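(* Assume that there exist $\mathbf l,\mathbf u\in C^1([0,T],\mathbb R)$ such that for every $t\in[0,T]$, $\mathbf l(t)<\mathbf u(t)$ and $C(t)=[\mathbf l(t),\mathbf u(t)]$. Assume that the kernel $K$ is bounded and that $\{u\in\mathbb R:K(u)\neq0\}=\,]A,B[$ for some real numbers $A<B$. If $A\geqslant0$, $t\in\mathcal E\cap[0,T[$ and $h_\varepsilon=\varepsilon^{1/(2-H)}$, then $$\varepsilon^{-1/(2-H)}\big(\widehat\tau_\varepsilon(t)-\tau(t)-\gamma_\varepsilon(t)\big)\longrightarrow\mu(t)\quad\text{in }\mathbb L^2\text{ as }\varepsilon\to0,$$ and $$\varepsilon^{-1/(2-H)}\dot\gamma_\varepsilon(t)\longrightarrow\mathcal N(0,\sigma_{H,K}^2)\quad\text{in distribution as }\varepsilon\to0,$$ where $$\mu(t)=\big(b(x(t))-b(x(0))+\dot y(t)-\dot y(0)\big)\int_A^BK(u)u\,du$$ and $$\sigma_{H,K}^2=H(2H-1)\int_A^B\int_A^B|u-v|^{2H-2}K(u)K(v)\,du\,dv.$$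
   Context: Setting. $T>0$; $b:\mathbb R\to\mathbb R$ is Lipschitz continuous; $B^H$ is a (standard) fractional Brownian motion with Hurst index $H\in\,]1/2,1[$; $C:[0,T]\rightrightarrows\mathbb R$ is a multifunction that is Lipschitz continuous for the Hausdorff distance; $x_0\in C(0)$. For a closed convex set $D\subset\mathbb R$ and $z\in\mathbb R$, the normal cone is $\mathcal N_D(z)=\{v\in\mathbb R:\forall w\in D,\ v(w-z)\leqslant 0\}$. For a continuous function $f$ of finite $1$-variation on $[0,T]$, $Df$ is its differential (Stieltjes) measure, $|Df|$ the variation measure of $Df$. For $\varepsilon>0$, $(X_\varepsilon,Y_\varepsilon)$ is the solution of the Skorokhod reflection problem: $X_\varepsilon,Y_\varepsilon$ have continuous paths on $[0,T]$, $Y_\varepsilon$ is of finite $1$-variation, $X_\varepsilon(t)\in C(t)$ for all $t$, $Y_\varepsilon(0)=x_0$, $$X_\varepsilon(t)=\int_0^t b(X_\varepsilon(s))ds+\varepsilon B^H(t)+Y_\varepsilon(t),\qquad -\frac{dDY_\varepsilon}{d|DY_\varepsilon|}(t)\in\mathcal N_{C(t)}(X_\varepsilon(t))\ \ |DY_\varepsilon|\text{-a.e.}$$ $(x,y)$ is the solution of the deterministic problem with $\varepsilon=0$: $x,y$ continuous, $y$ of finite $1$-variation, $x(t)\in C(t)$ for all $t$, $y(0)=x_0$, $x(t)=\int_0^t b(x(s))ds+y(t)$, $-\frac{dDy}{d|Dy|}(t)\in\mathcal N_{C(t)}(x(t))$ $|Dy|$-a.e. Under the hypotheses on $C$ in the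 claim, both problems have a unique solution, and $x,y$ are Lipschitz continuous (known). Trend and estimator. The trend is $\tau(t)=\int_0^t b(x(u))du+y(t)-x_0$, $t\in[0,T]$. A kernel is a measurable function $K:\mathbb R\to\mathbb R_+$ with $\int_{\mathbb R}K(u)du=1$; $K_h(\cdot)=\frac1hK(\cdot/h)$ for $h>0$. The bandwidth is $h_\varepsilon>0$. The estimator is $$\widehat\tau_\varepsilon(t)=\int_0^t\int_0^TK_{h_\varepsilon}(s-u)\,dX_\varepsilon(s)\,du,\quad t\in[0,T],$$ where integration with respect to $dX_\varepsilon(s)$ means $b(X_\varepsilon(s))ds+\varepsilon\,dB^H(s)+dY_\varepsilon(s)$, the integral against $B^H$ being the Wiener integral and that against $Y_\varepsilon$ the Lebesgue–Stieltjes integral. Moreover, $$\gamma_\varepsilon(t)=\varepsilon\int_0^t\int_0^TK_{h_\varepsilon}(s-u)\,dB^H(s)\,du,\qquad \dot\gamma_\varepsilon(t)=\varepsilon\int_0^TK_{h_\varepsilon}(s-t)\,dB^H(s).$$ The set $\mathcal E$. $\mathcal E=\mathcal E_{\mathbf l}\cup\mathcal E_{\mathbf u}\cup\mathcal E_{\mathrm{int}(C)}$, where for a multifunction $I:[0,T]\rightrightarrows\mathbb R$, $\mathcal E_I=\{s\in[0,T]:\exists\eta>0,\ \forall r\in\,]s-\eta,s+\eta[\,\cap[0,T],\ x(r)\in I(r)\}$; here $\mathbf l$ and $\mathbf u$ are identified with the multifunctions $t\mapsto\{\mathbf l(t)\}$ and $t\mapsto\{\mathbf u(t)\}$, and $\mathrm{int}(C)(t)=\mathrm{int}(C(t))=\,]\mathbf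 l(t),\mathbf u(t)[$. Derivative of $y$. $\dot y$ is the derivative of the Lipschitz function $y$ (so $y(v)-y(w)=\int_w^v\dot y(s)ds$ for $0\leqslant w<v\leqslant T$); $\dot y(t)$ is the derivative of $y$ at $t$ when $t\in\mathcal E\cap\,]0,T[$, and $\dot y(0)$ is the right derivative of $y$ at $0$ (these derivatives exist under the hypotheses of the claim). *)

(* Defs.v *)
From HB Require Import structures.
From mathcomp Require Export all_boot all_order all_algebra.
From mathcomp Require Export all_classical all_reals all_analysis.
Export Order.TTheory GRing.Theory Num.Theory.
Export numFieldNormedType.Exports.

Set Implicit Arguments.
Unset Strict Implicit.
Unset Printing Implicit Defensive.

Local Open Scope classical_set_scope.
Local Open Scope ring_scope.
Local Open Scope charge_scope.

Section deterministic_notions.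
Context {R : realType}.
Implicit Types (C : R -> set R) (T : R).

Definition normal_cone (D : set R) (z : R) : set R :=
  [set v | forall w, D w -> v * (w - z) <= 0].

Definition hausdorff_dist (A B : set R) : \bar R :=
  maxe (ereal_sup [set edist_inf B a | a in A])
       (ereal_sup [set edist_inf A b | b in B]).

Definition lipschitz_multifunction T C :=
  exists k : R, forall s t, s \in `[0, T] -> t \in `[0, T] ->
    (hausdorff_dist (C s) (C t) <= (k * `|s - t|)%:E)%E.

(* The derivatives at [0] and [T] are one-sided: difference quotients are
   taken only at points of [[0, T]]. *)
Definition C1_on T (f : R -> R) :=
  exists2 df : R -> R, {within `[0, T], continuous df} &
    forall t, t \in `[0, T] ->
      (f s - f t) / (s - t) @[s --> within `[0, T] t^'] --> df t.

Definition is_kernel (K : R -> R) :=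
  [/\ measurable_fun setT K, forall u, 0 <= K u &
      (\int[lebesgue_measure]_u (K u)%:E = 1)%E].

Definition scaled_kernel (K : R -> R) (h u : R) : R := h^-1 * K (u / h).

Definition sticking_set T (x : R -> R) (I : R -> set R) : set R :=
  [set s | s \in `[0, T] /\ exists2 eta : R, 0 < eta &
    forall r, r \in `]s - eta, s + eta[ -> r \in `[0, T] -> I r (x r)].

Definition E_set T (l u : R -> R) C (x : R -> R) : set R :=
  sticking_set T x (fun t => [set l t])
  `|` sticking_set T x (fun t => [set u t])
  `|` sticking_set T x (fun t => (C t)°).

Definition path_derivative (y : R -> R) (t : R) : R :=
  if t == 0 then lim ((y s - y 0) / s @[s --> 0^'+]) else derive1 y t.

End deterministic_notions.

Section charge_notions.
Context d (E : measurableType d) (R : realType).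
Variable nu : {charge set E -> \bar R}.

Definition hahn_pos : set E := sval (cid (Hahn_decomposition nu)).
Definition hahn_neg : set E := sval (cid (svalP (cid (Hahn_decomposition nu)))).

Lemma hahn_pos_negP : hahn_decomposition nu hahn_pos hahn_neg.
Proof. exact: (svalP (cid (svalP (cid (Hahn_decomposition nu))))). Qed.

Definition variation_measure := charge_variation hahn_pos_negP.

HB.instance Definition _ := Measure.on variation_measure.

Let variation_measure_fin : fin_num_fun variation_measure.
Proof.
move=> A mA; rewrite /variation_measure /charge_variation fin_numD.
by rewrite !fin_num_measure.
Qed.

HB.instance Definition _ :=
  @Measure_isFinite.Build _ _ _ variation_measure variation_measure_fin.

Definition charge_integral (D : set E) (f : E -> R) : R :=
  \int[jordan_pos hahn_pos_negP]_(x in D) f x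
  - \int[jordan_neg hahn_pos_negP]_(x in D) f x.

End charge_notions.

Section stieltjes.
Context {R : realType}.
Implicit Types (T : R) (f g : R -> R).

(* A continuous [f] has no jump at [0], so that [Df] carries no mass outside
   []0, T]]. *)
Definition is_differential_measure T f
    (nu : {charge set (measurableTypeR R) -> \bar R}) :=
  (forall s t : R, 0 <= s -> s <= t -> t <= T ->
     nu `]s, t]%classic = (f t - f s)%:E) /\
  (forall A, measurable A -> A `&` `]0, T]%classic = set0 -> nu A = 0%E).

(* [Df]; it is [czero] when [f] has no differential measure, which does not
   happen for [f] continuous and of finite 1-variation on [[0, T]]. *)
Definition differential_measure T f
    : {charge set (measurableTypeR R) -> \bar R} :=
  if pselect (exists nu, is_differential_measure T f nu) is left e
  then sval (cid e) else czero.

Definition stieltjes_integral T f g : R :=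
  charge_integral (differential_measure T f) `[0, T] g.

Definition skorokhod_solution (b : R -> R) (C : R -> set R) T (x0 : R)
    (z x y : R -> R) :=
  let Dy := differential_measure T y in
  [/\ {within `[0, T], continuous x}, {within `[0, T], continuous y} &
      bounded_variation 0 T y] /\
  [/\ forall t, t \in `[0, T] -> C t (x t),
      y 0 = x0,
      forall t, t \in `[0, T] ->
        x t = \int[lebesgue_measure]_(s in `[0, t]) b (x s) + z t + y t &
      {ae variation_measure Dy, forall t, t \in `[0, T] ->
        normal_cone (C t) (x t)
          (- fine (('d Dy '/d (variation_measure Dy)) t))}].

Definition trend (b x y : R -> R) (x0 t : R) : R :=
  \int[lebesgue_measure]_(s in `[0, t]) b (x s) + y t - x0.

End stieltjes.

Section probabilistic_notions.
Context d (Omega : measurableType d) (R : realType) (P : probability Omega R).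
Implicit Types (H T : R) (B : R -> {RV P >-> R}).

(* Standard deviation [s = 0] is the degenerate law; [normal_prob m 0] is not
   the Dirac mass. *)
Definition gaussian_law (m s : R) : set (measurableTypeR R) -> \bar R :=
  if s == 0 then \d_m else normal_prob m s.

Definition is_gaussian (f : Omega -> R) :=
  measurable_fun setT f /\
  exists m s : R, forall A : set (measurableTypeR R), measurable A ->
    P (f @^-1` A) = gaussian_law m s A.

Definition gaussian_process T B :=
  forall (n : nat) (a t : 'I_n -> R), (forall i, t i \in `[0, T]) ->
    is_gaussian (fun w => \sum_(i < n) a i * B (t i) w).

Definition fractional_brownian_motion T H B :=
  [/\ gaussian_process T B,
      forall t, t \in `[0, T] -> ('E_P[B t] = 0)%E,
      forall s t, s \in `[0, T] -> t \in `[0, T] ->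
        covariance P (B s) (B t) =
        (2^-1 * (s `^ (2 * H) + t `^ (2 * H) - `|t - s| `^ (2 * H)))%:E &
      forall w, {within `[0, T], continuous (fun t => B t w)}].

Definition cvg_L2 (I : Type) (F : set_system I) (f : I -> Omega -> R)
    (g : Omega -> R) :=
  [/\ g \in Lfun P 2%:E, \forall i \near F, f i \in Lfun P 2%:E &
      Lnorm P 2%:E (EFin \o (f i \- g)) @[i --> F] --> 0%E].

Definition cvg_in_law (I : Type) (F : set_system I) (f : I -> Omega -> R)
    (mu : {measure set (measurableTypeR R) -> \bar R}) :=
  (\forall i \near F, measurable_fun setT (f i)) /\
  forall phi : R -> R, continuous phi -> bounded_fun phi ->
    ('E_P[phi \o f i])%E @[i --> F] --> (\int[mu]_x (phi x)%:E)%E.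

(* A step function [\sum_k a_k \1_(]s_k, t_k])] is given by the list of the
   triples [(a_k, s_k, t_k)]. *)
Definition valid_step T (phi : seq (R * R * R)) :=
  all (fun q => (0 <= q.1.2) && (q.1.2 <= q.2) && (q.2 <= T)) phi.

Definition step_fun (phi : seq (R * R * R)) (r : R) : R :=
  \sum_(q <- phi) q.1.1 * \1_(`]q.1.2, q.2]) r.

Definition step_integral B (phi : seq (R * R * R)) (w : Omega) : R :=
  \sum_(q <- phi) q.1.1 * (B q.2 w - B q.1.2 w).

Definition fbm_sqnorm T H (f : R -> R) : \bar R :=
  ((H * (2 * H - 1))%:E *
   \int[lebesgue_measure]_(r in `[0%R, T]) \int[lebesgue_measure]_(v in `[0%R, T])
     (`|r - v| `^ (2 * H - 2) * f r * f v)%R%:E)%E.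

(* [Z] is a version of the Wiener integral [\int_0^T f dB]. *)
Definition is_wiener_integral T H B (f : R -> R) (Z : Omega -> R) :=
  exists phi : nat -> seq (R * R * R),
    [/\ forall n, valid_step T (phi n),
        fbm_sqnorm T H (f \- step_fun (phi n)) @[n --> \oo] --> 0%E &
        cvg_L2 \oo (fun n => step_integral B (phi n)) Z].

(* A jointly measurable version, as needed for the integral in [r] below, of
   the Wiener integrals of [s |-> K_h (s - r)], [r \in [0, T]]. *)
Definition is_kernel_wiener_process T H B (K : R -> R) (h : R)
    (Z : R -> Omega -> R) :=
  measurable_fun (`[0, T] `*` setT)
    (fun p : measurableTypeR R * Omega => Z p.1 p.2) /\
  forall r, r \in `[0, T] ->
    is_wiener_integral T H B (fun s => scaled_kernel K h (s - r)) (Z r).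

Definition gamma_dot (eps : R) (Z : R -> Omega -> R) (t : R) (w : Omega) : R :=
  eps * Z t w.

Definition gamma (eps : R) (Z : R -> Omega -> R) (t : R) (w : Omega) : R :=
  eps * \int[lebesgue_measure]_(r in `[0, t]) Z r w.

Definition trend_estimator T (b K : R -> R) (h eps : R) (X Y Z : R -> Omega -> R)
    (t : R) (w : Omega) : R :=
  \int[lebesgue_measure]_(r in `[0, t])
    (\int[lebesgue_measure]_(s in `[0, T])
        (scaled_kernel K h (s - r) * b (X s w))
     + eps * Z r w
     + stieltjes_integral T (fun s => Y s w)
         (fun s => scaled_kernel K h (s - r))).

End probabilistic_notions.

Definition bandwidth {R : realType} (H eps : R) : R := eps `^ ((2 - H)^-1).

Definition trend_bias {R : realType} (b x y K : R -> R) (A B t : R) : R :=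
  (b (x t) - b (x 0) + path_derivative y t - path_derivative y 0) *
  \int[lebesgue_measure]_(v in `[A, B]) (K v * v).

Definition limit_variance {R : realType} (H : R) (K : R -> R) (A B : R) : R :=
  H * (2 * H - 1) *
  \int[lebesgue_measure]_(r in `[A, B]) \int[lebesgue_measure]_(v in `[A, B])
    (`|r - v| `^ (2 * H - 2) * K r * K v).

(* Main.v *)
From HB Require Import structures.
Require Import Defs.
From mathcomp Require Import measurable_realfun ring lra.

(** Write [h] for the bandwidth and [V] for the process [X eps - eps * BH], that is,
    drift plus reflection of the perturbed equation. Substituting [r = s - h z] in
    the double integral defining the estimator turns the weights [K_h (s - r)],
    averaged over [r] in [[0, t]], into an average over [z] of increments: once the
    noise term [gamma] is removed, the estimator is the integral of
    [K z * (V (t + h z) - V (h z))]. This is an application of Tonelli's theorem,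
    path by path, to Lebesgue measure and to the two Jordan parts of the
    differential measure of the reflection term ([solution_averages]). As [A >= 0]
    and [t < T], only times of [[0, T]] occur when [eps] is small.

    Two errors remain in the comparison with the trend, which is [x t - x 0].
    Replacing [V] by the deterministic solution [x] costs at most a constant times
    [eps * sup |BH|], because the reflected equation is stable for the uniform norm
    ([reflected_stability]); divided by [h = eps `^ (1 / (2 - H))] this is a positive
    power of [eps] times a variable of finite second moment ([fbm_sup_square]). The
    remaining deterministic quantity, the integral of
    [K z * ((x (t + h z) - x t) - (x (h z) - x 0))], is of first order in [h]: on the
    set E and at time [0], [x] has the derivative [b (x) + y'] ([solution_slope]),
    and the difference of the two derivatives, multiplied by the first moment of
    [K], is the announced bias.

    For the second convergence, the Wiener integral of [K_h (s - t)] is a limit in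
    quadratic mean of Gaussian variables, so it is centered Gaussian
    ([gaussian_L2_limit_law]), and its variance is the value of the covariance form
    of fractional noise at the kernel ([wiener_isometry]). That form is homogeneous
    under dilations ([energy_scaling]); with the given bandwidth the rescaled
    variance equals the limit variance as soon as the kernel fits into [[0, T]], and
    the law is then constant in [eps].

    The covariance form itself, the double integral of
    [|r - v| `^ (2 H - 2) f r g v], is handled from its values on indicators, where
    it reproduces the covariance of fractional Brownian motion
    ([singular_form_indic]), by density of step functions ([step_dense]). The
    process [r |-> Z r] is square integrable for each [r] but a given path of it may
    fail to be integrable in [r]; such paths form a null set ([ae_integrable_paths])
    on which both noise integrals are [0] by convention ([noisy_average]). *)

Set Implicit Arguments.
Unset Strict Implicit.
Unset Printing Implicit Defensive.

Local Open Scope classical_set_scope.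
Local Open Scope ring_scope.
Local Open Scope charge_scope.

(** * Differential measures and the direction of the reflection *)

Section restricted_stieltjes.
Context {R : realType} (F : cumulative R R) (T : R).

Definition restricted_stieltjes : set (measurableTypeR R) -> \bar R :=
  mrestr (lebesgue_stieltjes_measure F) (measurable_itv `]0, T]).

HB.instance Definition _ := Measure.on restricted_stieltjes.

Lemma stieltjes_itv (s t : R) : s <= t ->
  lebesgue_stieltjes_measure F `]s, t]%classic = (F t - F s)%:E.
Proof.
move=> st; transitivity (wlength F `]s, t]%classic).
  by apply: measurable_mu_extE; exact: is_ocitv.
by rewrite wlength_itv_bnd.
Qed.

Let fin_restricted : fin_num_fun restricted_stieltjes.
Proof.
move=> A mA; rewrite ge0_fin_numE//.
apply: (@le_lt_trans _ _ (lebesgue_stieltjes_measure F `]0, T]%classic)).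
  rewrite /restricted_stieltjes /mrestr; apply: le_measure; rewrite ?inE//.
  by apply: measurableI => //; exact: measurable_itv.
have [T0|T0] := leP 0 T; first by rewrite stieltjes_itv// ltry.
by rewrite set_itv_ge ?measure0// bnd_simp -leNgt ltW.
Qed.

HB.instance Definition _ :=
  @Measure_isFinite.Build _ _ _ restricted_stieltjes fin_restricted.

End restricted_stieltjes.

(** Extended by its end values, the path becomes a cumulative function on the
    line, to which the Lebesgue-Stieltjes construction applies. *)
Lemma nondecreasing_stieltjes_measure {R : realType} (T : R) (f : R -> R) :
  0 < T -> {in `[0, T] &, {homo f : x y / x <= y}} ->
  (forall r, 0 <= r -> r < T -> f s @[s --> r^'+] --> f r) ->
  exists nu : {finite_measure set (measurableTypeR R) -> \bar R},
  (forall s t : R, 0 <= s -> s <= t -> t <= T ->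
     nu `]s, t]%classic = (f t - f s)%:E) /\
  (forall A, measurable A -> A `&` `]0, T]%classic = set0 -> nu A = 0%E).
Proof.
move=> T0 ndf rcf.
(* projection of the line onto [0, T] *)
pose clamp (r : R) := Num.max 0 (Num.min T r).
have clamp_in r : clamp r \in `[0, T].
  rewrite in_itv/= /clamp; rewrite le_max lexx/= ge_max ltW//=.
  by rewrite ge_min lexx.
have clampE r : 0 <= r -> r <= T -> clamp r = r.
  by move=> r0 rT; rewrite /clamp (min_idPr rT) (max_idPr r0).
pose g := f \o clamp.
have ndg : nondecreasing g.
  move=> r s rs /=; apply: ndf; rewrite ?clamp_in//.
  rewrite /clamp; rewrite ge_max !le_max lexx/=.
  by apply/orP; right; rewrite le_min !ge_min lexx/= rs orbT.
have rcg : forall r, g @ r^'+ --> g r.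
  move=> r; have [r0|r0] := ltP r 0.
    have : g r @[_ --> r^'+] --> g r by exact: cvg_cst.
    apply: cvg_trans; apply: near_eq_cvg; near=> s.
    have s0 : s < 0 by near: s; exact: nbhs_right_lt.
    have c0 q : q < 0 -> clamp q = 0.
      move=> q0; rewrite /clamp; apply/max_idPl.
      by rewrite ge_min (ltW q0) orbT.
    by rewrite /g/= !c0.
  have [rT|rT] := ltP r T.
    rewrite /g/= clampE//; last exact: ltW.
    apply: cvg_trans (rcf r r0 rT); apply: near_eq_cvg; near=> s.
    rewrite /= clampE//; first by apply: (le_trans r0); near: s; exact: nbhs_right_ge.
    by near: s; exact: nbhs_right_le.
  have : g r @[_ --> r^'+] --> g r by exact: cvg_cst.
    apply: cvg_trans; apply: near_eq_cvg; near=> s.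
  have rs : r <= s by near: s; exact: nbhs_right_ge.
  have cT q : T <= q -> clamp q = T.
    by move=> Tq; rewrite /clamp (min_idPl Tq); apply/max_idPr; exact: ltW.
  by rewrite /g/= !cT// (le_trans rT).
pose F : cumulative R R := HB.pack g (isCumulative.Build R _ R g ndg rcg).
exists [the {finite_measure set (measurableTypeR R) -> \bar R}
        of restricted_stieltjes F T].
split.
  move=> s t s0 st tT; rewrite /= /restricted_stieltjes /mrestr.
  have -> : `]s, t] `&` `]0, T]%classic = `]s, t]%classic.
    apply/setIidPl => r /=; rewrite !in_itv/= => /andP[sr rt].
    by rewrite (le_lt_trans s0)//= (le_trans rt).
  rewrite stieltjes_itv//= /g/= !clampE//.
  exact: le_trans st tT. exact: le_trans s0 st.
move=> A mA A0; rewrite /= /restricted_stieltjes /mrestr A0.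
by rewrite measure0.
Unshelve. all: by end_near. Qed.

(** A path of bounded variation is the difference of its positive and negative
    variations; continuity of the path makes both right-continuous, and the
    difference of their Stieltjes measures has the required increments. Thus [Df]
    is never the default charge for the paths of a Skorokhod problem. *)
Lemma differential_measureP {R : realType} (T : R) (f : R -> R) :
  0 < T -> {within `[0, T], continuous f} -> bounded_variation 0 T f ->
  is_differential_measure T f (differential_measure T f).
Proof.
move=> T0 cf bvf; rewrite /differential_measure.
case: pselect => [e|]; first exact: svalP.
case.
have rcf : forall r, 0 <= r -> r < T -> f s @[s --> r^'+] --> f r.
  have [cf1 cf2 _] := (continuous_within_itvP f T0).1 cf.
  move=> r; rewrite le_eqVlt => /predU1P[<- //|r0 rT].
  by apply: cvg_at_right_filter; apply: cf1; rewrite in_itv/= r0.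
have [|||mn [mn1 mn2]] := @nondecreasing_stieltjes_measure R T (fine \o neg_tv 0 f) => //.
  exact: fine_neg_tv_nondecreasing.
  move=> r r0 rT; apply: (neg_tv_right_continuous r0 rT) => //.
  exact: rcf.
have bvNf := bounded_variationN bvf.
have [|||mp [mp1 mp2]] := @nondecreasing_stieltjes_measure R T (fine \o pos_tv 0 f) => //.
  exact: fine_neg_tv_nondecreasing.
  move=> r r0 rT; apply: (neg_tv_right_continuous r0 rT) => //.
  by apply: cvgN; exact: rcf.
exists (cadd (charge_of_finite_measure mp) (copp (charge_of_finite_measure mn))).
split.
  move=> s t s0 st tT.
  transitivity (mp `]s, t]%classic - mn `]s, t]%classic)%E; first by [].
  rewrite mn1// mp1//.
  rewrite (bounded_variation_pos_neg_tvE bvf); last first.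
    by rewrite in_itv/= (le_trans s0 st).
  rewrite (bounded_variation_pos_neg_tvE bvf); last first.
    by rewrite in_itv/= s0/= (le_trans st tT).
  by rewrite -EFinB; congr EFin => /=; ring.
move=> A mA A0.
transitivity (mp A - mn A)%E; first by [].
by rewrite mn2// mp2// sube0.
Qed.

Lemma normal_cone_itv_left {R : realType} (l u x v : R) : l <= x -> x < u ->
  normal_cone `[l, u]%classic x v -> v <= 0.
Proof.
move=> lx xu /(_ u); rewrite /= in_itv/= lexx (le_trans lx (ltW xu)).
by move=> /(_ isT); rewrite pmulr_lle0// subr_gt0.
Qed.

Lemma normal_cone_itv_right {R : realType} (l u x v : R) : l < x -> x <= u ->
  normal_cone `[l, u]%classic x v -> 0 <= v.
Proof.
move=> lx xu /(_ l); rewrite /= in_itv/= lexx (le_trans (ltW lx) xu).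
by move=> /(_ isT); rewrite nmulr_lle0// subr_lt0.
Qed.

(** Domination is what gives [dDy / d|Dy|] its meaning as a density, so that the
    normal cone condition says something about [Dy]. *)
Lemma charge_dominated_variation d (E : measurableType d) (R : realType)
   (nu : {charge set E -> \bar R}) : nu `<< variation_measure nu.
Proof.
apply/null_content_dominatesP => A mA /eqP vA.
have := abse_charge_variation (hahn_pos_negP nu) mA.
rewrite -/(variation_measure nu) (eqP vA) => h.
by apply/eqP; rewrite -abse_eq0 eq_le h abse_ge0.
Qed.

Lemma ae_ge0_integral d (E : measurableType d) (R : realType)
    (m : {measure set E -> \bar R}) (D : set E) (f : E -> \bar R) :
  measurable D -> measurable_fun D f -> {ae m, forall t, D t -> (0 <= f t)%E} ->
  (0 <= \int[m]_(t in D) f t)%E.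
Proof.
move=> mD mf f0.
rewrite (@ae_eq_integral _ _ _ m D (abse \o f))//.
- by apply: integral_ge0 => t _ /=.
- exact: measurableT_comp.
- by apply: filterS f0 => t h Dt /=; rewrite gee0_abs// h.
Qed.

Section charge_sign.
Context d (E : measurableType d) (R : realType) (nu : {charge set E -> \bar R})
  (m : {sigma_finite_measure set E -> \bar R}) (D : set E).
Hypotheses (num : nu `<< m) (mD : measurable D).

Lemma Radon_Nikodym_charge_ge0 :
  {ae m, forall t, D t -> 0 <= fine ('d nu '/d m t)} -> (0 <= nu D)%E.
Proof.
move=> h; rewrite (Radon_Nikodym_integral num)//; apply: ae_ge0_integral => //.
  have /integrableP[mf _] := Radon_Nikodym_integrable num.
  exact: measurable_funTS.
apply: filterS h => t /[apply].
by rewrite -lee_fin fineK ?Radon_Nikodym_fin_num.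
Qed.

Lemma Radon_Nikodym_charge_le0 :
  {ae m, forall t, D t -> fine ('d nu '/d m t) <= 0} -> (nu D <= 0)%E.
Proof.
move=> h; rewrite (Radon_Nikodym_integral num)// -oppe_ge0.
have fi : m.-integrable D ('d nu '/d m).
  exact: integrableS (Radon_Nikodym_integrable num).
rewrite -integralN; last exact/integrable_add_def.
apply: ae_ge0_integral => //.
  by have /integrableP[mf _] := fi; exact: measurableT_comp.
apply: filterS h => t /[apply].
by rewrite -lee_fin fineK ?Radon_Nikodym_fin_num// oppe_ge0.
Qed.

End charge_sign.

Section skorokhod_monotone.
Context {R : realType} (b : R -> R) (C : R -> set R) (T x0 : R)
  (z x y : R -> R) (l u : R -> R).
Hypothesis T_gt0 : 0 < T.
Hypothesis C_itv : forall t, t \in `[0, T] -> C t = `[l t, u t]%classic.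
Hypothesis xy_sol : skorokhod_solution b C T x0 z x y.

(** Strictly below the upper barrier the normal cone, which contains the opposite
    of the density of [Dy], has no positive element: the reflection can only push
    up. *)
Lemma skorokhod_nondecreasing (s t : R) : 0 <= s -> s <= t -> t <= T ->
  (forall r, s < r -> r <= t -> x r < u r) -> y s <= y t.
Proof.
move=> s0 st tT xu.
have [[_ cy bvy] [xC _ _ cone]] := xy_sol.
have dom := @charge_dominated_variation _ _ _ (differential_measure T y).
have [D1 _] := differential_measureP T_gt0 cy bvy.
rewrite -subr_ge0 -lee_fin -D1//; apply: (Radon_Nikodym_charge_ge0 dom) => //.
apply: negligibleS cone => r; apply: contra_not => h.
rewrite /= in_itv/= => /andP[sr rt].
have rT : r \in `[0, T].
  by rewrite in_itv/= (le_trans s0 (ltW sr)) (le_trans rt tT).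
rewrite -oppr_le0.
move: (h rT) (xC _ rT); rewrite C_itv//= in_itv/= => hn /andP[lx _].
exact: normal_cone_itv_left lx (xu _ sr rt) hn.
Qed.

Lemma skorokhod_nonincreasing (s t : R) : 0 <= s -> s <= t -> t <= T ->
  (forall r, s < r -> r <= t -> l r < x r) -> y t <= y s.
Proof.
move=> s0 st tT xu.
have [[_ cy bvy] [xC _ _ cone]] := xy_sol.
have dom := @charge_dominated_variation _ _ _ (differential_measure T y).
have [D1 _] := differential_measureP T_gt0 cy bvy.
rewrite -subr_le0 -lee_fin -D1//; apply: (Radon_Nikodym_charge_le0 dom) => //.
apply: negligibleS cone => r; apply: contra_not => h.
rewrite /= in_itv/= => /andP[sr rt].
have rT : r \in `[0, T].
  by rewrite in_itv/= (le_trans s0 (ltW sr)) (le_trans rt tT).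
rewrite -oppr_ge0.
move: (h rT) (xC _ rT); rewrite C_itv//= in_itv/= => hn /andP[_ ux].
exact: normal_cone_itv_right (xu _ sr rt) ux hn.
Qed.

End skorokhod_monotone.

(** * Stability of reflected equations *)

Section integrable_real.
Context d (E : measurableType d) (R : realType) (m : {measure set E -> \bar R})
  (D : set E).
Hypothesis mD : measurable D.
Implicit Types f g : E -> R.

Lemma integrable_EFinB f g : m.-integrable D (EFin \o f) ->
  m.-integrable D (EFin \o g) -> m.-integrable D (fun x => (f x - g x)%:E).
Proof. by move=> fi gi; exact: (integrableB _ fi gi). Qed.

Lemma integrable_EFinD f g : m.-integrable D (EFin \o f) ->
  m.-integrable D (EFin \o g) -> m.-integrable D (fun x => (f x + g x)%:E).
Proof. by move=> fi gi; exact: (integrableD _ fi gi). Qed.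

Lemma integrable_EFinZ (k : R) f : m.-integrable D (EFin \o f) ->
  m.-integrable D (fun x => (k * f x)%:E).
Proof. by move=> fi; exact: (integrableZl _ k fi). Qed.

Lemma integrable_EFin_norm f : m.-integrable D (EFin \o f) ->
  m.-integrable D (fun x => `|f x|%:E).
Proof. by move=> fi; exact: (integrable_abse fi). Qed.

End integrable_real.

Section continuity_helpers.
Context {R : realType}.
Implicit Types (f : R -> R) (a b s t : R).

Lemma within_itv_dist a b f s (e : R) : {within `[a, b], continuous f} ->
  s \in `[a, b] -> 0 < e ->
  exists2 d : R, 0 < d & forall r, r \in `[a, b] -> `|r - s| < d ->
    `|f r - f s| < e.
Proof.
move=> /subspace_continuousP cf sab e0.
have /cvgrPdist_lt/(_ _ e0) := cf s sab.
rewrite /within => /nbhs_ballP[d /= d0 dP]; exists d => // r rab rs.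
by rewrite distrC; apply: (dP r) => //; rewrite /ball/= distrC.
Qed.

Lemma continuous_within_sub a b c d f : `[c, d]%classic `<=` `[a, b]%classic ->
  {within `[a, b], continuous f} -> {within `[c, d], continuous f}.
Proof. exact: continuous_subspaceW. Qed.

(** The starting point of the comparison arguments below: after the supremum of
    the times at which [f <= e], the strict inequality holds throughout. *)
Lemma last_sublevel_time (f : R -> R) (e t : R) : 0 <= t ->
  {within `[0, t], continuous f} -> f 0 <= e ->
  exists2 s, s \in `[0, t] & f s <= e /\ forall r, s < r -> r <= t -> e < f r.
Proof.
move=> t0 cf f0.
pose S := [set r | r \in `[0, t] /\ f r <= e].
have S0 : S 0 by split => //; rewrite in_itv/= lexx.
have Sub : ubound S t by move=> r [+ _]; rewrite in_itv/= => /andP[].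
have hS : has_sup S by split; [exists 0|exists t].
have sup0 : 0 <= sup S by exact: (ub_le_sup hS.2).
have supt : sup S <= t by apply: ge_sup => //; exists 0.
have sin : sup S \in `[0, t] by rewrite in_itv/= sup0.
exists (sup S) => //; split.
  rewrite leNgt; apply/negP => fe.
  have [d d0 dP] := within_itv_dist cf sin (let h : 0 < f (sup S) - e := ltac:(by rewrite subr_gt0) in h).
  have [r [rin fr] rs] := sup_adherent d0 hS.
  have rle : r <= sup S by exact: (ub_le_sup hS.2).
  have : `|r - sup S| < d by rewrite distrC ger0_norm ?subr_ge0//; lra.
  move=> /(dP r rin); rewrite ltr_norml; lra.
move=> r sr rt; rewrite ltNge; apply/negP => fr.
have : r <= sup S.
  apply: (ub_le_sup hS.2); split => //.
  by rewrite in_itv/= rt (le_trans sup0 (ltW sr)).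
by rewrite leNgt sr.
Qed.

Lemma continuous_itv_integrable a b f : {within `[a, b], continuous f} ->
  lebesgue_measure.-integrable `[a, b] (EFin \o f).
Proof. by move=> cf; apply: continuous_compact_integrable => //; exact: segment_compact. Qed.

Lemma exp_integral (c t : R) : 0 < c -> 0 <= t ->
  \int[lebesgue_measure]_(s in `[0, t]) expR (c * s) = (expR (c * t) - 1) / c.
Proof.
move=> c0; rewrite le_eqVlt => /predU1P[<-|t0].
  by rewrite set_itv1 Rintegral_set1 mulr0 expR0 subrr mul0r.
have der (s : R) : is_derive s 1 (fun r => expR (c * r) / c) (expR (c * s)).
  apply: is_derive_eq.
  by rewrite /GRing.scale/= mulr1 mulr0 add0r; field; rewrite gt_eqF.
have cexp : continuous (fun r : R => expR (c * r)).
  move=> s; apply: continuous_comp; last exact: continuous_expR.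
  exact: mulrl_continuous.
rewrite /Rintegral (@continuous_FTC2 _ _ (fun r => expR (c * r) / c))//.
- by rewrite mulr0 expR0 -EFinB /= -mulrBl.
- exact: continuous_subspaceT.
- have cF : continuous (fun r : R => expR (c * r) / c).
    by move=> s; apply: cvgMl; exact: cexp.
  by split => [s _| |]; [have [] := der s|apply: cvg_at_right_filter; exact: cF|apply: cvg_at_left_filter; exact: cF].
- by move=> s _; rewrite derive1E; have [_ ->] := der s.
Qed.

(** At a maximum point [s] of [expR (- 2 c t) * f t], the integral of [f] up to
    [s] is bounded by that of the maximum times [expR (2 c r)], hence by
    [f s / (2 c)]: half of [f s] is absorbed in the left-hand side. *)
Lemma gronwall_sup (T c a : R) f : 0 < T -> 0 < c -> 0 <= a ->
  {within `[0, T], continuous f} ->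
  (forall t, t \in `[0, T] -> 0 <= f t) ->
  (forall t, t \in `[0, T] ->
     f t <= a + c * \int[lebesgue_measure]_(s in `[0, t]) f s) ->
  forall t, t \in `[0, T] -> f t <= 2 * a * expR (2 * c * T).
Proof.
move=> T0 c0 a0 cf f0 fle.
pose g t := expR (- (2 * c * t)) * f t.
have cg : {within `[0, T], continuous g}.
  move=> t; apply: cvgM; last exact: cf.
  apply: continuous_subspaceT => s; apply: continuous_comp; last exact: continuous_expR.
  by apply: cvgN; exact: mulrl_continuous.
have [s sin gmax] := EVT_max (ltW T0) cg.
have ge t : t \in `[0, T] -> f t <= g s * expR (2 * c * t).
  move=> tin; have := gmax t tin.
  by rewrite {1}/g expRN mulrC ler_pdivrMr ?expR_gt0.
have [s0 sT] : 0 <= s /\ s <= T by move: sin; rewrite in_itv/= => /andP[].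
have c20 : 0 < 2 * c by rewrite mulr_gt0.
have sub : `[0, s]%classic `<=` `[0, T]%classic.
  by move=> r /=; rewrite !in_itv/= => /andP[-> /=] /le_trans; apply.
have fs : f s <= a + c * (g s * ((expR (2 * c * s) - 1) / (2 * c))).
  apply: (le_trans (fle s sin)); rewrite lerD2l ler_pM2l//.
  rewrite -exp_integral//.
  have ie : lebesgue_measure.-integrable `[0, s] (EFin \o (fun r => expR (2 * c * r))).
    apply: continuous_itv_integrable; apply: continuous_subspaceT => r.
    apply: continuous_comp; last exact: continuous_expR.
    exact: mulrl_continuous.
  rewrite -RintegralZl//; apply: le_Rintegral => //.
  - by apply: continuous_itv_integrable; exact: continuous_within_sub cf.
  - have := @integrableZl _ _ _ lebesgue_measure _ (measurable_itv `[0, s]) (g s) _ ie.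
    by apply.
  - by move=> r rs; apply: ge; exact: sub.
have gs0 : 0 <= g s by rewrite mulr_ge0 ?expR_ge0// f0.
have gsE : g s * expR (2 * c * s) = f s.
  by rewrite /g mulrAC -expRD addNr expR0 mul1r.
have fs2 : f s <= 2 * a.
  have e : c * (g s * ((expR (2 * c * s) - 1) / (2 * c))) = (f s - g s) / 2.
    by rewrite -gsE; field; rewrite gt_eqF.
  move: fs; rewrite e; lra.
have gs2 : g s <= 2 * a.
  apply: le_trans fs2; rewrite -gsE ler_peMr// -[leLHS]expR0 ler_expR.
  by rewrite mulr_ge0// ltW.
move=> t tin; apply: (le_trans (ge t tin)).
rewrite ler_pM ?expR_ge0// ler_expR ler_pM2l//.
by move: tin; rewrite in_itv/= => /andP[].
Qed.

End continuity_helpers.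

Section reflection.
Context {R : realType} (T : R) (l u : R -> R).
Hypothesis T_gt0 : 0 < T.

(** The consequences of the normal cone condition that comparison arguments use.
    They mention no measure, so two solutions can be compared pointwise in time. *)
Definition reflection_rule (x y : R -> R) :=
  [/\ {within `[0, T], continuous y},
      forall t, t \in `[0, T] -> l t <= x t <= u t,
      forall s t, 0 <= s -> s <= t -> t <= T ->
        (forall r, s < r -> r <= t -> x r < u r) -> y s <= y t &
      forall s t, 0 <= s -> s <= t -> t <= T ->
        (forall r, s < r -> r <= t -> l r < x r) -> y t <= y s].

(** If [y1 - y2] exceeds [e] at [t], then on the interval since it last did not,
    [x2 < x1]. There [x1] is off the lower barrier and [x2] off the upper one, so
    [y1] does not increase and [y2] does not decrease: the gap cannot have grown. *)
Lemma reflection_one_sided (x1 y1 x2 y2 : R -> R) (e t : R) :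
  reflection_rule x1 y1 -> reflection_rule x2 y2 ->
  y1 0 - y2 0 <= e -> t \in `[0, T] ->
  (forall r, 0 <= r -> r <= t -> (x2 r - y2 r) - (x1 r - y1 r) <= e) ->
  y1 t - y2 t <= e.
Proof.
move=> [cy1 lu1 up1 down1] [cy2 lu2 up2 down2] y0 tin fle.
move: (tin); rewrite in_itv/= => /andP[t0 tT].
have sub : `[0, t]%classic `<=` `[0, T]%classic.
  by move=> r /=; rewrite !in_itv/= => /andP[-> /=] /le_trans; apply.
have cD : {within `[0, t], continuous (fun r => y1 r - y2 r)}.
  by move=> r; apply: cvgB; [exact: continuous_within_sub cy1 _|exact: continuous_within_sub cy2 _].
have [s sin [Ds Dlt]] := last_sublevel_time t0 cD y0.
move: sin; rewrite in_itv/= => /andP[s0 st].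
have x21 r : s < r -> r <= t -> x2 r < x1 r.
  move=> sr rt; have := fle r (le_trans s0 (ltW sr)) rt.
  by have := Dlt r sr rt; lra.
have rin r : s < r -> r <= t -> r \in `[0, T].
  by move=> sr rt; rewrite in_itv/= (le_trans s0 (ltW sr)) (le_trans rt).
have h1 : y1 t <= y1 s.
  apply: down1 => // r sr rt; apply: le_lt_trans (x21 r sr rt).
  by have /andP[] := lu2 r (rin r sr rt).
have h2 : y2 s <= y2 t.
  apply: up2 => // r sr rt; apply: lt_le_trans (x21 r sr rt) _.
  by have /andP[] := lu1 r (rin r sr rt).
lra.
Qed.

Lemma reflection_lipschitz (x1 y1 x2 y2 : R -> R) (e t : R) :
  reflection_rule x1 y1 -> reflection_rule x2 y2 ->
  y1 0 = y2 0 -> t \in `[0, T] ->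
  (forall r, 0 <= r -> r <= t -> `|(x1 r - y1 r) - (x2 r - y2 r)| <= e) ->
  `|x1 t - x2 t| <= 2 * e.
Proof.
move=> r1 r2 y0 tin fle.
move: (tin); rewrite in_itv/= => /andP[t0 tT].
have e0 : 0 <= e by apply: le_trans (fle 0 _ _).
have h1 : y1 t - y2 t <= e.
  apply: (reflection_one_sided r1 r2) => //; first by rewrite y0 subrr.
  by move=> r r0 rt; have := fle r r0 rt; rewrite ler_norml; lra.
have h2 : y2 t - y1 t <= e.
  apply: (reflection_one_sided r2 r1) => //; first by rewrite y0 subrr.
  by move=> r r0 rt; have := fle r r0 rt; rewrite ler_norml; lra.
by have := fle t t0 (lexx _); rewrite !ler_norml; lra.
Qed.

End reflection.

Lemma lipschitz_constant {R : realType} (b : R -> R) : lipschitz b ->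
  exists2 L, 0 < L & forall r s, `|b r - b s| <= L * `|r - s|.
Proof.
move=> [L [Lr hL]]; exists (`|L| + 1); first by rewrite ltr_wpDl.
move=> r s; have /hL/(_ (r, s)) : L < `|L| + 1 by rewrite (le_lt_trans (ler_norm L))// ltrDl.
by apply.
Qed.

Lemma lipschitz_continuous_fun {R : realType} (b : R -> R) (L : R) :
  0 < L -> (forall r s, `|b r - b s| <= L * `|r - s|) -> continuous b.
Proof.
move=> L0 bL x; apply/cvgrPdist_lt => e e0; near=> y.
apply: (le_lt_trans (bL _ _)); rewrite -ltr_pdivlMl//.
by near: y; apply: cvgr_dist_lt; rewrite ?mulr_gt0 ?invr_gt0.
Unshelve. all: by end_near. Qed.

Lemma lipschitz_comp_within {R : realType} (b x : R -> R) (L T : R) :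
  0 < L -> (forall r s, `|b r - b s| <= L * `|r - s|) ->
  {within `[0, T], continuous x} -> {within `[0, T], continuous (b \o x)}.
Proof.
move=> L0 bL cx t.
apply: (@continuous_comp (subspace `[0, T]) _ _ x b); first exact: cx.
exact: (lipschitz_continuous_fun L0 bL).
Qed.

Section skorokhod_stability.
Context {R : realType} (T : R) (l u : R -> R) (b : R -> R) (L : R).
Hypothesis T_gt0 : 0 < T.
Hypothesis L_gt0 : 0 < L.
Hypothesis bL : forall r s, `|b r - b s| <= L * `|r - s|.

(** The reflection is Lipschitz for the uniform distance of the free parts
    [x - y], and these differ by the noises plus an integral of [x1 - x2], to
    which Gronwall's lemma applies. *)
Lemma reflected_stability (z1 x1 y1 z2 x2 y2 : R -> R) (e : R) :
  reflection_rule T l u x1 y1 -> reflection_rule T l u x2 y2 ->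
  {within `[0, T], continuous x1} -> {within `[0, T], continuous x2} ->
  y1 0 = y2 0 ->
  (forall t, t \in `[0, T] ->
    x1 t = \int[lebesgue_measure]_(s in `[0, t]) b (x1 s) + z1 t + y1 t) ->
  (forall t, t \in `[0, T] ->
    x2 t = \int[lebesgue_measure]_(s in `[0, t]) b (x2 s) + z2 t + y2 t) ->
  0 <= e -> (forall t, t \in `[0, T] -> `|z1 t - z2 t| <= e) ->
  forall t, t \in `[0, T] -> `|x1 t - x2 t| <= 4 * e * expR (4 * L * T).
Proof.
move=> r1 r2 c1 c2 y0 E1 E2 e0 ze.
pose f t := `|x1 t - x2 t|.
have cf : {within `[0, T], continuous f}.
  move=> t; apply: (@continuous_comp (subspace `[0, T]) _ _ (fun t => x1 t - x2 t) Num.norm).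
    by apply: cvgB; [exact: c1|exact: c2].
  exact: norm_continuous.
have subT t : t \in `[0, T] -> `[0, t]%classic `<=` `[0, T]%classic.
  rewrite in_itv/= => /andP[_ tT] r /=; rewrite !in_itv/= => /andP[-> /=] /le_trans; exact.
have ib (x : R -> R) t : {within `[0, T], continuous x} -> t \in `[0, T] ->
    lebesgue_measure.-integrable `[0, t] (EFin \o (b \o x)).
  move=> cx tin; apply: continuous_itv_integrable.
  apply: continuous_within_sub (lipschitz_comp_within L_gt0 bL cx).
  exact: subT.
have if_ t : t \in `[0, T] -> lebesgue_measure.-integrable `[0, t] (EFin \o f).
  move=> tin; apply: continuous_itv_integrable.
  exact: continuous_within_sub (subT _ tin) cf.
have f0 t : 0 <= f t by exact: normr_ge0.
have key t : t \in `[0, T] ->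
    f t <= 2 * e + 2 * L * \int[lebesgue_measure]_(s in `[0, t]) f s.
  move=> tin; rewrite -mulrA -mulrDr.
  apply: (@reflection_lipschitz _ T l u x1 y1 x2 y2) => // r r0 rt.
  have rin : r \in `[0, T].
    by move: tin; rewrite !in_itv/= r0 => /andP[_]; exact: le_trans.
  rewrite E1// E2//.
  have -> : forall I1 I2 : R, I1 + z1 r + y1 r - y1 r - (I2 + z2 r + y2 r - y2 r)
      = (z1 r - z2 r) + (I1 - I2) by move=> *; ring.
  rewrite -RintegralB//; [|exact: ib..].
  apply: (le_trans (ler_normD _ _)); apply: lerD; first exact: ze.
  apply: (@le_trans _ _ (\int[lebesgue_measure]_(s in `[0, r]) `|b (x1 s) - b (x2 s)|)).
    apply: le_normr_Rintegral => //.
    by apply: integrable_EFinB => //; exact: ib.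
  rewrite -RintegralZl//; last exact: if_.
  apply: (@le_trans _ _ (\int[lebesgue_measure]_(s in `[0, r]) (L * f s))).
    apply: le_Rintegral => //.
    + apply: integrable_EFin_norm => //; apply: integrable_EFinB => //; exact: ib.
    + by apply: integrable_EFinZ => //; exact: if_.
  have sub_rt : `[0, r]%classic `<=` `[0, t]%classic.
    by move=> q /=; rewrite !in_itv/= => /andP[-> /=] /le_trans; apply.
  rewrite /Rintegral fine_le//.
  - apply: integrable_fin_num => //.
    by apply: integrable_EFinZ => //; exact: if_.
  - apply: integrable_fin_num => //.
    by apply: integrable_EFinZ => //; exact: if_.
  - apply: ge0_subset_integral => //.
    + apply/measurable_EFinP; apply: measurable_funM => //.
      by have /integrableP[/measurable_EFinP] := if_ t tin.
    + by move=> q _; rewrite lee_fin mulr_ge0// ltW.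
move=> t tin; have L20 : 0 < 2 * L by rewrite mulr_gt0.
have e20 : 0 <= 2 * e by rewrite mulr_ge0.
have := gronwall_sup T_gt0 L20 e20 cf (fun t _ => f0 t) key tin.
have -> : 2 * (2 * e) = 4 * e by ring.
have -> : 2 * (2 * L) = 4 * L by ring.
exact.
Qed.

End skorokhod_stability.

(** * Derivatives of the reflected path *)

Section slopes.
Context {R : realType} (T : R).
Implicit Types (f g y : R -> R) (a c t : R).

(** [a] is the derivative at [t] of the restriction of [f] to [[0, T]]. *)
Definition slope_at f t a := forall e : R, 0 < e ->
  exists2 d : R, 0 < d & forall r, r \in `[0, T] -> `|r - t| < d ->
    `|f r - f t - (r - t) * a| <= e * `|r - t|.

Lemma slope_atD f g t a c : slope_at f t a -> slope_at g t c ->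
  slope_at (fun s => f s + g s) t (a + c).
Proof.
move=> fa gc e e0; have e20 : 0 < e / 2 by rewrite divr_gt0.
have [d1 d10 h1] := fa _ e20; have [d2 d20 h2] := gc _ e20.
exists (Num.min d1 d2); first by rewrite lt_min d10.
move=> r rT; rewrite lt_min => /andP[r1 r2].
have -> : f r + g r - (f t + g t) - (r - t) * (a + c) =
  (f r - f t - (r - t) * a) + (g r - g t - (r - t) * c) by ring.
rewrite (le_trans (ler_normD _ _))//.
have -> : e * `|r - t| = e / 2 * `|r - t| + e / 2 * `|r - t| by field.
by apply: lerD; [exact: h1|exact: h2].
Qed.

Lemma slope_atN f t a : slope_at f t a -> slope_at (fun s => - f s) t (- a).
Proof.
move=> fa e e0; have [d d0 h] := fa _ e0; exists d => // r rT rd.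
have -> : - f r - - f t - (r - t) * - a = - (f r - f t - (r - t) * a) by ring.
by rewrite normrN h.
Qed.

Lemma slope_at_eq f g t a : (exists2 d : R, 0 < d & forall r, r \in `[0, T] -> `|r - t| < d -> f r - f t = g r - g t) ->
  slope_at f t a -> slope_at g t a.
Proof.
move=> [d1 d10 fg] fa e e0; have [d d0 h] := fa _ e0.
exists (Num.min d1 d); first by rewrite lt_min d10.
by move=> r rT; rewrite lt_min => /andP[r1 r2]; rewrite -fg// h.
Qed.

Lemma slope_at_cst k t : slope_at (fun=> k) t 0.
Proof. by move=> e e0; exists 1 => // r _ _; rewrite subrr mulr0 subrr normr0 mulr_ge0// ltW. Qed.

Lemma C1_on_slope f : C1_on T f -> exists2 df : R -> R, forall t, t \in `[0, T] -> slope_at f t (df t) & {within `[0, T], continuous f}.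
Proof.
move=> [df _ h].
have sl : forall t, t \in `[0, T] -> slope_at f t (df t).
  move=> t tT e e0.
  have /cvgrPdist_lt/(_ _ e0) := h t tT.
  rewrite /within/= /dnbhs => /nbhs_ballP[d /= d0 dP].
  exists d => // r rT rd.
  have [->|rt] := eqVneq r t; first by rewrite !subrr mul0r subrr normr0 mulr0.
  have rt0 : 0 < `|r - t| by rewrite normr_gt0 subr_eq0.
  have := dP r; rewrite /ball/= distrC => /(_ rd); rewrite /dnbhs/= => /(_ rt rT) /ltW.
  rewrite -(ler_pM2r rt0) -normrM mulrBl divfK ?subr_eq0// distrC.
  by rewrite [df t * _]mulrC.
exists df => //.
apply/subspace_continuousP => t tT; apply/cvgrPdist_le => e e0.
have [d d0 dP] := sl t tT _ ltr01.
near=> r.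
have rT : r \in `[0, T] by near: r; exact: withinT.
have rd : `|r - t| < d.
  by near: r; apply: cvg_within; rewrite -nbhs_ballE; exists d => //= r; rewrite /ball/= distrC.
have re : `|r - t| < e / (1 + `|df t|).
  near: r; apply: cvg_within; rewrite -nbhs_ballE.
  exists (e / (1 + `|df t|)) => //=; last by move=> r; rewrite /ball/= distrC//.
  by rewrite divr_gt0// ltr_wpDr.
have := dP r rT rd; rewrite mul1r distrC => h1.
have h2 : `|f t - f r| <= `|r - t| * (1 + `|df t|).
  have -> : f t - f r = (r - t) * df t - (f r - f t) - (r - t) * df t by ring.
  rewrite (le_trans (ler_normB _ _))// normrM mulrDr mulr1 lerD2r//.
rewrite (le_trans h2)// -ler_pdivlMr ?ltW// ltr_wpDr//.
Unshelve. all: by end_near. Qed.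

Section primitive.
Variable f : R -> R.
Hypothesis cf : {within `[0, T], continuous f}.
Let F t := \int[lebesgue_measure]_(s in `[0, t]) f s.

Lemma primitive_increment (p q k e : R) : 0 <= p -> p <= q -> q <= T ->
  (forall s, p < s -> s <= q -> `|f s - k| <= e) ->
  `|F q - F p - (q - p) * k| <= e * (q - p).
Proof.
move=> p0 pq qT fk.
have sub a b : 0 <= a -> b <= T -> `[a, b]%classic `<=` `[0, T]%classic.
  by move=> a0 bT r /=; rewrite !in_itv/= => /andP[ar rb]; rewrite (le_trans a0)//= (le_trans rb).
have fi : lebesgue_measure.-integrable `[0, q] (EFin \o f).
  by apply: continuous_itv_integrable; apply: continuous_within_sub cf; exact: sub.
have fi2 : lebesgue_measure.-integrable `]p, q] (EFin \o f).
  apply: integrableS fi => // r /=; rewrite !in_itv/= => /andP[pr ->].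
  by rewrite (le_trans p0 (ltW pr)).
have muE : lebesgue_measure `]p, q]%classic = (q - p)%:E.
  by rewrite lebesgue_measure_itv/= lte_fin; case: ltgtP pq => // ->; rewrite subrr.
have ci (k0 : R) : lebesgue_measure.-integrable `]p, q] (EFin \o (fun=> k0)).
  have : lebesgue_measure.-integrable `[p, q] (EFin \o (fun=> k0)).
    by apply: continuous_itv_integrable; apply: continuous_subspaceT => r; exact: cvg_cst.
  by apply: integrableS => //; exact: subset_itv_oc_cc.
rewrite /F Rintegral_itvB//=.
have -> : (q - p) * k = \int[lebesgue_measure]_(s in `]p, q]) k.
  by rewrite Rintegral_cst//= muE/= mulrC.
rewrite -RintegralB//.
have -> : e * (q - p) = \int[lebesgue_measure]_(s in `]p, q]) e.
  by rewrite Rintegral_cst//= muE/=.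
apply: (@le_trans _ _ (\int[lebesgue_measure]_(s in `]p, q]) `|f s - k|)).
  by apply: le_normr_Rintegral => //; apply: integrable_EFinB => //; exact: ci.
apply: le_Rintegral => //.
- by apply: integrable_EFin_norm => //; apply: integrable_EFinB => //; exact: ci.
- by move=> s /=; rewrite in_itv/= => /andP[]; exact: fk.
Qed.

Lemma primitive_slope t : t \in `[0, T] -> slope_at F t (f t).
Proof.
move=> tT e e0.
have [d d0 dP] := within_itv_dist cf tT e0.
have [t0 tT'] : 0 <= t /\ t <= T by move: tT; rewrite in_itv/= => /andP[].
exists d => // r rT rd.
have [r0 rT'] : 0 <= r /\ r <= T by move: rT; rewrite in_itv/= => /andP[].
have [tr|rt] := leP t r.
  rewrite [in leRHS]ger0_norm ?subr_ge0//; apply: primitive_increment => // s ts sr.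
  apply: ltW; apply: dP; first by rewrite in_itv/= (le_trans t0 (ltW ts)) (le_trans sr).
  move: rd; rewrite !ger0_norm ?subr_ge0// ?(ltW ts)//; last lra.
rewrite [in leRHS]ltr0_norm ?subr_lt0// opprB.
have -> : F r - F t - (r - t) * f t = - (F t - F r - (t - r) * f t) by ring.
rewrite normrN; apply: primitive_increment => //; first exact: ltW.
move=> s rs st; apply: ltW; apply: dP.
  by rewrite in_itv/= (le_trans r0 (ltW rs)) (le_trans st).
by move: rd; rewrite distrC [`|s - t|]distrC !ger0_norm ?subr_ge0 ?(ltW rt)//; lra.
Qed.

End primitive.

(** A path pushed up by a barrier is squeezed between [max (g 0, g t)] and the
    running maximum of [g] on [[0, t]]; if [g] leaves [0] with slope [c], both have
    slope [max c 0] at [0]. *)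
Lemma reflected_slope0 (y g : R -> R) (c d0 : R) : 0 < d0 -> y 0 = g 0 ->
  (forall t, t \in `[0, T] -> t < d0 -> [/\ y 0 <= y t, g t <= y t &
     exists2 s, s \in `[0, t] & y t <= g s]) ->
  slope_at g 0 c -> slope_at y 0 (Num.max c 0).
Proof.
move=> d00 y0 h gc e e0; have [d d_gt0 dP] := gc _ e0.
exists (Num.min d0 d); first by rewrite lt_min d00.
move=> r rT; rewrite lt_min subr0 => /andP[rd0 rd].
have r0 : 0 <= r by move: rT; rewrite in_itv/= => /andP[].
have rT' : r <= T by move: rT; rewrite in_itv/= => /andP[].
move: rd rd0; rewrite (ger0_norm r0) => rd rd0.
have [h1 h2 [s sin h3]] := h r rT rd0.
move: sin; rewrite in_itv/= => /andP[s0 sr].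
have sT : s \in `[0, T] by rewrite in_itv/= s0 (le_trans sr).
have g1 := dP r rT; have g2 := dP s sT.
move: g1 g2; rewrite !subr0 (ger0_norm r0) (ger0_norm s0) => /(_ rd) + /(_ (le_lt_trans sr rd)).
rewrite !ler_norml => /andP[g1 g1'] /andP[g2 g2'].
have es : e * s <= e * r by rewrite ler_pM2l.
rewrite /Num.max; case: ltP => c0; apply/andP; split; rewrite ?mulr0; try lra.
- have : s * c <= 0 by rewrite mulr_ge0_le0// ltW.
  lra.
- have : s * c <= r * c by rewrite ler_wpM2r.
  lra.
Qed.

Lemma slope_path_derivative y t a : 0 < T -> t \in `[0, T[ -> slope_at y t a ->
  path_derivative y t = a.
Proof.
move=> T0; rewrite in_itv/= => /andP[t0 tT] ya; rewrite /path_derivative.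
have [t_eq|tn0] := eqVneq t 0.
  subst t; apply: cvg_lim => //; apply/cvgrPdist_le => e e0.
  have [d d0 dP] := ya _ e0; near=> s.
  have s0 : 0 < s by near: s; exact: nbhs_right_gt.
  have sd : s < d by near: s; exact: nbhs_right_lt.
  have sT : s <= T by near: s; exact: nbhs_right_le.
  have := dP s; rewrite in_itv/= (ltW s0) sT subr0 ger0_norm ?(ltW s0)// => /(_ isT sd).
  rewrite -ler_pdivrMr// -[X in _ / X](gtr0_norm s0) -normf_div.
  by rewrite distrC mulrBl [s * a]mulrC mulfK// gt_eqF.
have tp : 0 < t by rewrite lt_neqAle eq_sym tn0.
rewrite derive1E; apply: cvg_lim => //; apply/cvgrPdist_le => e e0.
have [d d0 dP] := ya _ e0.
near=> h.
have hn0 : h != 0 by near: h; exact: nbhs_dnbhs_neq.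
have hd : `|h| < d by near: h; exact: dnbhs0_lt.
have ht : `|h| < t by near: h; exact: dnbhs0_lt.
have hT : `|h| < T - t by near: h; apply: dnbhs0_lt; rewrite subr_gt0.
have rT : h + t \in `[0, T].
  by move: ht hT; rewrite !ltr_norml in_itv/=; lra.
have := dP _ rT; rewrite addrK => /(_ hd).
rewrite -ler_pdivrMr ?normr_gt0// -normf_div/= scaler1.
rewrite /GRing.scale/= distrC mulrBl [h * a]mulrC mulfK//.
by rewrite [h^-1 * _]mulrC.
Unshelve. all: by end_near. Qed.

End slopes.

Section solution_slopes.
Context {R : realType} (T : R) (l u : R -> R) (b : R -> R) (C : R -> set R).
Variables (L : R) (x y : R -> R).
Hypothesis T_gt0 : 0 < T.
Hypothesis L_gt0 : 0 < L.
Hypothesis bL : forall r s, `|b r - b s| <= L * `|r - s|.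
Hypothesis (l_C1 : C1_on T l) (u_C1 : C1_on T u).
Hypothesis lu : forall t, t \in `[0, T] -> l t < u t.
Hypothesis C_itv : forall t, t \in `[0, T] -> C t = `[l t, u t]%classic.
Hypothesis rule : reflection_rule T l u x y.
Hypothesis cx : {within `[0, T], continuous x}.
Hypothesis xE : forall t, t \in `[0, T] ->
  x t = \int[lebesgue_measure]_(s in `[0, t]) b (x s) + y t.

Let F t := \int[lebesgue_measure]_(s in `[0, t]) b (x s).

Let F_slope t : t \in `[0, T] -> slope_at T F t (b (x t)).
Proof.
by move=> tT; apply: (@primitive_slope _ T (b \o x)) => //; exact: lipschitz_comp_within L_gt0 bL cx.
Qed.

Let yE t : t \in `[0, T] -> y t = x t - F t.
Proof. by move=> tT; rewrite {1}xE// addrAC subrr add0r. Qed.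

Let F0 : F 0 = 0. Proof. by rewrite /F set_itv1 Rintegral_set1. Qed.

(** If [x 0] is inside, [y] is constant for a while; on a barrier it is the
    one-sided reflection of the difference between the barrier and the drift. *)
Let slope_start : exists a, slope_at T y 0 a.
Proof.
have in0 : 0 \in `[0, T] by rewrite in_itv/= lexx ltW.
have [cy lxu up down] := rule.
have [dl sl cl] := C1_on_slope l_C1; have [du su cu] := C1_on_slope u_C1.
have y0 : y 0 = x 0 by rewrite yE// F0 subr0.
have near_pos (f : R -> R) : {within `[0, T], continuous f} -> 0 < f 0 ->
    exists2 d, 0 < d & forall r, r \in `[0, T] -> r < d -> 0 < f r.
  move=> cf f0; have [d d0 dP] := within_itv_dist cf in0 f0.
  exists d => // r rT rd; have := dP r rT; rewrite subr0 ger0_norm; last first.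
    by move: rT; rewrite in_itv/= => /andP[].
  by move=> /(_ rd); rewrite ltr_norml; lra.
have sub t : t \in `[0, T] -> `[0, t]%classic `<=` `[0, T]%classic.
  rewrite in_itv/= => /andP[_ tT] r /=; rewrite !in_itv/= => /andP[-> /=] /le_trans; exact.
have inT t r : t \in `[0, T] -> 0 <= r -> r <= t -> r \in `[0, T].
  by rewrite !in_itv/= => /andP[_ tT] -> /le_trans; apply.
have cB (f g : R -> R) : {within `[0, T], continuous f} -> {within `[0, T], continuous g} ->
    {within `[0, T], continuous (fun s => f s - g s)}.
  by move=> cf cg t; apply: cvgB; [exact: cf|exact: cg].
have /andP[lx xu] := lxu _ in0.
have [xu0|xu0] := ltP (x 0) (u 0); last first.
  (* on the upper barrier: [- y] is pushed up by [F - u] *)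
  have x0u : x 0 = u 0 by apply/eqP; rewrite eq_le xu xu0.
  have lx0 : 0 < x 0 - l 0 by rewrite x0u subr_gt0 lu.
  have [d d0 dP] := near_pos (fun s => x s - l s) (cB _ _ cx cl) lx0.
  pose g t := - (u t - F t).
  have gs : slope_at T g 0 (- (du 0 + - b (x 0))).
    apply: slope_atN; apply: slope_atD; first exact: su.
    by apply: slope_atN; exact: F_slope.
  exists (- Num.max (- (du 0 + - b (x 0))) 0).
  apply: (@slope_at_eq _ _ (fun s => - - y s)); first by exists 1 => // r _ _; rewrite !opprK.
  apply: slope_atN; apply: (reflected_slope0 d0 _ _ gs).
    by rewrite /g F0 subr0 y0 x0u.
  move=> t tT td; have [t0 tT'] : 0 <= t /\ t <= T by move: tT; rewrite in_itv/= => /andP[].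
  split.
  - rewrite lerN2; apply: down => // r r0 rt; rewrite -subr_gt0.
    by apply: dP; [exact: inT tT (ltW r0) rt|exact: le_lt_trans td].
  - by rewrite /g lerN2 yE// lerB// ; have /andP[] := lxu _ tT.
  - have cD : {within `[0, t], continuous (fun s => u s - x s)}.
      by apply: continuous_within_sub (cB _ _ cu cx); exact: sub.
    have [|s sin [sle slt]] := last_sublevel_time t0 cD (e := 0); first by rewrite x0u subrr.
    exists s => //; move: (sin); rewrite in_itv/= => /andP[s0 st].
    have sT := inT _ _ tT s0 st.
    have ys : y s <= y t.
      apply: up => // r sr rt; rewrite -subr_gt0; exact: slt.
    rewrite /g lerN2; apply: le_trans ys; rewrite yE// lerB//.
    by move: sle; rewrite subr_le0.
have [lx0|lx0] := ltP (l 0) (x 0); last first.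
  (* on the lower barrier: [y] is pushed up by [l - F] *)
  have x0l : x 0 = l 0 by apply/eqP; rewrite eq_le lx lx0.
  have ux0 : 0 < u 0 - x 0 by rewrite subr_gt0.
  have [d d0 dP] := near_pos (fun s => u s - x s) (cB _ _ cu cx) ux0.
  pose g t := l t - F t.
  have gs : slope_at T g 0 (dl 0 + - b (x 0)).
    apply: slope_atD; first exact: sl.
    by apply: slope_atN; exact: F_slope.
  exists (Num.max (dl 0 + - b (x 0)) 0).
  apply: (reflected_slope0 d0 _ _ gs).
    by rewrite /g F0 subr0 y0 x0l.
  move=> t tT td; have [t0 tT'] : 0 <= t /\ t <= T by move: tT; rewrite in_itv/= => /andP[].
  split.
  - apply: up => // r r0 rt; rewrite -subr_gt0.
    by apply: dP; [exact: inT tT (ltW r0) rt|exact: le_lt_trans td].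
  - by rewrite /g yE// lerB// ; have /andP[] := lxu _ tT.
  - have cD : {within `[0, t], continuous (fun s => x s - l s)}.
      by apply: continuous_within_sub (cB _ _ cx cl); exact: sub.
    have [|s sin [sle slt]] := last_sublevel_time t0 cD (e := 0); first by rewrite x0l subrr.
    exists s => //; move: (sin); rewrite in_itv/= => /andP[s0 st].
    have sT := inT _ _ tT s0 st.
    have ys : y t <= y s.
      apply: down => // r sr rt; rewrite -subr_gt0; exact: slt.
    rewrite /g; apply: (le_trans ys); rewrite yE// lerB//.
    by move: sle; rewrite subr_le0.
have ux0 : 0 < u 0 - x 0 by rewrite subr_gt0.
have xl0 : 0 < x 0 - l 0 by rewrite subr_gt0.
have [d1 d10 dP1] := near_pos (fun s => u s - x s) (cB _ _ cu cx) ux0.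
have [d2 d20 dP2] := near_pos (fun s => x s - l s) (cB _ _ cx cl) xl0.
exists 0; apply: (@slope_at_eq _ _ (fun=> 0)); last exact: slope_at_cst.
exists (Num.min d1 d2); first by rewrite lt_min d10.
move=> t tT; have [t0 tT'] : 0 <= t /\ t <= T by move: tT; rewrite in_itv/= => /andP[].
rewrite subr0 (ger0_norm t0) lt_min subrr => /andP[td1 td2].
apply/eqP; rewrite eq_sym subr_eq0 eq_le; apply/andP; split.
- apply: down => // r r0 rt; rewrite -subr_gt0.
  by apply: dP2; [exact: inT tT (ltW r0) rt|exact: le_lt_trans td2].
- apply: up => // r r0 rt; rewrite -subr_gt0.
  by apply: dP1; [exact: inT tT (ltW r0) rt|exact: le_lt_trans td1].
Qed.

(** On the set E the path [y] is locally [l - F], [u - F] or constant. *)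
Let slope_sticking t : E_set T l u C x t -> exists a, slope_at T y t a.
Proof.
have [cy lxu up down] := rule.
have [dl sl _] := C1_on_slope l_C1; have [du su _] := C1_on_slope u_C1.
have stick (f df : R -> R) : (forall t, t \in `[0, T] -> slope_at T f t (df t)) ->
    sticking_set T x (fun t => [set f t]) t -> exists a, slope_at T y t a.
  move=> fs [tT [eta eta0 xf]]; exists (df t + - b (x t)).
  apply: (@slope_at_eq _ _ (fun s => f s + - F s)); last first.
    by apply: slope_atD; [exact: fs|apply: slope_atN; exact: F_slope].
  have xfr r : r \in `[0, T] -> `|r - t| < eta -> x r = f r.
    by move=> rT rt; apply: xf => //; rewrite in_itv/=; move: rt; rewrite ltr_norml; lra.
  exists eta => // r rT rt; rewrite !yE// !xfr//.
  by rewrite subrr normr0.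
move=> [[|]|]; [exact: (stick _ _ sl)|exact: (stick _ _ su)|].
move=> [tT [eta eta0 xC]].
have xin r : r \in `[0, T] -> `|r - t| < eta -> l r < x r < u r.
  move=> rT rt; have := xC r.
  rewrite in_itv/= => /(_ ltac:(by move: rt; rewrite ltr_norml; lra)) /(_ rT).
  by rewrite C_itv// interior_itv/= in_itv.
exists 0; apply: (@slope_at_eq _ _ (fun=> 0)); last exact: slope_at_cst.
have cst_on p q : p \in `[0, T] -> q \in `[0, T] -> p <= q -> `|p - t| < eta -> `|q - t| < eta ->
    y p = y q.
  move=> pT qT pq pe qe.
  have [p0 qT'] : 0 <= p /\ q <= T by move: pT qT; rewrite !in_itv/= => /andP[-> _] /andP[].
  have xr r : p < r -> r <= q -> l r < x r < u r.
    move=> pr rq; apply: xin; first by rewrite in_itv/= (le_trans p0 (ltW pr)) (le_trans rq).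
    by move: pe qe; rewrite !ltr_norml; lra.
  apply/eqP; rewrite eq_le; apply/andP; split.
  - by apply: up => // r pr rq; have /andP[] := xr r pr rq.
  - by apply: down => // r pr rq; have /andP[] := xr r pr rq.
exists eta => // r rT rt; rewrite subrr; apply/esym/eqP; rewrite subr_eq0; apply/eqP.
have te : `|t - t| < eta by rewrite subrr normr0.
have [tr|rt'] := leP t r; first by apply/esym; exact: cst_on.
by apply: cst_on => //; exact: ltW.
Qed.

(** These first order expansions, at [t] and at [0], produce the bias. *)
Lemma solution_slope t : t \in `[0, T[ -> t = 0 \/ E_set T l u C x t ->
  slope_at T x t (b (x t) + path_derivative y t).
Proof.
move=> tT h.
have tT' : t \in `[0, T] by move: tT; rewrite !in_itv/= => /andP[-> /ltW].
have [a ya] : exists a, slope_at T y t a.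
  by case: h => [->|/slope_sticking//]; exact: slope_start.
rewrite (slope_path_derivative T_gt0 tT ya).
apply: (@slope_at_eq _ _ (fun s => F s + y s)); last first.
  by apply: slope_atD => //; exact: F_slope.
by exists 1 => // r rT _; rewrite -!xE.
Qed.

End solution_slopes.

(** * Integrals of the power kernel *)

Section power_integrals.
Context {R : realType}.
Implicit Types (f F : R -> R) (a b : R).

(** The integrand may blow up at the end points: the fundamental theorem is
    applied on an increasing sequence of compact intervals. *)
Lemma FTC_improper f F a b : a < b ->
  {in `]a, b[, forall x, 0 <= f x} ->
  {in `]a, b[, continuous f} ->
  {in `]a, b[, forall x, is_derive x (1 : R) F (f x)} ->
  {within `[a, b], continuous F} ->
  (\int[lebesgue_measure]_(x in `]a, b[) (f x)%:E = (F b - F a)%:E)%E.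
Proof.
move=> ab f0 cf dF cF.
have [_ cFa cFb] := (continuous_within_itvP F ab).1 cF.
pose d (n : nat) : R := (b - a) / (n.+3)%:R.
have ba0 : 0 < b - a by rewrite subr_gt0.
have d0 n : 0 < d n by rewrite divr_gt0.
have d3 n : d n <= (b - a) / 3.
  by rewrite ler_wpM2l ?(ltW ba0)// lef_pV2 ?posrE// ler_nat.
have dcvg : d n @[n --> \oo] --> 0.
  rewrite /d -[X in _ --> X](mulr0 (b - a)); apply: cvgMr.
  have := @cvg_harmonic R; rewrite -(cvg_shiftS _) -(cvg_shiftS _) => h.
  exact: h.
pose E n : set R := `[a + d n, b - d n]%classic.
have EI n : E n `<=` `]a, b[%classic.
  move=> x; rewrite /E /= !in_itv/= => /andP[x1 x2].
  by rewrite (lt_le_trans _ x1) ?ltrDl//= (le_lt_trans x2)// ltrBlDr ltrDl.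
have dle n m : (n <= m)%N -> d m <= d n.
  by move=> nm; rewrite ler_wpM2l ?(ltW ba0)// lef_pV2 ?posrE// ler_nat.
have UE : \bigcup_n E n = `]a, b[%classic.
  apply/seteqP; split => [x [n _ /EI]//|x /=].
  rewrite in_itv/= => /andP[ax xb].
  have m0 : 0 < Num.min (x - a) (b - x) by rewrite lt_min !subr_gt0 ax.
  have [n _ hn] : \forall n \near \oo, d n < Num.min (x - a) (b - x).
    exact: (cvgr_lt _ dcvg).
  exists n => //; rewrite /E/= in_itv/=.
  by have := hn n (leqnn _); rewrite lt_min => /andP[]; lra.
have mf : measurable_fun `]a, b[ f.
  by apply: open_continuous_measurable_fun; [exact: interval_open|move=> x; rewrite inE/=; exact: cf].
have key n : (\int[lebesgue_measure]_(x in E n) (f x)%:E = (F (b - d n) - F (a + d n))%:E)%E.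
  have abn : a + d n < b - d n by have := d3 n; lra.
  have sub x : x \in `[a + d n, b - d n] -> x \in `]a, b[.
    by move=> h; exact: (EI n).
  rewrite EFinB; apply: continuous_FTC2 => //.
  - apply: continuous_in_subspaceT => x; rewrite inE/= => xE; apply: cf; exact: sub.
  - split.
    + by move=> x xE; have [] := dF x (sub x (subset_itv_oo_cc xE)).
    + apply: cvg_at_right_filter; apply: differentiable_continuous; apply/derivable1_diffP.
      have [] // := dF (a + d n); by apply: sub; rewrite in_itv/= lexx ltW.
    + apply: cvg_at_left_filter; apply: differentiable_continuous; apply/derivable1_diffP.
      have [] // := dF (b - d n); by apply: sub; rewrite in_itv/= lexx ltW.
  - by move=> x xE; rewrite derive1E; have [_ ->] := dF x (sub x (subset_itv_oo_cc xE)).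
have cv1 : (\int[lebesgue_measure]_(x in E n) (f x)%:E)%E @[n --> \oo] -->
    (\int[lebesgue_measure]_(x in `]a, b[) (f x)%:E)%E.
  rewrite -UE; apply: ge0_nondecreasing_set_cvg_integral.
  - move=> n m nm; apply/subsetPset => x; rewrite /E/= !in_itv/= => /andP[x1 x2].
    by have := dle _ _ nm; lra.
  - by move=> n; exact: measurable_itv.
  - by move=> n; apply/measurable_EFinP; exact: measurable_funS mf.
  - by move=> n x /EI /f0; rewrite lee_fin.
have cv2 : (F (b - d n) - F (a + d n))%:E @[n --> \oo] --> (F b - F a)%:E.
  apply: cvg_EFin; first by near=> n.
  apply: cvgB.
    have /cvg_at_leftP := cFb; apply; split; first by move=> n; rewrite ltrBlDr ltrDl.
    by rewrite -[X in _ --> X]subr0; apply: cvgB => //; exact: cvg_cst.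
  have /cvg_at_rightP := cFa; apply; split; first by move=> n; rewrite ltrDl.
  by rewrite -[X in _ --> X]addr0; apply: cvgD => //; exact: cvg_cst.
rewrite (funext key) in cv1.
exact: (cvg_unique _ cv1 cv2).
Unshelve. all: by end_near. Qed.

Lemma continuous_norm_powR (a c : R) : 0 < a -> continuous (fun x : R => `|x - c| `^ a).
Proof.
move=> a0 x; have [->|xc] := eqVneq x c.
  rewrite /continuous_at subrr normr0 powR0 ?gt_eqF//; apply/cvgrPdist_lt => e e0.
  near=> z; rewrite sub0r normrN ger0_norm ?powR_ge0//.
  have -> : e = (e `^ a^-1) `^ a by rewrite -powRrM mulVf ?gt_eqF// powRr1 ?ltW.
  rewrite gt0_ltr_powR ?nnegrE ?powR_ge0//.
  near: z; exists (e `^ a^-1) => /=; first by rewrite powR_gt0.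
  by move=> z /=; rewrite distrC.
apply: (@continuous_comp R R R (fun x => `|x - c|) (fun y => y `^ a)).
  apply: (@continuous_comp R R R (fun x => x - c) Num.norm); last exact: norm_continuous.
  by apply: cvgB; [exact: cvg_id|exact: cvg_cst].
apply: differentiable_continuous; apply/derivable1_diffP.
by apply: derivable_powR; rewrite in_itv/= andbT normr_gt0 subr_eq0.
Unshelve. all: by end_near. Qed.

Lemma is_derive_powR_right (a c x : R) : c < x ->
  is_derive x (1 : R) (fun v => (v - c) `^ a) (a * (x - c) `^ (a - 1)).
Proof.
move=> cx.
have h : is_derive (x - c) (1 : R) (powR (R:=R) ^~ a) (a * (x - c) `^ (a - 1)).
  by apply: is_derive1_powR; rewrite subr_gt0.
have h2 : is_derive x (1 : R) (fun v : R => v - c) 1.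
  by apply: is_derive_eq; rewrite subr0.
have := @is_derive1_comp _ (powR (R:=R) ^~ a) (fun v => v - c) x _ _ h h2.
by rewrite mulr1.
Qed.

Lemma is_derive_powR_left (a c x : R) : x < c ->
  is_derive x (1 : R) (fun v => (c - v) `^ a) (- (a * (c - x) `^ (a - 1))).
Proof.
move=> cx.
have h : is_derive (c - x) (1 : R) (powR (R:=R) ^~ a) (a * (c - x) `^ (a - 1)).
  by apply: is_derive1_powR; rewrite subr_gt0.
have h2 : is_derive x (1 : R) (fun v : R => c - v) (- 1).
  by have := is_deriveB (is_derive_cst c x (1 : R)) (is_derive_id x (1 : R)); rewrite sub0r.
have := @is_derive1_comp _ (powR (R:=R) ^~ a) (fun v => c - v) x _ _ h h2.
by rewrite mulrN1.
Qed.

Lemma within_powR_right (a c p q : R) : 0 < a -> c <= p ->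
  {within `[p, q], continuous (fun v => (v - c) `^ a)}.
Proof.
move=> a0 cp; apply: (@subspace_eq_continuous _ _ _ (fun v => `|v - c| `^ a)).
  move=> v; rewrite inE/= in_itv/= => /andP[pv _]; rewrite /from_subspace ger0_norm//.
  by rewrite subr_ge0 (le_trans cp).
apply: continuous_subspaceT; exact: continuous_norm_powR.
Qed.

Lemma within_powR_left (a c p q : R) : 0 < a -> q <= c ->
  {within `[p, q], continuous (fun v => (c - v) `^ a)}.
Proof.
move=> a0 cp; apply: (@subspace_eq_continuous _ _ _ (fun v => `|v - c| `^ a)).
  move=> v; rewrite inE/= in_itv/= => /andP[_ vq]; rewrite /from_subspace distrC ger0_norm//.
  by rewrite subr_ge0 (le_trans vq).
apply: continuous_subspaceT; exact: continuous_norm_powR.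
Qed.

Lemma continuous_powR_shift (a c x : R) : c < x -> {for x, continuous (fun v : R => (v - c) `^ a)}.
Proof.
move=> cx; apply: differentiable_continuous; apply/derivable1_diffP.
by have [] := is_derive_powR_right a cx.
Qed.

Lemma continuous_powR_shift_left (a c x : R) : x < c -> {for x, continuous (fun v : R => (c - v) `^ a)}.
Proof.
move=> cx; apply: differentiable_continuous; apply/derivable1_diffP.
by have [] := is_derive_powR_left a cx.
Qed.

Lemma integral_kernel_right (al r b : R) : 0 < al -> r <= b ->
  (\int[lebesgue_measure]_(v in `]r, b[) (`|r - v| `^ (al - 1))%:E = ((b - r) `^ al / al)%:E)%E.
Proof.
move=> al0; rewrite le_eqVlt => /predU1P[->|rb].
  by rewrite set_itv_ge ?bnd_simp ?ltxx// integral_set0 subrr powR0 ?gt_eqF// mul0r.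
transitivity (\int[lebesgue_measure]_(v in `]r, b[) ((v - r) `^ (al - 1))%:E)%E.
  apply: eq_integral => v; rewrite inE/= in_itv/= => /andP[rv _].
  by rewrite distrC gtr0_norm ?subr_gt0.
rewrite (@FTC_improper _ (fun v => (v - r) `^ al / al))//.
- by rewrite subrr powR0 ?gt_eqF// mul0r subr0.
- by move=> v _; exact: powR_ge0.
- by move=> v; rewrite in_itv/= => /andP[rv _]; exact: continuous_powR_shift.
- move=> v; rewrite in_itv/= => /andP[rv _].
  have h := is_derive_powR_right al rv.
  apply: is_derive_eq; rewrite /GRing.scale/= mulr0 add0r.
  by rewrite mulrA mulVf ?mul1r// gt_eqF.
- by move=> v; apply: cvgMl; exact: (@within_powR_right al r r b al0 (lexx _)).
Qed.

Lemma integral_kernel_left (al r : R) : 0 < al -> 0 <= r ->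
  (\int[lebesgue_measure]_(v in `]0%R, r[) (`|r - v| `^ (al - 1))%:E = (r `^ al / al)%:E)%E.
Proof.
move=> al0; rewrite le_eqVlt => /predU1P[<-|r0].
  by rewrite set_itv_ge ?bnd_simp ?ltxx// integral_set0 powR0 ?gt_eqF// mul0r.
transitivity (\int[lebesgue_measure]_(v in `]0%R, r[) ((r - v) `^ (al - 1))%:E)%E.
  apply: eq_integral => v; rewrite inE/= in_itv/= => /andP[_ rv].
  by rewrite gtr0_norm ?subr_gt0.
rewrite (@FTC_improper _ (fun v => - ((r - v) `^ al / al)))//.
- by rewrite subr0 subrr powR0 ?gt_eqF// mul0r oppr0 sub0r opprK.
- by move=> v _; exact: powR_ge0.
- by move=> v; rewrite in_itv/= => /andP[_ rv]; exact: continuous_powR_shift_left.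
- move=> v; rewrite in_itv/= => /andP[_ rv].
  have h := is_derive_powR_left al rv.
  apply: is_derive_eq; rewrite /GRing.scale/= mulr0 add0r.
  by rewrite mulrN opprK mulrA mulVf ?mul1r// gt_eqF.
- move=> v; apply: cvgN; apply: cvgMl.
  exact: (@within_powR_left al r 0 r al0 (lexx _)).
Qed.

Lemma measurable_norm_powR (a r : R) (D : set R) : measurable D ->
  measurable_fun D (fun v : R => (`|r - v| `^ a)%:E).
Proof.
move=> mD; apply/measurable_funTS/measurable_EFinP.
apply: (measurableT_comp (measurable_powR a)).
by apply: measurableT_comp => //; apply: measurable_funB.
Qed.

Lemma integral_kernel (al r b : R) : 0 < al -> 0 <= r -> r <= b ->
  (\int[lebesgue_measure]_(v in `[0%R, b]) (`|r - v| `^ (al - 1))%:E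
   = ((r `^ al + (b - r) `^ al) / al)%:E)%E.
Proof.
move=> al0 r0 rb.
rewrite integral_itv_bndoo; last exact: measurable_norm_powR.
have [b0|b0] := ltP 0 b; last first.
  have [-> ->] : b = 0 /\ r = 0 by lra.
  by rewrite set_itv_ge ?bnd_simp ?ltxx// integral_set0 subrr powR0 ?gt_eqF// addr0 mul0r.
move: rb; rewrite le_eqVlt => /predU1P[<-|rb'].
  by rewrite integral_kernel_left// subrr powR0 ?gt_eqF// addr0.
have rb := ltW rb'.
have -> : `]0, b[%classic = `]0, r] `|` `]r, b[%classic.
  apply/seteqP; split => v /=; rewrite !in_itv/=.
    move=> /andP[v0 vb]; rewrite v0 vb andbT/=.
    by have [|] := leP v r; [left|right].
  move=> [/andP[v0 vr]|/andP[rv vb]]; last by rewrite vb (le_lt_trans r0 rv).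
  by rewrite v0 (le_lt_trans vr rb').
rewrite ge0_integral_setU//=.
- rewrite -[X in (X + _)%E]integral_itv_bndo_bndc; last exact: measurable_norm_powR.
  by rewrite integral_kernel_left// integral_kernel_right// mulrDl.
- by apply: measurable_norm_powR; exact: measurableU.
- apply/disj_setPS => v [] /=; rewrite !in_itv/= => /andP[_ vr] /andP[+ _].
  by rewrite ltNge vr.
Qed.

(** Both integrations have explicit antiderivatives; for [al = 2 H - 1] the result
    is, up to a constant, the covariance of fractional Brownian motion. *)
Lemma integral_square_kernel (al p q : R) : 0 < al -> 0 <= p -> p <= q ->
  (\int[lebesgue_measure]_(r in `[0%R, p]) \int[lebesgue_measure]_(v in `[0%R, q]) (`|r - v| `^ (al - 1))%:E
   = ((p `^ (al + 1) + q `^ (al + 1) - (q - p) `^ (al + 1)) / (al * (al + 1)))%:E)%E.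
Proof.
move=> al0; rewrite le_eqVlt => /predU1P[<- q0|p0 pq].
  rewrite set_itv1 integral_set1 subr0 addrK powR0 ?mul0r// gt_eqF//.
  by rewrite addr_gt0.
have q0 : 0 < q by exact: lt_le_trans pq.
have al10 : 0 < al + 1 by rewrite addr_gt0.
pose g r := (r `^ al + (q - r) `^ al) / al.
pose G r := (r `^ (al + 1) - (q - r) `^ (al + 1)) / (al * (al + 1)).
have gE r : r \in `]0, p[ -> g r = ((r - 0) `^ al + (q - r) `^ al) / al.
  by rewrite subr0.
transitivity (\int[lebesgue_measure]_(r in `[0%R, p]) (g r)%:E)%E.
  apply: eq_integral => r; rewrite inE/= in_itv/= => /andP[r0 rp].
  by rewrite integral_kernel// (le_trans rp).
rewrite integral_itv_bndoo; last first.
  apply/measurable_EFinP; apply: measurable_funM => //; apply: measurable_funD.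
    by apply: measurable_funTS; exact: measurable_powR.
  apply: measurable_funTS; apply: (measurableT_comp (measurable_powR al)).
  exact: measurable_funB.
rewrite (@FTC_improper g G)//.
- congr EFin; rewrite /G subr0 powR0 ?gt_eqF//; field.
  by rewrite !gt_eqF.
- by move=> r _; rewrite divr_ge0 ?addr_ge0 ?powR_ge0// ltW.
- move=> r; rewrite in_itv/= => /andP[r0 rp]; apply: cvgMl; apply: cvgD.
    have := @continuous_powR_shift al 0 r r0.
    rewrite (_ : (fun v => (v - 0) `^ al) = (fun v => v `^ al))//.
    by apply/funext => v; rewrite subr0.
  by apply: continuous_powR_shift_left; exact: lt_le_trans pq.
- move=> r; rewrite in_itv/= => /andP[r0 rp].
  have h1 := is_derive1_powR (al + 1) r0.
  have h2 := is_derive_powR_left (al + 1) (lt_le_trans rp pq).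
  apply: is_derive_eq; rewrite /GRing.scale/= mulr0 add0r addrK /g.
  by field; rewrite !gt_eqF.
- move=> r; apply: cvgMl; apply: cvgB.
    have := @within_powR_right (al + 1) 0 0 p al10 (lexx _) r.
    rewrite (_ : (fun v => (v - 0) `^ (al + 1)) = (fun v => v `^ (al + 1)))//.
    by apply/funext => v; rewrite subr0.
  exact: (@within_powR_left (al + 1) q 0 p al10 pq r).
Qed.

End power_integrals.

(** * The covariance form of fractional noise *)

Section bounded_measurable.
Context {R : realType}.
Implicit Types f g : R -> R.

(** A class containing the scaled kernels and the step functions, on which the
    singular form below is finite and bilinear. *)
Definition bounded_measurable f :=
  measurable_fun setT f /\ exists M, forall x, `|f x| <= M.

Lemma bounded_measurableD f g : bounded_measurable f -> bounded_measurable g ->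
  bounded_measurable (fun x => f x + g x).
Proof.
move=> [mf [M fM]] [mg [N gN]]; split; first exact: measurable_funD.
by exists (M + N) => x; rewrite (le_trans (ler_normD _ _))// lerD.
Qed.

Lemma bounded_measurableZ (c : R) f : bounded_measurable f ->
  bounded_measurable (fun x => c * f x).
Proof.
move=> [mf [M fM]]; split; first exact: measurable_funM.
by exists (`|c| * M) => x; rewrite normrM ler_wpM2l.
Qed.

Lemma bounded_measurableB f g : bounded_measurable f -> bounded_measurable g ->
  bounded_measurable (fun x => f x - g x).
Proof.
move=> [mf [M fM]] [mg [N gN]]; split; first exact: measurable_funB.
by exists (M + N) => x; rewrite (le_trans (ler_normB _ _))// lerD.
Qed.

Lemma bounded_measurable_norm f : bounded_measurable f ->
  bounded_measurable (fun x => `|f x|).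
Proof.
move=> [mf [M fM]]; split; first exact: measurableT_comp.
by exists M => x; rewrite normr_id.
Qed.

Lemma bounded_measurable_cst (c : R) : bounded_measurable (fun=> c).
Proof. by split; [exact: measurable_cst|exists `|c|]. Qed.

Lemma bounded_measurable_indic (A : set R) : measurable A ->
  bounded_measurable (\1_A : R -> R).
Proof.
move=> mA; split; first exact: measurable_indic.
by exists 1 => x; rewrite indicE; case: (x \in A); rewrite ?normr1 ?normr0.
Qed.

Lemma bounded_measurable_sum (I : Type) (s : seq I) (F : I -> R -> R) :
  (forall i, bounded_measurable (F i)) ->
  bounded_measurable (fun x => \sum_(i <- s) F i x).
Proof.
move=> hF; elim: s => [|i s ih].
  rewrite (_ : (fun x => _) = fun=> 0); first exact: bounded_measurable_cst.
  by apply/funext => x; rewrite big_nil.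
rewrite (_ : (fun x => _) = fun x => F i x + \sum_(j <- s) F j x).
  exact: bounded_measurableD.
by apply/funext => x; rewrite big_cons.
Qed.

End bounded_measurable.

Section singular_form.
Context {R : realType} (T al : R).
Hypothesis T_gt0 : 0 < T.
Hypothesis al_gt0 : 0 < al.
Implicit Types f g h : R -> R.

Let mu : {measure set (measurableTypeR R) -> \bar R} := @lebesgue_measure R.
Local Notation leb2 := (@lebesgue_measure R \x @lebesgue_measure R)%E.

(** Putting the domain [[0, T] x [0, T]] into the kernel lets Fubini's theorem be
    used on the whole plane. *)
Definition cut_kernel (p : measurableTypeR R * measurableTypeR R) : R :=
  `|p.1 - p.2| `^ (al - 1) * \1_(`[0, T]%classic : set R) p.1 * \1_(`[0, T]%classic : set R) p.2.

Lemma cut_kernel_ge0 p : 0 <= cut_kernel p.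
Proof. by rewrite /cut_kernel !mulr_ge0 ?powR_ge0// indicE. Qed.

Lemma measurable_cut_kernel : measurable_fun setT cut_kernel.
Proof.
apply: measurable_funM; first apply: measurable_funM.
- apply: (measurableT_comp (measurable_powR (al - 1))).
  by apply: measurableT_comp => //; apply: measurable_funB.
- by apply: measurableT_comp => //; exact: measurable_indic.
- by apply: measurableT_comp => //; exact: measurable_indic.
Qed.

Lemma iterated_cut_kernel f g :
  (\int[lebesgue_measure]_x \int[lebesgue_measure]_y (cut_kernel (x, y) * (f x * g y))%:E =
  \int[lebesgue_measure]_(r in `[0%R, T]) \int[lebesgue_measure]_(v in `[0%R, T])
     (`|r - v| `^ (al - 1) * f r * g v)%:E)%E.
Proof.
rewrite [RHS]integral_mkcond; apply: eq_integral => x _.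
rewrite patchE; case: ifPn => xD.
  rewrite [RHS]integral_mkcond; apply: eq_integral => y _.
  rewrite patchE /cut_kernel !indicE/= xD; case: ifPn => yD.
    by rewrite !mulr1 mulrA.
  by rewrite mulr0 mul0r.
apply: integral0_eq => y _; rewrite /cut_kernel !indicE/= (negbTE xD).
by rewrite mulr0 !mul0r.
Qed.

Lemma potential_le r : r \in `[0, T] ->
  0 <= (r `^ al + (T - r) `^ al) / al <= 2 * T `^ al / al.
Proof.
rewrite in_itv/= => /andP[r0 rT]; rewrite divr_ge0 ?addr_ge0 ?powR_ge0 ?(ltW al_gt0)//=.
rewrite ler_pM2r ?invr_gt0// mulr_natl mulr2n lerD//.
  by rewrite ge0_ler_powR ?nnegrE ?(ltW al_gt0)// (le_trans r0).
rewrite ge0_ler_powR ?nnegrE ?(ltW al_gt0)// ?subr_ge0 ?gerBl//.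
exact: ltW.
Qed.

Lemma cut_kernel_integrable : leb2.-integrable setT (EFin \o cut_kernel).
Proof.
apply/integrable12ltyP; first by apply/measurable_EFinP; exact: measurable_cut_kernel.
have -> : (\int[lebesgue_measure]_x \int[lebesgue_measure]_y `|(EFin \o cut_kernel) (x, y)|)%E =
  (\int[lebesgue_measure]_x \int[lebesgue_measure]_y (cut_kernel (x, y) * ((fun=> 1) x * (fun=> 1) y))%:E)%E.
  apply: eq_integral => x _; apply: eq_integral => y _ /=.
  by rewrite ger0_norm ?cut_kernel_ge0// !mulr1.
rewrite iterated_cut_kernel.
have -> : (\int[lebesgue_measure]_(r in `[0%R, T]) \int[lebesgue_measure]_(v in `[0%R, T])
     (`|r - v| `^ (al - 1) * 1 * 1)%:E = \int[lebesgue_measure]_(r in `[0%R, T]) \int[lebesgue_measure]_(v in `[0%R, T])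
     (`|r - v| `^ (al - 1))%:E)%E.
  by apply: eq_integral => x _; apply: eq_integral => y _; rewrite !mulr1.
by rewrite integral_square_kernel// ?ltry// ltW.
Qed.

Lemma weighted_integrable (F : measurableTypeR R * measurableTypeR R -> R) (M : R) :
  measurable_fun setT F -> (forall p, `|F p| <= M) ->
  leb2.-integrable setT (EFin \o (fun p => cut_kernel p * F p)).
Proof.
move=> mF FM.
have h : leb2.-integrable setT (EFin \o (fun p => M * cut_kernel p)).
  by apply: integrable_EFinZ => //; exact: cut_kernel_integrable.
apply: le_integrable h => //.
  by apply/measurable_EFinP; apply: measurable_funM => //; exact: measurable_cut_kernel.
move=> p _ /=; rewrite lee_fin normrM mulrC (ger0_norm (cut_kernel_ge0 _)).
have M0 : 0 <= M by rewrite (le_trans _ (FM p)).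
by rewrite [leRHS]ger0_norm ?mulr_ge0 ?cut_kernel_ge0// ler_wpM2r ?cut_kernel_ge0.
Qed.

Lemma tensor_integrable f g : bounded_measurable f -> bounded_measurable g ->
  leb2.-integrable setT (EFin \o (fun p => cut_kernel p * (f p.1 * g p.2))).
Proof.
move=> [mf [M fM]] [mg [N gN]]; apply: (@weighted_integrable _ (M * N)).
  by apply: measurable_funM; [exact: measurableT_comp mf _|exact: measurableT_comp mg _].
by move=> p; rewrite normrM ler_pM.
Qed.

(** For [al = 2 H - 1], the form [H (2 H - 1) Q] is the covariance of the Wiener
    integrals of [f] and [g]. *)
Definition singular_form f g : R :=
  Rintegral leb2 setT (fun p => cut_kernel p * (f p.1 * g p.2)).

Local Notation Q := singular_form.

Lemma singular_form_iterated f g : bounded_measurable f -> bounded_measurable g ->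
  (\int[lebesgue_measure]_(r in `[0%R, T]) \int[lebesgue_measure]_(v in `[0%R, T])
     (`|r - v| `^ (al - 1) * f r * g v)%:E = (Q f g)%:E)%E.
Proof.
move=> bf bg; rewrite -iterated_cut_kernel.
have i := tensor_integrable bf bg.
rewrite /Q /Rintegral fineK; last exact: integrable_fin_num.
by rewrite -(integral12_prod_meas1 i).
Qed.

Lemma singular_formC f g : bounded_measurable f -> bounded_measurable g -> Q f g = Q g f.
Proof.
move=> bf bg; apply: EFin_inj.
rewrite -singular_form_iterated// -singular_form_iterated// -2!iterated_cut_kernel.
rewrite (Fubini (tensor_integrable bf bg))/=.
apply: eq_integral => x _; apply: eq_integral => y _.
by rewrite /cut_kernel/= distrC; congr EFin; ring.
Qed.

Lemma singular_formDl f g h : bounded_measurable f -> bounded_measurable g -> bounded_measurable h ->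
  Q (fun x => f x + g x) h = Q f h + Q g h.
Proof.
move=> bf bg bh; rewrite /Q -RintegralD//; [|exact: tensor_integrable..].
by apply: eq_Rintegral => p _ /=; ring.
Qed.

Lemma singular_formZl c f h : bounded_measurable f -> bounded_measurable h ->
  Q (fun x => c * f x) h = c * Q f h.
Proof.
move=> bf bh; rewrite /Q -RintegralZl//; last exact: tensor_integrable.
by apply: eq_Rintegral => p _ /=; ring.
Qed.

Lemma singular_form_suml (I : Type) (s : seq I) (c : I -> R) (F : I -> R -> R) h :
  (forall i, bounded_measurable (F i)) -> bounded_measurable h ->
  Q (fun x => \sum_(i <- s) c i * F i x) h = \sum_(i <- s) c i * Q (F i) h.
Proof.
move=> bF bh; elim: s => [|i s ih].
  rewrite big_nil /Q (_ : (fun p => _) = fun=> 0).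
    by rewrite Rintegral_cst// mul0r.
  by apply/funext => p; rewrite big_nil mul0r mulr0.
rewrite big_cons -ih -singular_formZl// -singular_formDl//.
- by congr (Q _ h); apply/funext => x; rewrite big_cons.
- exact: bounded_measurableZ.
- by apply: bounded_measurable_sum => j; exact: bounded_measurableZ.
Qed.

Lemma singular_formB f g : bounded_measurable f -> bounded_measurable g ->
  forall t, Q (fun x => f x + t * g x) (fun x => f x + t * g x) =
  Q f f + 2 * t * Q f g + t ^+ 2 * Q g g.
Proof.
move=> bf bg t; have btg := bounded_measurableZ t bg.
have bs := bounded_measurableD bf btg.
rewrite singular_formDl// singular_formZl//.
rewrite [Q f _]singular_formC// [Q g _]singular_formC//.
rewrite !singular_formDl// !singular_formZl// (singular_formC bg bf).
by ring.
Qed.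

(** The potential of the kernel being bounded, one argument is controlled by its
    supremum and the other by its integral: the form is continuous for [L^1]
    convergence of uniformly bounded functions. *)
Lemma singular_form_bound f g (M : R) : bounded_measurable f -> bounded_measurable g ->
  (forall x, `|g x| <= M) ->
  `|Q f g| <= M * (2 * T `^ al / al) * \int[lebesgue_measure]_(r in `[0, T]) `|f r|.
Proof.
move=> bf bg gM.
have M0 : 0 <= M by rewrite (le_trans _ (gM 0)).
have bnf := bounded_measurable_norm bf.
have bM := bounded_measurable_cst M.
apply: (@le_trans _ _ (Q (fun x => `|f x|) (fun=> M))).
  rewrite /Q; apply: (le_trans (le_normr_Rintegral _ (tensor_integrable bf bg))) => //.
  apply: le_Rintegral => //.
  - by apply: integrable_EFin_norm => //; exact: tensor_integrable.
  - exact: (tensor_integrable bnf bM).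
  - move=> p _; rewrite normrM (ger0_norm (cut_kernel_ge0 _)) normrM.
    by rewrite ler_wpM2l ?cut_kernel_ge0// ler_wpM2l.
have fi : lebesgue_measure.-integrable `[0, T] (EFin \o (fun r => `|f r|)).
  have [mf [N fN]] := bnf.
  have h : lebesgue_measure.-integrable `[0, T] (EFin \o (fun=> N)).
    by apply: continuous_itv_integrable; apply: continuous_subspaceT => r; exact: cvg_cst.
  apply: le_integrable h => //.
  - by apply/measurable_EFinP; exact: measurable_funTS.
  - by move=> r _ /=; rewrite lee_fin (le_trans (fN r))// ler_norm.
rewrite -RintegralZl// -lee_fin -singular_form_iterated//.
rewrite /Rintegral fineK; last first.
  by apply: integrable_fin_num => //; exact: integrable_EFinZ.
have [mf _] := bnf.
apply: (@le_trans _ _ (\int[lebesgue_measure]_(r in `[0%R, T])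
    (`|f r| * M * ((r `^ al + (T - r) `^ al) / al))%:E)%E).
  rewrite le_eqVlt; apply/orP; left; apply/eqP.
  apply: eq_integral => r; rewrite inE/= in_itv/= => /andP[r0 rT].
  under eq_integral => v _ do rewrite -mulrA mulrC EFinM.
  rewrite ge0_integralZl//; last 2 first.
  - by apply: measurable_norm_powR.
  - by rewrite lee_fin mulr_ge0.
  by rewrite integral_kernel// -EFinM.
apply: ge0_le_integral => //.
- move=> r rT; have /andP[p0 p1] := potential_le rT.
  by rewrite lee_fin (mulr_ge0 _ p0)// mulr_ge0.
- apply/measurable_EFinP; apply: measurable_funM.
    by apply: measurable_funM => //; exact: measurable_funTS.
  apply: measurable_funM => //; apply: measurable_funD.
    by apply: measurable_funTS; exact: measurable_powR.
  apply: measurable_funTS; apply: (measurableT_comp (measurable_powR al)).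
  exact: measurable_funB.
- by apply/measurable_EFinP; apply: measurable_funM => //; exact: measurable_funTS.
- move=> r rT; have /andP[p0 p1] := potential_le rT.
  rewrite lee_fin [M * _]mulrC -mulrA [leRHS]mulrC ler_wpM2l//.
  by rewrite [leRHS]mulrC ler_wpM2l.
Qed.

Lemma singular_form_indic (p q : R) : 0 <= p -> p <= T -> 0 <= q -> q <= T ->
  Q (\1_(`]0, p]%classic : set R)) (\1_(`]0, q]%classic : set R)) =
  (p `^ (al + 1) + q `^ (al + 1) - `|q - p| `^ (al + 1)) / (al * (al + 1)).
Proof.
wlog pq : p q / p <= q => [hw|p0 pT q0 qT].
  move=> p0 pT q0 qT; have [pq|qp] := leP p q; first exact: hw.
  rewrite singular_formC; [|exact: bounded_measurable_indic..].
  by rewrite hw// ?(ltW qp)// [q `^ _ + _]addrC distrC.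
apply: EFin_inj; rewrite -singular_form_iterated; [|exact: bounded_measurable_indic..].
rewrite ger0_norm ?subr_ge0// -integral_square_kernel//.
have kI c (r : R) : 0 <= c -> c <= T ->
    (\int[lebesgue_measure]_(v in `[0%R, T]) (`|r - v| `^ (al - 1) * \1_(`]0, c]%classic : set R) v)%:E
    = \int[lebesgue_measure]_(v in `[0%R, c]) (`|r - v| `^ (al - 1))%:E)%E.
  move=> c0 cT; rewrite -[RHS]integral_itv_obnd_cbnd; last exact: measurable_norm_powR.
  rewrite integral_mkcond [RHS]integral_mkcond; apply: eq_integral => v _.
  rewrite !patchE indicE; case: ifPn => [vT|].
    by case: ifPn => _; rewrite ?mulr1 ?mulr0.
  rewrite notin_setE/= in_itv/= => vT; rewrite memNset//= in_itv/= => /andP[v0 vc].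
  by apply: vT; rewrite (ltW v0) (le_trans vc).
transitivity (\int[lebesgue_measure]_(r in `[0%R, T])
  ((\int[lebesgue_measure]_(v in `[0%R, q]) (`|r - v| `^ (al - 1))%:E) * (\1_(`]0, p]%classic : set R) r)%:E))%E.
  apply: eq_integral => r _; rewrite -kI//.
  rewrite muleC -ge0_integralZl//.
  - by apply: eq_integral => v _; rewrite -EFinM; congr EFin; ring.
  - apply/measurable_EFinP; apply: measurable_funM.
      by apply/measurable_EFinP; exact: measurable_norm_powR.
    by apply: measurable_funTS; exact: measurable_indic.
transitivity (\int[lebesgue_measure]_(r in `]0%R, p]) \int[lebesgue_measure]_(v in `[0%R, q]) (`|r - v| `^ (al - 1))%:E)%E.
  rewrite integral_mkcond [RHS]integral_mkcond; apply: eq_integral => v _.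
  rewrite !patchE indicE; case: ifPn => [vT|].
    by case: ifPn => _; rewrite ?mule1 ?mule0.
  rewrite notin_setE/= in_itv/= => vT; rewrite memNset//= in_itv/= => /andP[v0 vc].
  by apply: vT; rewrite (ltW v0) (le_trans vc).
apply: integral_itv_obnd_cbnd.
apply: (@eq_measurable_fun _ _ _ _ _ (fun r => ((r `^ al + (q - r) `^ al) / al)%:E)).
  move=> r; rewrite inE/= in_itv/= => /andP[r0 rp].
  by rewrite integral_kernel// ?(ltW r0)// (le_trans rp).
apply/measurable_EFinP; apply: measurable_funM => //; apply: measurable_funD.
  by apply: measurable_funTS; exact: measurable_powR.
apply: measurable_funTS; apply: (measurableT_comp (measurable_powR al)).
exact: measurable_funB.
Qed.

End singular_form.

(** * Second moments *)

(** The inequality [(a + b)^2 <= (1 + k) a^2 + (1 + 1 / k) b^2], for all [k > 0],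
    replaces the triangle inequality of a Hilbert norm: it serves both for second
    moments and for the singular form, without square roots. *)
Lemma squeeze_quadratic {R : realType} (A : R) (B e : R^nat) :
  0 <= A -> (forall n, 0 <= B n) -> (forall n, 0 <= e n) -> e n @[n --> \oo] --> 0 ->
  (forall n (k : R), 0 < k -> A <= (1 + k) * B n + (1 + k^-1) * e n) ->
  (forall n (k : R), 0 < k -> B n <= (1 + k) * A + (1 + k^-1) * e n) ->
  B n @[n --> \oo] --> A.
Proof.
move=> A0 B0 e0 ecv hA hB; apply/cvgrPdist_le => d d0.
pose k := Num.min 1 (d / (4 * (A + 1))).
have A1 : 0 < 4 * (A + 1) by rewrite mulr_gt0// ltr_wpDl.
have k0 : 0 < k by rewrite lt_min ltr01 divr_gt0.
have k1 : k <= 1 by rewrite ge_min lexx.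
have kA : k * (4 * (A + 1)) <= d by rewrite -ler_pdivlMr// ge_min lexx orbT.
have kk : 0 < 1 + k^-1 by rewrite addr_gt0 ?invr_gt0.
near=> n.
have en : e n <= d / (4 * (1 + k^-1)) .
  near: n; apply: cvgr_le; first exact: ecv.
  by rewrite divr_gt0// mulr_gt0.
have en1 : e n <= 1 by near: n; apply: cvgr_le; first exact: ecv.
have he : (1 + k^-1) * e n <= d / 4.
  move: en; rewrite ler_pdivlMr ?mulr_gt0// => en.
  by rewrite ler_pdivlMr//; lra.
have h1 := hA n k k0; have h2 := hB n k k0; have h3 := hB n 1 ltr01.
have h4 : k * B n <= k * (2 * A + 2).
  by rewrite ler_wpM2l ?(ltW k0)//; move: h3; rewrite invr1; lra.
rewrite ler_norml; apply/andP; split; lra.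
Unshelve. all: by end_near. Qed.

Section square_integrable.
Context d (E : measurableType d) (R : realType) (P : probability E R).
Implicit Types f g : E -> R.

Definition square_integrable f := measurable_fun setT f /\
  P.-integrable setT (EFin \o (fun w => f w ^+ 2)).

Definition second_moment f : R := \int[P]_w (f w ^+ 2).

Lemma Lnorm2E f : measurable_fun setT f ->
  Lnorm P 2%:E (EFin \o f) = ((\int[P]_w (f w ^+ 2)%:E) `^ 2^-1)%E.
Proof.
move=> mf; rewrite unlock; congr (_ `^ _)%E; apply: eq_integral => w _ /=.
by rewrite powR_mulrn// real_normK// num_real.
Qed.

Lemma Lfun2P f : f \in Lfun P 2%:E <-> square_integrable f.
Proof.
split=> [h|[mf i]].
  split; last exact: Lfun2_integrable_sqr.
  by move: h; rewrite inE => /andP[]; rewrite inE.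
rewrite inE; apply/andP; split; rewrite inE//=.
rewrite /finite_norm Lnorm2E// poweR_lty//.
by have := integrable_fin_num measurableT i; rewrite fin_numElt => /andP[].
Qed.

Lemma square_integrableD f g : square_integrable f -> square_integrable g ->
  square_integrable (fun w => f w + g w).
Proof.
move=> [mf fi] [mg gi]; have mfg : measurable_fun setT (fun w => f w + g w) by exact: measurable_funD.
split => //.
have h : P.-integrable setT (fun w => (2 * f w ^+ 2 + 2 * g w ^+ 2)%:E).
  apply: (@integrable_EFinD _ _ _ P setT measurableT (fun w => 2 * f w ^+ 2) (fun w => 2 * g w ^+ 2)).
    exact: integrable_EFinZ.
  exact: integrable_EFinZ.
apply: le_integrable h => //.
  by apply/measurable_EFinP; exact: measurable_funX.
move=> w _ /=; have f2 := sqr_ge0 (f w); have g2 := sqr_ge0 (g w).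
have fg2 : 0 <= 2 * f w ^+ 2 + 2 * g w ^+ 2 by lra.
rewrite lee_fin (ger0_norm (sqr_ge0 _)) (ger0_norm fg2).
by have := sqr_ge0 (f w - g w); lra.
Qed.

Lemma square_integrableZ (c : R) f : square_integrable f ->
  square_integrable (fun w => c * f w).
Proof.
move=> [mf fi]; split; first exact: measurable_funM.
rewrite (_ : EFin \o _ = fun w => (c ^+ 2 * f w ^+ 2)%:E).
  exact: integrable_EFinZ.
by apply/funext => w /=; rewrite exprMn.
Qed.

Lemma square_integrableB f g : square_integrable f -> square_integrable g ->
  square_integrable (fun w => f w - g w).
Proof.
move=> hf hg; have := square_integrableD hf (square_integrableZ (-1) hg).
by under eq_fun do rewrite mulN1r.
Qed.

Lemma square_integrable_cst (c : R) : square_integrable (fun=> c).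
Proof.
split; first exact: measurable_cst.
exact: finite_measure_integrable_cst.
Qed.

Lemma square_integrable_sum (I : Type) (s : seq I) (F : I -> E -> R) :
  (forall i, square_integrable (F i)) ->
  square_integrable (fun w => \sum_(i <- s) F i w).
Proof.
move=> hF; elim: s => [|i s ih].
  rewrite (_ : (fun x => _) = fun=> 0); first exact: square_integrable_cst.
  by apply/funext => x; rewrite big_nil.
rewrite (_ : (fun x => _) = fun x => F i x + \sum_(j <- s) F j x).
  exact: square_integrableD.
by apply/funext => x; rewrite big_cons.
Qed.

Lemma square_integrable_mul f g : square_integrable f -> square_integrable g ->
  P.-integrable setT (EFin \o (fun w => f w * g w)).
Proof.
move=> /Lfun2P hf /Lfun2P hg; have := Lfun2_mul_Lfun1 hf hg.
by move/Lfun1_integrable.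
Qed.

Lemma square_integrable1 f : square_integrable f -> P.-integrable setT (EFin \o f).
Proof.
move=> hf; have := square_integrable_mul hf (square_integrable_cst 1).
by rewrite (_ : EFin \o (fun w => f w * 1) = EFin \o f)//; apply/funext => w /=; rewrite mulr1.
Qed.

Lemma second_moment_ge0 f : 0 <= second_moment f.
Proof. by apply: Rintegral_ge0 => w _; exact: sqr_ge0. Qed.

Lemma second_momentE f : square_integrable f ->
  (\int[P]_w (f w ^+ 2)%:E = (second_moment f)%:E)%E.
Proof. by move=> [mf fi]; rewrite /second_moment /Rintegral fineK//; exact: integrable_fin_num. Qed.

Lemma second_moment_le f g (k : R) : square_integrable f -> square_integrable g ->
  0 < k -> second_moment f <= (1 + k) * second_moment g + (1 + k^-1) * second_moment (fun w => f w - g w).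
Proof.
move=> hf hg k0; have [_ fi] := hf; have [_ gi] := hg.
have hfg := square_integrableB hf hg; have [_ fgi] := hfg.
rewrite /second_moment -RintegralZl// -RintegralZl// -RintegralD//; last 2 first.
- exact: integrable_EFinZ.
- exact: integrable_EFinZ.
apply: le_Rintegral => //.
  apply: (@integrable_EFinD _ _ _ P setT measurableT (fun w => (1 + k) * g w ^+ 2)
    (fun w => (1 + k^-1) * (f w - g w) ^+ 2)); exact: integrable_EFinZ.
move=> w _.
have h := sqr_ge0 (k * g w - (f w - g w)).
rewrite -subr_ge0 -(pmulr_rge0 _ k0).
have -> : k * ((1 + k) * g w ^+ 2 + (1 + k^-1) * (f w - g w) ^+ 2 - f w ^+ 2) =
  (k * g w - (f w - g w)) ^+ 2 by field; rewrite gt_eqF.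
by [].
Qed.

Lemma Lnorm2_second_moment f : square_integrable f ->
  Lnorm P 2%:E (EFin \o f) = (Num.sqrt (second_moment f))%:E.
Proof.
move=> hf; rewrite Lnorm2E; last exact: hf.1.
by rewrite second_momentE// poweR_EFin powR12_sqrt// second_moment_ge0.
Qed.

Lemma cvg_second_moment (F : nat -> E -> R) f : (forall n, square_integrable (F n)) ->
  square_integrable f ->
  Lnorm P 2%:E (EFin \o (F n \- f)) @[n --> \oo] --> 0%E ->
  second_moment (fun w => F n w - f w) @[n --> \oo] --> 0.
Proof.
move=> hF hf; have hB n := square_integrableB (hF n) hf.
rewrite (_ : (fun n => _) = (fun n => (Num.sqrt (second_moment (fun w => F n w - f w)))%:E)); last first.
  by apply/funext => n; exact: Lnorm2_second_moment (hB n).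
move=> /fine_cvgP[_ /=] h.
have h2 : Num.sqrt (second_moment (fun w => F n w - f w)) ^+ 2 @[n --> \oo] --> (0 : R).
  rewrite -(mulr0 0); under eq_fun do rewrite expr2.
  by apply: cvgM; exact: h.
by under eq_fun do rewrite -[second_moment _]sqr_sqrtr ?second_moment_ge0//.
Qed.

Lemma second_moment_cvg (F : nat -> E -> R) f : (forall n, square_integrable (F n)) ->
  square_integrable f ->
  second_moment (fun w => F n w - f w) @[n --> \oo] --> 0 ->
  second_moment (F n) @[n --> \oo] --> second_moment f.
Proof.
move=> hF hf cv.
apply: (@squeeze_quadratic _ (second_moment f) (fun n => second_moment (F n))
  (fun n => second_moment (fun w => F n w - f w))) => //.
- exact: second_moment_ge0.
- by move=> n; exact: second_moment_ge0.
- by move=> n; exact: second_moment_ge0.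
- move=> n k k0; have := second_moment_le hf (hF n) k0.
  rewrite (_ : second_moment (fun w => f w - F n w) = second_moment (fun w => F n w - f w))//.
  by apply: eq_Rintegral => w _; rewrite -sqrrN opprB.
- by move=> n k k0; exact: second_moment_le.
Qed.

Definition L2_inner f g : R := \int[P]_w (f w * g w).

Lemma L2_innerC f g : L2_inner f g = L2_inner g f.
Proof. by apply: eq_Rintegral => w _; rewrite mulrC. Qed.

Lemma L2_inner_suml (I : Type) (s : seq I) (c : I -> R) (F : I -> E -> R) g :
  (forall i, square_integrable (F i)) -> square_integrable g ->
  L2_inner (fun w => \sum_(i <- s) c i * F i w) g = \sum_(i <- s) c i * L2_inner (F i) g.
Proof.
move=> hF hg; elim: s => [|i s ih].
  rewrite big_nil /L2_inner (_ : (fun p => _) = fun=> 0).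
    by rewrite Rintegral_cst// mul0r.
  by apply/funext => p; rewrite big_nil mul0r.
have hs : square_integrable (fun w => \sum_(i <- s) c i * F i w).
  by apply: square_integrable_sum => j; exact: square_integrableZ.
rewrite big_cons -ih /L2_inner -RintegralZl//; last exact: square_integrable_mul.
rewrite -RintegralD//.
- by apply: eq_Rintegral => w _; rewrite big_cons; ring.
- by apply: integrable_EFinZ => //; exact: square_integrable_mul.
- exact: square_integrable_mul.
Qed.

End square_integrable.

(** * Density of step functions *)

Section grid_approximation.
Context {R : realType} (T : R).
Hypothesis T_gt0 : 0 < T.
Implicit Types f : R -> R.

Definition grid (n k : nat) : R := T * k%:R / n.+1%:R.

(** Values are taken at the left end of each interval of the grid. Discretising
    the paths of a process in this way gives a jointly measurable process. *)
Definition grid_step n f (r : R) : R :=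
  \sum_(k < n.+1) f (grid n k) * \1_(`]grid n k, grid n k.+1]%classic : set R) r.

Lemma grid_in n k : (k <= n.+1)%N -> 0 <= grid n k /\ grid n k <= T.
Proof.
move=> kn; rewrite /grid divr_ge0 ?mulr_ge0 ?(ltW T_gt0)//; split => //.
by rewrite ler_pdivrMr// ler_pM2l// ler_nat.
Qed.

Lemma grid_mono n k : grid n k <= grid n k.+1.
Proof. by rewrite ler_pM2r ?invr_gt0// ler_pM2l// ler_nat. Qed.

Lemma grid_step_size n k : grid n k.+1 - grid n k = T / n.+1%:R.
Proof. by rewrite /grid -mulrBl -mulrBr -natrB// subSnn mulr1. Qed.

Lemma indic_oc (s t r : R) : 0 <= s -> s <= t ->
  \1_(`]s, t]%classic : set R) r = \1_(`]0, t]%classic : set R) r - \1_(`]0, s]%classic : set R) r :> R.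
Proof.
move=> s0 st; rewrite !indicE !mem_setE !in_itv/=.
have [rs|sr] := leP r s; last first.
  by rewrite (le_lt_trans s0 sr)/= subr0.
rewrite (le_trans rs st) !andbT/=.
by case: (0 < r); rewrite ?subrr// subr0.
Qed.

Lemma grid_partition n (r : R) : 0 < r -> r <= T ->
  \sum_(k < n.+1) \1_(`]grid n k, grid n k.+1]%classic : set R) r = 1 :> R.
Proof.
move=> r0 rT.
transitivity (\sum_(k < n.+1) (\1_(`]0, grid n k.+1]%classic : set R) r
   - \1_(`]0, grid n k]%classic : set R) r) : R).
  apply: eq_bigr => k _; apply: indic_oc; last exact: grid_mono.
  by have [] := @grid_in n k (ltnW (ltn_ord k)).
rewrite -(big_mkord xpredT (fun k => \1_(`]0, grid n k.+1]%classic : set R) r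
   - \1_(`]0, grid n k]%classic : set R) r : R)) telescope_sumr//.
rewrite /grid mulfK ?pnatr_eq0// mulr0 mul0r !indicE !mem_setE !in_itv/= r0 rT.
by rewrite leNgt r0 subr0.
Qed.

Lemma grid_step_close n f (r e : R) : 0 < r -> r <= T ->
  (forall s, s \in `[0, T] -> `|s - r| <= T / n.+1%:R -> `|f r - f s| <= e) ->
  `|f r - grid_step n f r| <= e.
Proof.
move=> r0 rT fe.
have -> : f r - grid_step n f r = \sum_(k < n.+1)
    (f r - f (grid n k)) * \1_(`]grid n k, grid n k.+1]%classic : set R) r.
  rewrite -[f r in LHS]mulr1 -(grid_partition n r0 rT) mulr_sumr /grid_step -sumrB.
  by apply: eq_bigr => k _; rewrite mulrBl.
apply: (le_trans (ler_norm_sum _ _ _)).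
rewrite -[e]mulr1 -(grid_partition n r0 rT) mulr_sumr; apply: ler_sum => k _.
rewrite normrM indicE mem_setE in_itv/=.
have [/andP[kr rk]|_] := boolP (grid n k < r <= grid n k.+1); last by rewrite normr0 !mulr0.
rewrite normr1 !mulr1; have [k0 kT] := @grid_in n k (ltnW (ltn_ord k)).
apply: fe; first by rewrite in_itv/= k0.
by rewrite -(grid_step_size n k) distrC ger0_norm ?subr_ge0 ?(ltW kr)// lerD2r.
Qed.

Lemma grid_step_norm n f (M r : R) : (forall s, `|f s| <= M) -> `|grid_step n f r| <= M.
Proof.
move=> fM; have M0 : 0 <= M by rewrite (le_trans _ (fM 0)).
have [/andP[r0 rT]|rN] := boolP ((0 < r) && (r <= T)).
  apply: (le_trans (ler_norm_sum _ _ _)).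
  rewrite -[M]mulr1 -(grid_partition n r0 rT) mulr_sumr; apply: ler_sum => k _.
  by rewrite normrM indicE; case: (_ \in _); rewrite ?normr0 ?mulr0// normr1 !mulr1.
rewrite /grid_step big1 ?normr0// => k _; rewrite indicE mem_setE in_itv/=.
have [k0 _] := @grid_in n k (ltnW (ltn_ord k)); have [_ kT] := @grid_in n k.+1 (ltn_ord k).
have [/andP[kr rk]|_] := boolP (grid n k < r <= grid n k.+1); last by rewrite mulr0.
by move: rN; rewrite (le_lt_trans k0 kr) (le_trans rk kT).
Qed.

Lemma grid_step_cvg f (r : R) : {within `[0, T], continuous f} -> 0 < r -> r <= T ->
  grid_step n f r @[n --> \oo] --> f r.
Proof.
move=> cf r0 rT; apply/cvgrPdist_le => e e0.
have rin : r \in `[0, T] by rewrite in_itv/= (ltW r0).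
have [d d0 dP] := within_itv_dist cf rin e0.
near=> n; apply: grid_step_close => // s sT sr.
rewrite distrC; apply: ltW; apply: dP => //; apply: le_lt_trans sr _.
near: n; have h : T * (n.+1%:R)^-1 @[n --> \oo] --> T * 0 by apply: cvgMr; exact: cvg_harmonic.
by rewrite mulr0 in h; apply: cvgr_lt; first exact: h.
Unshelve. all: by end_near. Qed.

Definition grid_triples n f : seq (R * R * R) :=
  [seq (f (grid n k), grid n k, grid n k.+1) | k <- iota 0 n.+1].

Lemma grid_triples_valid n f : valid_step T (grid_triples n f).
Proof.
apply/allP => q /mapP[k]; rewrite mem_iota add0n => /andP[_ kn] -> /=.
have [-> _] := @grid_in n k (ltnW kn); have [_ ->] := @grid_in n k.+1 kn.
by rewrite grid_mono.
Qed.

Lemma step_fun_grid n f : step_fun (grid_triples n f) = grid_step n f.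
Proof.
apply/funext => r; rewrite /step_fun /grid_step big_map/=.
by rewrite -(big_mkord xpredT (fun k => f (grid n k) * \1_(`]grid n k, grid n k.+1]%classic : set R) r)) /index_iota subn0.
Qed.

Lemma measurable_grid_step n f : measurable_fun setT (grid_step n f).
Proof.
by apply: measurable_sum => k; apply: measurable_funM.
Qed.

Lemma ecvg0_lt (v : (\bar R)^nat) (e : R) : v n @[n --> \oo] --> 0%E -> 0 < e ->
  \forall n \near \oo, (v n < e%:E)%E.
Proof.
move=> /fine_cvgP[fv cv] e0; near=> n.
rewrite -[v n]fineK ?lte_fin; last by near: n.
by near: n; exact: (cvgr_lt _ cv).
Unshelve. all: by end_near. Qed.

(** A continuous approximation in [L^1] is truncated at the level [M] and then
    discretised. The supremum bound is kept because the singular form is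
    continuous for [L^1] convergence only on uniformly bounded functions. *)
Lemma step_dense f (M e : R) : measurable_fun setT f -> (forall x, `|f x| <= M) -> 0 < e ->
  exists phi, [/\ valid_step T phi, measurable_fun setT (step_fun phi),
    forall x, `|step_fun phi x| <= M &
    \int[lebesgue_measure]_(r in `[0, T]) `|f r - step_fun phi r| <= e].
Proof.
move=> mf fM e0; have M0 : 0 <= M by rewrite (le_trans _ (fM 0)).
have ci (k0 : R) : lebesgue_measure.-integrable `[0, T] (EFin \o (fun=> k0)).
  by apply: continuous_itv_integrable; apply: continuous_subspaceT => r; exact: cvg_cst.
have bi (g : R -> R) (N : R) : measurable_fun setT g -> (forall x, `|g x| <= N) ->
    lebesgue_measure.-integrable `[0, T] (EFin \o g).
  move=> mg gN; apply: le_integrable (ci N) => //.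
    by apply/measurable_EFinP; exact: measurable_funTS.
  by move=> r _ /=; rewrite lee_fin (le_trans (gN r))// ler_norm.
have muT : (lebesgue_measure (`[0%R, T]%classic : set R) < +oo)%E.
  by rewrite lebesgue_measure_itv/= lte_fin T_gt0 -EFinD ltry.
have [g_ [cg gi gcv]] := approximation_continuous_integrable (measurable_itv `[0, T]) muT (bi _ _ mf fM).
have e20 : 0 < e / 2 by rewrite divr_gt0.
have [n gn] : exists n, (\int[lebesgue_measure]_(z in `[0%R, T]) `|(f z - g_ n z)%:E| < (e / 2)%:E)%E.
  have [n _ hn] := ecvg0_lt gcv e20.
  by exists n; exact: hn (leqnn n).
(* truncation of [g_ n] at the levels - M and M *)
pose g x := (`|g_ n x + M| - `|g_ n x - M|) / 2.
have gP x : `|g x| <= M /\ `|f x - g x| <= `|f x - g_ n x|.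
  have := fM x; rewrite /g ler_norml => /andP[f1 f2].
  have [h1|h1] := ltP M (g_ n x).
    have -> : `|f x - g_ n x| = g_ n x - f x by rewrite ler0_norm; lra.
    rewrite (ger0_norm (_ : 0 <= g_ n x + M)); last lra.
    rewrite (ger0_norm (_ : 0 <= g_ n x - M)); last lra.
    by rewrite !ler_norml; lra.
  have [h2|h2] := ltP (g_ n x) (- M).
    have -> : `|f x - g_ n x| = f x - g_ n x by rewrite ger0_norm; lra.
    rewrite (ler0_norm (_ : g_ n x + M <= 0)); last lra.
    rewrite (ler0_norm (_ : g_ n x - M <= 0)); last lra.
    by rewrite !ler_norml; lra.
  rewrite (ger0_norm (_ : 0 <= g_ n x + M)); last lra.
  rewrite (ler0_norm (_ : g_ n x - M <= 0)); last lra.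
  have -> : (g_ n x + M - - (g_ n x - M)) / 2 = g_ n x by field.
  by split => //; rewrite ler_norml; lra.
have gM x : `|g x| <= M by have [] := gP x.
have fg x : `|f x - g x| <= `|f x - g_ n x| by have [] := gP x.
have cgc : continuous g.
  move=> x; apply: cvgMl; apply: cvgB; apply: cvg_norm.
    by apply: cvgD; [exact: cg|exact: cvg_cst].
  by apply: cvgB; [exact: cg|exact: cvg_cst].
have mg : measurable_fun setT g by exact: continuous_measurable_fun.
have cv : (\int[lebesgue_measure]_(r in `[0%R, T]) `|(g r - grid_step m g r)%:E|)%E @[m --> \oo] --> 0%E.
  have h : (\int[lebesgue_measure]_(r in `]0%R, T]) `|(g r - grid_step m g r)%:E|)%E @[m --> \oo]
      --> (\int[lebesgue_measure]_(r in `]0%R, T]) 0)%E.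
    apply: (dominated_cvg _ (g := fun=> (2 * M)%:E)) => //.
    - move=> m; apply/measurable_funTS/measurable_EFinP; apply: measurableT_comp => //.
      by apply: measurable_funB => //; exact: measurable_grid_step.
    - move=> r; rewrite /= in_itv/= => /andP[r0 rT].
      have h : `|g r - grid_step m g r| @[m --> \oo] --> `|g r - g r|.
        apply: cvg_norm; apply: cvgB; first exact: cvg_cst.
        by apply: grid_step_cvg => //; exact: continuous_subspaceT.
      rewrite subrr normr0 in h.
      by apply: cvg_EFin h; near=> m.
    - by apply: integrableS (ci (2 * M)) => //; exact: subset_itv_oc_cc.
    - move=> m r _ /=; rewrite lee_fin normr_id (le_trans (ler_normB _ _))//.
      by have := gM r; have := @grid_step_norm m g M r gM; lra.
  rewrite integral0 in h.
  rewrite (_ : (fun m => _) = (fun m => \int[lebesgue_measure]_(r in `]0%R, T]) `|(g r - grid_step m g r)%:E|)%E)//.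
  apply/funext => m; rewrite -integral_itv_obnd_cbnd//.
  apply/measurable_funTS/measurable_EFinP; apply: measurableT_comp => //.
  by apply: measurable_funB => //; exact: measurable_grid_step.
have [m hm] : exists m, (\int[lebesgue_measure]_(r in `[0%R, T]) `|(g r - grid_step m g r)%:E| < (e / 2)%:E)%E.
  have [m _ hm] := ecvg0_lt cv e20.
  by exists m; exact: hm (leqnn m).
exists (grid_triples m g); rewrite step_fun_grid; split.
- exact: grid_triples_valid.
- exact: measurable_grid_step.
- by move=> x; exact: grid_step_norm.
have ig : lebesgue_measure.-integrable `[0, T] (EFin \o g) by exact: bi gM.
have if_ : lebesgue_measure.-integrable `[0, T] (EFin \o f) by exact: bi fM.
have igs : lebesgue_measure.-integrable `[0, T] (EFin \o grid_step m g).
  by apply: (bi _ M); [exact: measurable_grid_step|move=> x; exact: grid_step_norm].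
apply: (@le_trans _ _ (\int[lebesgue_measure]_(r in `[0, T]) (`|f r - g_ n r| + `|g r - grid_step m g r|))).
  apply: le_Rintegral => //.
  - by apply: integrable_EFin_norm => //; exact: integrable_EFinB.
  - apply: (@integrable_EFinD _ _ _ lebesgue_measure _ (measurable_itv `[0, T])
      (fun r => `|f r - g_ n r|) (fun r => `|g r - grid_step m g r|)).
      by apply: integrable_EFin_norm => //; exact: integrable_EFinB.
    by apply: integrable_EFin_norm => //; exact: integrable_EFinB.
  - move=> r _; apply: le_trans (lerD (fg r) (lexx _)).
    by rewrite (le_trans _ (ler_normD _ _))// addrA subrK.
rewrite RintegralD//; last 2 first.
- by apply: integrable_EFin_norm => //; exact: integrable_EFinB.
- by apply: integrable_EFin_norm => //; exact: integrable_EFinB.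
rewrite [e]splitr lerD//.
- rewrite -lee_fin /Rintegral fineK; first exact: ltW.
  by apply: integrable_fin_num => //; apply: integrable_EFin_norm => //; exact: integrable_EFinB.
- rewrite -lee_fin /Rintegral fineK; first exact: ltW.
  by apply: integrable_fin_num => //; apply: integrable_EFin_norm => //; exact: integrable_EFinB.
Unshelve. all: by end_near. Qed.

End grid_approximation.

(** * Isometry of the Wiener integral *)

Section step_points.
Context {R : realType}.
Implicit Types phi : seq (R * R * R).

(** A step function as a combination of indicators of the intervals []0, tau]];
    the same combination of the [BH tau] has a known covariance. *)
Definition step_points phi : seq (R * R) :=
  flatten [seq [:: (q.1.1, q.2); (- q.1.1, q.1.2)] | q <- phi].

Lemma step_fun_points T phi (r : R) : valid_step T phi ->
  step_fun phi r = \sum_(p <- step_points phi) p.1 * \1_(`]0, p.2]%classic : set R) r.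
Proof.
rewrite /step_fun /step_points; elim: phi => [|q phi ih]; first by rewrite !big_nil.
move=> /= /andP[/andP[/andP[s0 st] _] vphi]; rewrite !big_cons/= ih// indic_oc//.
by rewrite mulrBr mulNr addrA.
Qed.

Lemma step_points_in T phi : valid_step T phi ->
  forall p, p \in step_points phi -> p.2 \in `[0, T].
Proof.
move=> /allP vphi p /flatten_mapP[q /vphi /andP[/andP[s0 st] tT]].
rewrite in_cons mem_seq1 => /orP[|] /eqP ->; rewrite in_itv/=.
  by rewrite (le_trans s0).
by rewrite s0 (le_trans st).
Qed.

Lemma bounded_measurable_step phi : bounded_measurable (step_fun phi).
Proof.
apply: bounded_measurable_sum => q; apply: bounded_measurableZ.
exact: bounded_measurable_indic.
Qed.

End step_points.

Section wiener_isometry.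
Context d (Omega : measurableType d) (R : realType) (P : probability Omega R).
Variables (T H : R) (BH : R -> {RV P >-> R}).
Hypothesis T_gt0 : 0 < T.
Hypothesis H_gt : 2^-1 < H.
Hypothesis BH_fbm : fractional_brownian_motion T H BH.

Local Notation al := (2 * H - 1).
Local Notation cH := (H * (2 * H - 1)).
Local Notation Q := (singular_form T (2 * H - 1)).

Lemma hurst_exponent_gt0 : 0 < al.
Proof. by move: H_gt; lra. Qed.

Lemma hurst_constant_gt0 : 0 < cH.
Proof. by rewrite mulr_gt0 ?hurst_exponent_gt0//; move: H_gt; lra. Qed.

Lemma fbm_covarianceE s t : s \in `[0, T] -> t \in `[0, T] ->
  (\int[P]_w (BH s w * BH t w)%:E =
   (2^-1 * (s `^ (2 * H) + t `^ (2 * H) - `|t - s| `^ (2 * H)))%:E)%E.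
Proof.
move=> sT tT; have [_ mean cov _] := BH_fbm.
rewrite -cov// covariance.unlock !mean//= unlock.
apply: eq_integral => w _.
by have -> : ((BH s \- cst 0) * (BH t \- cst 0)) w = (BH s w - 0) * (BH t w - 0) by []; rewrite !subr0.
Qed.

Lemma fbm_square_integrable t : t \in `[0, T] -> square_integrable P (BH t).
Proof.
move=> tT; split; first exact: measurable_funP.
apply/integrableP; split.
  by apply/measurable_EFinP; apply: measurable_funX; exact: measurable_funP.
have := fbm_covarianceE tT tT.
under eq_integral => w _ do rewrite -expr2.
move=> e; apply: (@le_lt_trans _ _ (\int[P]_w (BH t w ^+ 2)%:E)%E); last by rewrite e ltry.
rewrite le_eqVlt; apply/orP; left; apply/eqP.
by apply: eq_integral => w _ /=; rewrite ger0_norm ?sqr_ge0.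
Qed.

Lemma fbm_inner s t : s \in `[0, T] -> t \in `[0, T] ->
  L2_inner P (BH s) (BH t) =
  2^-1 * (s `^ (2 * H) + t `^ (2 * H) - `|t - s| `^ (2 * H)).
Proof. by move=> sT tT; rewrite /L2_inner /Rintegral fbm_covarianceE. Qed.

(** Zero off [[0, T]], so that all its values are square integrable. *)
Let B' (t : R) : Omega -> R := if t \in `[0, T] then (BH t : Omega -> R) else fun=> 0.

Let B'_sq t : square_integrable P (B' t).
Proof.
rewrite /B'; case: ifPn => tT; first exact: fbm_square_integrable.
exact: square_integrable_cst.
Qed.

Lemma step_integral_points phi w : valid_step T phi ->
  step_integral BH phi w = \sum_(p <- step_points phi) p.1 * B' p.2 w.
Proof.
rewrite /step_integral /step_points; elim: phi => [|q phi ih]; first by rewrite !big_nil.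
move=> /= /andP[/andP[/andP[s0 st] tT] vphi]; rewrite !big_cons/= ih//.
have -> : B' q.2 = BH q.2 by rewrite /B' in_itv/= tT (le_trans s0 st).
have -> : B' q.1.2 = BH q.1.2 by rewrite /B' in_itv/= s0 (le_trans st tT).
by rewrite mulrBr mulNr addrA.
Qed.

Lemma step_integral_square_integrable phi : valid_step T phi ->
  square_integrable P (step_integral BH phi).
Proof.
move=> v; rewrite (_ : step_integral BH phi = fun w => \sum_(p <- step_points phi) p.1 * B' p.2 w).
  by apply: square_integrable_sum => p; exact: square_integrableZ.
by apply/funext => w; exact: step_integral_points.
Qed.

Lemma step_integral_mean phi : valid_step T phi ->
  \int[P]_w (step_integral BH phi w) = 0.
Proof.
move=> v.
transitivity (L2_inner P (fun w => \sum_(p <- step_points phi) p.1 * B' p.2 w) (fun=> 1)).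
  by apply: eq_Rintegral => w _; rewrite step_integral_points// mulr1.
rewrite L2_inner_suml//; last exact: square_integrable_cst.
apply: big1_seq => p /andP[_ pin]; have pT := step_points_in v pin.
have [_ mean _ _] := BH_fbm.
rewrite /L2_inner /Rintegral /B' pT.
under eq_integral do rewrite mulr1.
by have := mean _ pT; rewrite unlock => ->; rewrite mulr0.
Qed.

Lemma indic_form s t : s \in `[0, T] -> t \in `[0, T] ->
  cH * Q (\1_(`]0, s]%classic : set R)) (\1_(`]0, t]%classic : set R)) = L2_inner P (BH s) (BH t).
Proof.
move=> sT tT; rewrite fbm_inner//.
move: sT tT; rewrite !in_itv/= => /andP[s0 sT] /andP[t0 tT].
rewrite singular_form_indic//; last exact: hurst_exponent_gt0.
rewrite subrK; field.
rewrite (gt_eqF hurst_exponent_gt0) gt_eqF//.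
by move: H_gt; lra.
Qed.

Lemma step_isometry phi : valid_step T phi ->
  second_moment P (step_integral BH phi) = cH * Q (step_fun phi) (step_fun phi).
Proof.
move=> v; set I := fun w => \sum_(p <- step_points phi) p.1 * B' p.2 w.
set F := fun r => \sum_(p <- step_points phi) p.1 * \1_(`]0, p.2]%classic : set R) r.
have IE : step_integral BH phi = I by apply/funext => w; exact: step_integral_points.
have FE : step_fun phi = F by apply/funext => r; exact: (step_fun_points _ v).
have sI : square_integrable P I by rewrite -IE; exact: step_integral_square_integrable.
have bF : bounded_measurable F by rewrite -FE; exact: bounded_measurable_step.
have bi p : bounded_measurable (\1_(`]0, p]%classic : set R) : R -> R) by exact: bounded_measurable_indic.
rewrite IE FE.
transitivity (L2_inner P I I); first by apply: eq_Rintegral => w _; rewrite expr2.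
rewrite {1}/I L2_inner_suml// {1}/F.
rewrite (singular_form_suml _ _ (step_points phi) (fun p => p.1) (F := fun p => \1_(`]0, p.2]%classic : set R)))//; last exact: hurst_exponent_gt0.
rewrite mulr_sumr; apply: eq_big_seq => p pin; have pT := step_points_in v pin.
rewrite mulrCA; congr (_ * _); rewrite L2_innerC {1}/I L2_inner_suml//.
rewrite (singular_formC T_gt0 hurst_exponent_gt0)// /F.
rewrite (singular_form_suml _ _ (step_points phi) (fun p => p.1) (F := fun p => \1_(`]0, p.2]%classic : set R)))//; last exact: hurst_exponent_gt0.
rewrite mulr_sumr; apply: eq_big_seq => q qin; have qT := step_points_in v qin.
by rewrite mulrCA indic_form// /B' qT pT.
Qed.

Lemma singular_form_step_ge0 phi : valid_step T phi -> 0 <= Q (step_fun phi) (step_fun phi).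
Proof.
move=> v; rewrite -(pmulr_rge0 _ hurst_constant_gt0) -step_isometry//.
exact: second_moment_ge0.
Qed.

(** For a step function the form is a second moment; the general case follows by
    density. *)
Lemma singular_form_ge0 f : bounded_measurable f -> 0 <= Q f f.
Proof.
move=> bf; have [mf [M fM]] := bf.
have M0 : 0 <= M by rewrite (le_trans _ (fM 0)).
apply/ler_addgt0Pr => e e0.
pose K := 2 * (M * (2 * T `^ al / al)).
have K0 : 0 <= K by rewrite !mulr_ge0 ?powR_ge0 ?invr_ge0 ?(ltW hurst_exponent_gt0).
have K1 : 0 < K + 1 by lra.
have [phi [v mphi phiM close]] := step_dense T_gt0 mf fM (divr_gt0 e0 K1).
have bphi := bounded_measurable_step phi.
have bD := bounded_measurableB bf bphi.
have h1 : Q f f = Q (step_fun phi) (step_fun phi) + (Q (fun x => f x - step_fun phi x) f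
   + Q (fun x => f x - step_fun phi x) (step_fun phi)).
  have e1 : Q f f = Q (fun x => f x - step_fun phi x) f + Q (step_fun phi) f.
    rewrite -singular_formDl//; last exact: hurst_exponent_gt0.
    by congr (Q _ _); apply/funext => x; rewrite subrK.
  have e2 : Q f (step_fun phi) = Q (fun x => f x - step_fun phi x) (step_fun phi) + Q (step_fun phi) (step_fun phi).
    rewrite -singular_formDl//; last exact: hurst_exponent_gt0.
    by congr (Q _ _); apply/funext => x; rewrite subrK.
  rewrite e1 (singular_formC T_gt0 hurst_exponent_gt0 bphi bf) e2; ring.
have b1 := singular_form_bound T_gt0 hurst_exponent_gt0 bD bf fM.
have b2 := singular_form_bound T_gt0 hurst_exponent_gt0 bD bphi phiM.
have h2 : K * \int[lebesgue_measure]_(r in `[0, T]) `|f r - step_fun phi r| <= e.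
  apply: (@le_trans _ _ (K * (e / (K + 1)))); first by rewrite ler_wpM2l.
  by rewrite mulrA ler_pdivrMr// mulrDr mulr1 mulrC lerDl ltW.
have h3 := singular_form_step_ge0 v.
rewrite h1; move: b1 b2; rewrite !ler_norml => /andP[b1 _] /andP[b2 _].
move: h2; rewrite /K; lra.
Qed.

(** Along the approximating steps, the second moments converge to that of [Z], and
    the values of the form converge to that at [f]. *)
Lemma wiener_isometry f (Z : Omega -> R) : bounded_measurable f ->
  is_wiener_integral T H BH f Z ->
  [/\ square_integrable P Z, second_moment P Z = cH * Q f f &
  exists phi : nat -> seq (R * R * R), [/\ forall n, valid_step T (phi n),
    second_moment P (fun w => step_integral BH (phi n) w - Z w) @[n --> \oo] --> 0 &
    second_moment P (step_integral BH (phi n)) @[n --> \oo] --> second_moment P Z]].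
Proof.
move=> bf [phi [v fphi [/Lfun2P sZ _ cvZ]]].
have sI n := step_integral_square_integrable (v n).
have cv1 := cvg_second_moment sI sZ cvZ.
have cv2 := second_moment_cvg sI sZ cv1.
have bphi n := bounded_measurable_step (phi n).
have bD n := bounded_measurableB bf (bphi n).
have al0 := hurst_exponent_gt0.
have cv3 : cH * Q (fun x => f x - step_fun (phi n) x) (fun x => f x - step_fun (phi n) x) @[n --> \oo] --> 0.
  move: fphi => /fine_cvgP[_]; apply: cvg_trans; apply: near_eq_cvg; near=> n.
  rewrite /= /fbm_sqnorm (_ : 2 * H - 2 = al - 1); last by ring.
  transitivity (fine (cH%:E * (Q (fun x => f x - step_fun (phi n) x)
    (fun x => f x - step_fun (phi n) x))%:E)%E); last by [].
  by congr (fine (_ * _)%E); rewrite -singular_form_iterated.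
have cv4 : cH * Q (step_fun (phi n)) (step_fun (phi n)) @[n --> \oo] --> cH * Q f f.
  have c0 := hurst_constant_gt0.
  have cHE (k a b : R) : (1 + k) * (cH * a) + (1 + k^-1) * (cH * b) =
      cH * ((1 + k) * a + (1 + k^-1) * b) by ring.
  apply: (squeeze_quadratic _ _ _ cv3).
  - by rewrite mulr_ge0 ?singular_form_ge0// ltW.
  - by move=> n; rewrite mulr_ge0 ?singular_form_ge0// ltW.
  - by move=> n; rewrite mulr_ge0 ?singular_form_ge0// ltW.
  - move=> n k k0; rewrite cHE ler_pM2l//.
    have h := singular_form_ge0 (bounded_measurableD (bphi n) (bounded_measurableZ (- k^-1) (bD n))).
    have e : Q f f = Q (step_fun (phi n)) (step_fun (phi n)) + 2 * 1 * Q (step_fun (phi n)) (fun x => f x - step_fun (phi n) x)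
        + 1 ^+ 2 * Q (fun x => f x - step_fun (phi n) x) (fun x => f x - step_fun (phi n) x).
      rewrite -singular_formB//.
      by congr (Q _ _); apply/funext => x; ring.
    move: h; rewrite singular_formB// e.
    set a := Q (step_fun _) (step_fun _); set b := Q (step_fun _) _; set c := Q _ _ => h.
    have : 0 <= k * (a + 2 * - k^-1 * b + (- k^-1) ^+ 2 * c) by rewrite mulr_ge0// ltW.
    have -> : k * (a + 2 * - k^-1 * b + (- k^-1) ^+ 2 * c) = k * a - 2 * b + k^-1 * c.
      by field; rewrite gt_eqF.
    lra.
  - move=> n k k0; rewrite cHE ler_pM2l//.
    have h := singular_form_ge0 (bounded_measurableD bf (bounded_measurableZ (k^-1) (bD n))).
    have e : Q (step_fun (phi n)) (step_fun (phi n)) = Q f f + 2 * (- 1) * Q f (fun x => f x - step_fun (phi n) x)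
        + (- 1) ^+ 2 * Q (fun x => f x - step_fun (phi n) x) (fun x => f x - step_fun (phi n) x).
      rewrite -singular_formB//.
      by congr (Q _ _); apply/funext => x; ring.
    move: h; rewrite singular_formB// e.
    set a := Q f f; set b := Q f _; set c := Q _ _ => h.
    have : 0 <= k * (a + 2 * k^-1 * b + (k^-1) ^+ 2 * c) by rewrite mulr_ge0// ltW.
    have -> : k * (a + 2 * k^-1 * b + (k^-1) ^+ 2 * c) = k * a + 2 * b + k^-1 * c.
      by field; rewrite gt_eqF.
    lra.
split => //; last by exists phi.
apply: (cvg_unique _ cv2) => //.
apply: cvg_trans cv4; apply: near_eq_cvg; near=> n.
by rewrite step_isometry.
Unshelve. all: by end_near. Qed.

Lemma step_integral_gaussian phi : valid_step T phi -> is_gaussian P (step_integral BH phi).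
Proof.
move=> v; have [g _ _ _] := BH_fbm.
pose pts := step_points phi; pose p0 : R * R := (0, 0).
have := g (size pts) (fun i => (nth p0 pts i).1) (fun i => (nth p0 pts i).2).
rewrite (_ : (fun w => _) = step_integral BH phi); last first.
  apply/funext => w; rewrite step_integral_points// (big_nth p0) big_mkord.
  apply: eq_bigr => i _; rewrite /B'.
  by rewrite (step_points_in v (mem_nth _ _)).
apply=> i; exact: step_points_in v _ (mem_nth _ _).
Qed.

End wiener_isometry.

(** * Moments of the normal law *)

Section affine_change.
Context {R : realType} (a c : R).
Hypothesis a_gt0 : 0 < a.

Let phi : measurableTypeR R -> measurableTypeR R := fun x => a * x + c.

Let mphi : measurable_fun setT phi.
Proof. by apply: measurable_funD => //; exact: measurable_funM. Qed.

Let pushed : {measure set (measurableTypeR R) -> \bar R} :=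
  mscale (NngNum (ltW a_gt0)) (measure_function_pushforward__canonical__measure_function_Measure (@lebesgue_measure R) mphi).

Lemma lebesgue_affine (A : set R) : measurable A ->
  (lebesgue_measure A = a%:E * lebesgue_measure (phi @^-1` A))%E.
Proof.
move=> mA; transitivity (pushed A); last by [].
apply: lebesgue_measure_unique => // _ [[p q] _ <-].
rewrite /pushed/= /mscale/= /pushforward.
have -> : phi @^-1` `]p, q] = `](p - c) / a, (q - c) / a]%classic.
  apply/seteqP; split => x /=; rewrite !in_itv/= ltr_pdivrMr// ler_pdivlMr// /phi;
    by rewrite ltrBlDr lerBrDr [x * a]mulrC.
rewrite !lebesgue_measure_itv/= !lte_fin ltr_pM2r ?invr_gt0// ltrD2r.
case: ifPn => _; last by rewrite mule0.
by rewrite -!EFinB -EFinM; congr EFin; field; rewrite gt_eqF.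
Qed.

Lemma integral_affine (f : R -> \bar R) : measurable_fun setT f -> (forall x, 0 <= f x)%E ->
  (\int[lebesgue_measure]_x f x = a%:E * \int[lebesgue_measure]_x f (a * x + c)%R)%E.
Proof.
move=> mf f0.
transitivity (\int[pushed]_x f x)%E.
  apply: eq_measure_integral => A mA _; exact: lebesgue_affine.
rewrite /pushed ge0_integral_mscale//; congr (_ * _)%E.
by rewrite (ge0_integral_pushforward mphi).
Qed.

End affine_change.

Section standard_normal.
Context {R : realType}.
Local Notation N01 := (@normal_prob R 0 1).

Lemma normal_prob_ge0_integral (m s : R) (g : R -> \bar R) : s != 0 ->
  measurable_fun setT g -> (forall x, 0 <= g x)%E ->
  (\int[normal_prob m s]_x g x = \int[lebesgue_measure]_x (g x * (normal_pdf m s x)%:E))%E.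
Proof.
move=> s0 mg g0.
have dom := normal_prob_dominates m s.
have mpdf : measurable_fun setT (fun x => (normal_pdf m s x)%:E).
  by apply/measurable_EFinP; exact: measurable_normal_pdf.
rewrite -(Radon_Nikodym_SigmaFinite.change_of_variables dom g0 measurableT mg).
have RNi := Radon_Nikodym_SigmaFinite.f_integrable dom.
have mRN := measurable_int _ RNi.
apply: ae_eq_integral => //; [exact: emeasurable_funM|exact: emeasurable_funM|].
have h : ae_eq lebesgue_measure setT
    (Radon_Nikodym_SigmaFinite.f (normal_prob m s) lebesgue_measure) (fun x => (normal_pdf m s x)%:E).
  apply: integral_ae_eq => // A _ mA.
  by rewrite -Radon_Nikodym_SigmaFinite.f_integral.
by apply: filterS h => x /= hx _; rewrite hx.
Qed.

(** With [integral_affine], this reduces every normal law to the standard one. *)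
Lemma normal_pdf_affine (m s x : R) : 0 < s ->
  s * normal_pdf m s (s * x + m) = normal_pdf 0 1 x.
Proof.
move=> s0; rewrite !normal_pdfE ?oner_neq0 ?gt_eqF// /normal_peak /normal_fun.
rewrite expr1n mul1r addrK subr0.
have -> : (s * x) ^+ 2 = s ^+ 2 * x ^+ 2 by rewrite exprMn.
have s2 : s ^+ 2 != 0 by rewrite gt_eqF// exprn_gt0.
have -> : - (s ^+ 2 * x ^+ 2) / (s ^+ 2 *+ 2) = - x ^+ 2 / (1 *+ 2).
  by field; rewrite gt_eqF.
rewrite -mulrnAr sqrtrM ?sqr_ge0// sqrtr_sqr gtr0_norm// invfM mulrA mulrA mulfV ?gt_eqF// mul1r.
by [].
Qed.

Lemma normal_prob_std (m s : R) (g : R -> \bar R) : 0 < s ->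
  measurable_fun setT g -> (forall x, 0 <= g x)%E ->
  (\int[normal_prob m s]_x g x = \int[N01]_x g (s * x + m)%R)%E.
Proof.
move=> s0 mg g0.
rewrite normal_prob_ge0_integral ?gt_eqF// (integral_affine m s0); last 2 first.
- by apply: emeasurable_funM => //; apply/measurable_EFinP; exact: measurable_normal_pdf.
- by move=> x; rewrite mule_ge0// lee_fin normal_pdf_ge0.
have mphi : measurable_fun setT (fun x : R => s * x + m).
  by apply: measurable_funD => //; exact: measurable_funM.
rewrite normal_prob_ge0_integral ?oner_neq0//; last exact: (measurableT_comp mg).
rewrite -ge0_integralZl//; last 3 first.
- apply: emeasurable_funM; first exact: (measurableT_comp mg).
  by apply/measurable_EFinP; exact: (measurableT_comp (measurable_normal_pdf _ _)).
- by move=> x _; rewrite mule_ge0// lee_fin normal_pdf_ge0.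
- by rewrite lee_fin ltW.
by apply: eq_integral => x _; rewrite muleCA -EFinM normal_pdf_affine.
Qed.

Lemma normal_probN (m s : R) : normal_prob m (- s) = normal_prob m s.
Proof.
apply/funext => A; rewrite /normal_prob; apply: eq_integral => x _.
by rewrite /normal_pdf oppr_eq0 /normal_peak /normal_fun sqrrN.
Qed.

Let p (x : R) : R := normal_peak 1 * expR (- x ^+ 2 / 2).

Let pE : @normal_pdf R 0 1 = p.
Proof.
apply/funext => x; rewrite normal_pdfE ?oner_neq0// /p /normal_fun subr0 expr1n.
by congr (_ * expR (_ / _)).
Qed.

Let xp_derive (x : R) : is_derive x (1 : R) (fun x => x * p x) (p x - x ^+ 2 * p x).
Proof.
apply: is_derive_eq.
rewrite /p /GRing.scale/= !(mulr1, mulr0, addr0, add0r).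
by field.
Qed.

Let cp : continuous p.
Proof. by rewrite -pE; apply: continuous_normal_pdf; exact: oner_neq0. Qed.

(** The boundary term of the integration by parts below; it vanishes because
    [expR (x ^+ 2 / 2) >= x ^+ 2 / 2]. *)
Let boundary_term : (2 * (n.+1%:R * p n.+1%:R)) @[n --> \oo] --> (0 : R).
Proof.
have c0 : 0 <= normal_peak 1 :> R by exact: normal_peak_ge0.
have cv : 4 * normal_peak 1 * n.+1%:R^-1 @[n --> \oo] --> (0 : R).
  rewrite -[X in _ --> X](mulr0 (4 * normal_peak 1)); apply: cvgMr; exact: cvg_harmonic.
apply: (@squeeze_cvgr _ _ _ _ (fun=> 0) (fun n => 4 * normal_peak 1 * n.+1%:R^-1)) => //; last exact: cvg_cst.
near=> n; have n0 : 0 < n.+1%:R :> R by [].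
rewrite !mulr_ge0 ?expR_ge0//=.
have e : expR (- n.+1%:R ^+ 2 / 2) <= 2 / n.+1%:R ^+ 2 :> R.
  rewrite mulNr expRN -[leRHS]invrK lef_pV2 ?posrE ?expR_gt0// ?invr_gt0 ?divr_gt0 ?exprn_gt0//.
  rewrite invf_div (le_trans _ (expR_ge1Dx _))//; lra.
rewrite /p; apply: (@le_trans _ _ (2 * (n.+1%:R * (normal_peak 1 * (2 / n.+1%:R ^+ 2))))).
  by rewrite ler_wpM2l// ler_wpM2l// ler_wpM2l.
rewrite le_eqVlt; apply/orP; left; apply/eqP.
by field; rewrite gt_eqF.
Unshelve. all: by end_near. Qed.

(** Integration by parts: the derivative of [x * p x] is [p x - x ^+ 2 * p x]. *)
Lemma normal_second_moment : (\int[N01]_x (x ^+ 2)%:E = 1)%E.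
Proof.
rewrite normal_prob_ge0_integral ?oner_neq0//; last 2 first.
- by apply/measurable_EFinP; exact: measurable_funX.
- by move=> x; rewrite lee_fin sqr_ge0.
rewrite pE.
pose E (n : nat) : set R := `[- n.+1%:R, n.+1%:R]%classic.
have E_nd : {homo E : n m / (n <= m)%N >-> (n <= m)%O}.
  move=> n m nm; apply/subsetPset => x; rewrite /E/= !in_itv/= => /andP[x1 x2].
  have h : n.+1%:R <= m.+1%:R :> R by rewrite ler_nat.
  by rewrite (le_trans _ x1) ?lerN2// (le_trans x2).
have UE : \bigcup_n E n = setT.
  apply/seteqP; split => // x _; exists (Num.trunc `|x|) => //.
  rewrite /E/= in_itv/= -ler_norml ltW//.
  exact: truncnS_gt.
have mp : measurable_fun setT p by exact: continuous_measurable_fun.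
have mxp : measurable_fun setT (fun x : R => x ^+ 2 * p x).
  by apply: measurable_funM => //; exact: measurable_funX.
have p0 x : 0 <= p x by rewrite -pE normal_pdf_ge0.
have cv (f : R -> R) : measurable_fun setT f -> (forall x, 0 <= f x) ->
   (\int[lebesgue_measure]_(x in E n) (f x)%:E)%E @[n --> \oo] --> (\int[lebesgue_measure]_x (f x)%:E)%E.
  move=> mf f0; rewrite -UE; apply: ge0_nondecreasing_set_cvg_integral => //.
  - by move=> n; exact: measurable_itv.
  - by move=> n; apply/measurable_EFinP; exact: measurable_funTS.
  - by move=> n x _; rewrite lee_fin.
have cv1 := cv _ mp p0.
have cv2 := cv _ mxp (fun x => mulr_ge0 (sqr_ge0 x) (p0 x)).
have i1 : (\int[lebesgue_measure]_x (p x)%:E = 1)%E by rewrite -pE integral_normal_pdf.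
have key n : (\int[lebesgue_measure]_(x in E n) (x ^+ 2 * p x)%:E =
   \int[lebesgue_measure]_(x in E n) (p x)%:E - (2 * (n.+1%:R * p n.+1%:R))%:E)%E.
  have ci (f : R -> R) : continuous f -> lebesgue_measure.-integrable (E n) (EFin \o f).
    by move=> cf; apply: continuous_itv_integrable; exact: continuous_subspaceT.
  have cxp : continuous (fun x : R => x ^+ 2 * p x).
    by move=> x; apply: cvgM; [exact: exprn_continuous|exact: cp].
  have h : (\int[lebesgue_measure]_(x in E n) (p x - x ^+ 2 * p x)%:E = (2 * (n.+1%:R * p n.+1%:R))%:E)%E.
    rewrite (@continuous_FTC2 _ _ (fun x => x * p x))//.
    + rewrite -EFinB; congr EFin; rewrite /p sqrrN; ring.
    + by rewrite -subr_gt0 opprK addr_gt0.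
    + by apply: continuous_subspaceT => x; apply: cvgB; [exact: cp|exact: cxp].
    + have cF : continuous (fun x : R => x * p x) by move=> x; apply: cvgM; [exact: cvg_id|exact: cp].
      split => [x _| |]; [by have [] := xp_derive x|apply: cvg_at_right_filter; exact: cF|apply: cvg_at_left_filter; exact: cF].
    + by move=> x _; rewrite derive1E; have [_ ->] := xp_derive x.
  rewrite -h.
  have -> : (\int[lebesgue_measure]_(x in E n) (p x - x ^+ 2 * p x)%:E =
      \int[lebesgue_measure]_(x in E n) (p x)%:E - \int[lebesgue_measure]_(x in E n) (x ^+ 2 * p x)%:E)%E.
    under eq_integral do rewrite EFinB.
    by rewrite (integralB _ (ci _ cp) (ci _ cxp))//; exact: measurable_itv.
  have f1 : (\int[lebesgue_measure]_(x in E n) (p x)%:E)%E \is a fin_num.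
    by apply: integrable_fin_num; [exact: measurable_itv|exact: ci cp].
  have f2 : (\int[lebesgue_measure]_(x in E n) (x ^+ 2 * p x)%:E)%E \is a fin_num.
    by apply: integrable_fin_num; [exact: measurable_itv|exact: ci cxp].
  by rewrite -(fineK f1) -(fineK f2) -!EFinB; congr EFin; ring.
rewrite (funext key) in cv2.
have cv3 : (\int[lebesgue_measure]_(x in E n) (p x)%:E - (2 * (n.+1%:R * p n.+1%:R))%:E)%E @[n --> \oo]
    --> (\int[lebesgue_measure]_x (p x)%:E - 0%:E)%E.
  apply: cvgeB => //; first by rewrite i1.
  by apply: cvg_EFin boundary_term; near=> n.
rewrite i1 sube0 in cv3.
by rewrite -(cvg_unique _ cv2 cv3).
Unshelve. all: by end_near. Qed.

Lemma normal_square_integrable : square_integrable N01 (fun x : R => x).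
Proof.
split; first exact: measurable_id.
apply/integrableP; split; first by apply/measurable_EFinP; exact: measurable_funX.
apply: (@le_lt_trans _ _ (\int[N01]_x (x ^+ 2)%:E)%E); last by rewrite normal_second_moment ltry.
rewrite le_eqVlt; apply/orP; left; apply/eqP.
by apply: eq_integral => x _ /=; rewrite ger0_norm ?sqr_ge0.
Qed.

Lemma integral_lebesgueN (h : R -> \bar R) : measurable_fun setT h -> (forall x, 0 <= h x)%E ->
  (\int[lebesgue_measure]_x h x = \int[lebesgue_measure]_x h (- x)%R)%E.
Proof.
move=> mh h0.
transitivity (\int[pushforward lebesgue_measure (-%R : R -> measurableTypeR R)]_x h x)%E.
  apply: eq_measure_integral => A mA _; symmetry; exact: (lebesgue_measureN mA).
by rewrite ge0_integral_pushforward.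
Qed.

Lemma normal_symmetric (g : R -> \bar R) : measurable_fun setT g -> (forall x, 0 <= g x)%E ->
  (\int[N01]_x g x = \int[N01]_x g (- x)%R)%E.
Proof.
move=> mg g0.
have mgN : measurable_fun setT (fun x : R => g (- x)) by exact: (measurableT_comp mg).
rewrite normal_prob_ge0_integral ?oner_neq0// [RHS]normal_prob_ge0_integral ?oner_neq0// pE.
rewrite integral_lebesgueN.
- by apply: eq_integral => x _ /=; rewrite /p sqrrN.
- apply: emeasurable_funM => //; apply/measurable_EFinP.
  exact: continuous_measurable_fun.
- by move=> x; rewrite mule_ge0// lee_fin -pE normal_pdf_ge0.
Qed.

Lemma normal_mean : \int[N01]_x x = 0 :> R.
Proof.
have i : N01.-integrable setT (EFin \o (fun x : R => x)) by exact: square_integrable1 normal_square_integrable.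
have mE : measurable_fun setT (EFin : R -> \bar R) by exact/measurable_EFinP.
have e : (\int[N01]_x (EFin^\+ x) = \int[N01]_x (EFin^\- x))%E.
  rewrite (normal_symmetric (measurable_funepos mE) (funepos_ge0 _)).
  by apply: eq_integral => x _; rewrite !unlock EFinN.
rewrite /Rintegral integralE e subee//.
exact: (integrable_neg_fin_num measurableT i).
Qed.

End standard_normal.

Section gaussian_laws.
Context d (Omega : measurableType d) (R : realType) (P : probability Omega R).
Local Notation N01 := (@normal_prob R 0 1).

(** The degenerate law is the case [s = 0], so one formula covers every Gaussian
    variable. *)
Lemma gaussian_integral (f : Omega -> R) : is_gaussian P f ->
  exists m s : R, 0 <= s /\ forall g : R -> \bar R, measurable_fun setT g ->
    (\int[P]_w g (f w) = \int[N01]_x g (s * x + m)%R)%E.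
Proof.
move=> [mf [m [s law]]].
have [a [a0 sa as0 an0]] : exists a : R, [/\ 0 <= a, normal_prob m s = normal_prob m a,
    s = 0 -> a = 0 & s != 0 -> 0 < a].
  have [s0|s0] := leP 0 s; [exists s|exists (- s)].
    by split => // sn0; rewrite lt_neqAle eq_sym sn0.
  split; [by rewrite oppr_ge0 ltW|by rewrite normal_probN|by move=> ->; rewrite oppr0|by rewrite oppr_gt0].
exists m, a; split => //.
suff h (g : R -> \bar R) : measurable_fun setT g -> (forall x, 0 <= g x)%E ->
    (\int[P]_w g (f w) = \int[N01]_x g (a * x + m)%R)%E.
  move=> g mg; rewrite integralE [RHS]integralE.
  have e1 := h _ (measurable_funepos mg) (funepos_ge0 g).
  have e2 := h _ (measurable_funeneg mg) (funeneg_ge0 g).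
  congr (_ - _)%E.
    apply: (eq_trans _ (eq_trans e1 _)); by apply: eq_integral => x _; rewrite !unlock.
  apply: (eq_trans _ (eq_trans e2 _)); by apply: eq_integral => x _; rewrite !unlock.
move=> mg g0.
have mf' : measurable_fun setT (f : Omega -> measurableTypeR R) by exact: mf.
pose mu : {measure set (measurableTypeR R) -> \bar R} :=
  measure_function_pushforward__canonical__measure_function_Measure P mf'.
pose nu : {measure set (measurableTypeR R) -> \bar R} := normal_prob m a.
transitivity (\int[mu]_y g y)%E.
  by rewrite /mu/= (ge0_integral_pushforward mf').
have [s0|s0] := eqVneq s 0.
  pose delta : {measure set (measurableTypeR R) -> \bar R} := @dirac _ (measurableTypeR R) m R.
  transitivity (\int[delta]_y g y)%E.
    by apply: eq_measure_integral => A mA _; rewrite /mu/= /pushforward law// /gaussian_law s0 eqxx.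
  rewrite /delta integral_dirac// diracT mul1e as0//.
  under eq_integral do rewrite mul0r add0r.
  rewrite -[LHS]mule1 integral_cst//; congr (_ * _)%E.
  by rewrite -(@probability_setT _ _ _ N01).
transitivity (\int[nu]_y g y)%E.
  apply: eq_measure_integral => A mA _.
  by rewrite /mu/= /pushforward law// /gaussian_law (negbTE s0) sa.
have ps := an0 s0.
exact: (@normal_prob_std _ m a g ps mg g0).
Qed.

End gaussian_laws.

(** * Limits of Gaussian variables *)

Section weak_limits.
Context {R : realType}.

(** Uniform continuity on a compact interval, the two other terms dominating the
    oscillation [2 M] when [y] is large or [x] is far from [y]. Both are quadratic,
    hence controlled by second moments after integration. *)
Lemma bounded_continuous_modulus (phi : R -> R) (M r eta : R) : continuous phi ->
  (forall x, `|phi x| <= M) -> 0 < r -> 0 < eta ->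
  exists2 k : R, 0 < k & forall x y : R,
    `|phi x - phi y| <= eta + 2 * M / r ^+ 2 * y ^+ 2 + k * (x - y) ^+ 2.
Proof.
move=> cphi phiM r0 eta0.
have M0 : 0 <= M by rewrite (le_trans _ (phiM 0)).
have /compact_near_coveringP nc : compact `[- r, r] by exact: segment_compact.
have h : \forall delta \near 0^'+, `[- r, r]%classic `<=`
    [set y | forall x : R, `|x - y| < delta -> `|phi x - phi y| <= eta].
  apply: (nc R 0^'+ (fun delta y => forall x : R, `|x - y| < delta -> `|phi x - phi y| <= eta)).
  move=> y _; have [e /= e0 he] : \forall x \near y, `|phi y - phi x| < eta / 2.
    by have /cvgrPdist_lt := cphi y; apply; rewrite divr_gt0.
  exists (ball y (e / 2), `]0, e / 2[%classic).
    split; first by apply: nbhsx_ballx; rewrite divr_gt0.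
    by near=> z; rewrite /= in_itv/=; apply/andP; split; near: z; [exact: nbhs_right_gt|apply: nbhs_right_lt; rewrite divr_gt0].
  move=> [y' delta] /= [yy']; rewrite in_itv/= => /andP[delta0 deltae] x xy'.
  have h1 : `|phi y - phi x| < eta / 2.
    apply: he => /=; rewrite -(subrK y' y) -addrA.
    rewrite (le_lt_trans (ler_normD _ _))// (splitr e) ltrD//.
    by rewrite distrC (lt_trans xy').
  have h2 : `|phi y - phi y'| < eta / 2.
    by apply: he => /=; rewrite (lt_trans yy')// ltr_pdivrMr// ltr_pMr// ltr1n.
  rewrite -(subrK (phi y) (phi x)) -addrA (le_trans (ler_normD _ _))// (splitr eta) lerD ?ltW//.
  by rewrite distrC.
have [delta delta0 hd] : exists2 delta : R, 0 < delta & `[- r, r]%classic `<=`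
    [set y | forall x : R, `|x - y| < delta -> `|phi x - phi y| <= eta].
  near (0 : R)^'+ => delta; exists delta; first by near: delta; exact: nbhs_right_gt.
  by near: delta.
exists (2 * M / delta ^+ 2 + 1).
  by rewrite ltr_wpDl// mulr_ge0 ?mulr_ge0// invr_ge0 exprn_ge0// ltW.
move=> x y.
have b2 : `|phi x - phi y| <= 2 * M.
  by rewrite (le_trans (ler_normB _ _))// mulr2n mulrDl mul1r lerD.
have t1 : 0 <= 2 * M / r ^+ 2 * y ^+ 2.
  by rewrite mulr_ge0 ?sqr_ge0// mulr_ge0 ?mulr_ge0// invr_ge0 sqr_ge0.
have t2 : 0 <= 2 * M / delta ^+ 2 * (x - y) ^+ 2.
  by rewrite mulr_ge0 ?sqr_ge0// mulr_ge0 ?mulr_ge0// invr_ge0 sqr_ge0.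
have t3 : 0 <= (x - y) ^+ 2 by exact: sqr_ge0.
rewrite mulrDl mul1r.
have [yr|yr] := leP `|y| r.
  have [xy|xy] := ltP `|x - y| delta.
    have := hd y; rewrite /= in_itv/= -ler_norml => /(_ yr x xy) ?; lra.
  have : 2 * M <= 2 * M / delta ^+ 2 * (x - y) ^+ 2.
    rewrite -mulrA ler_peMr ?mulr_ge0// mulrC ler_pdivlMr ?exprn_gt0// mul1r.
    by rewrite -[leRHS]real_normK ?num_real// ler_sqr ?nnegrE// ltW.
  by move=> ?; lra.
have : 2 * M <= 2 * M / r ^+ 2 * y ^+ 2.
  rewrite -mulrA ler_peMr ?mulr_ge0// mulrC ler_pdivlMr ?exprn_gt0// mul1r.
  by rewrite -[leRHS]real_normK ?num_real// ler_sqr ?nnegrE// ltW.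
by move=> ?; lra.
Unshelve. all: by end_near. Qed.

Lemma bounded_integrable d (E : measurableType d) (P : probability E R) (f : E -> R) (M : R) :
  measurable_fun setT f -> (forall x, `|f x| <= M) -> P.-integrable setT (EFin \o f).
Proof.
move=> mf fM; apply: (@le_integrable _ _ _ P setT measurableT _ (EFin \o (fun=> M))) => //.
- exact/measurable_EFinP.
- by move=> x _ /=; rewrite lee_fin (le_trans (fM x))// ler_norm.
- exact: finite_measure_integrable_cst.
Qed.

Lemma cvg_expectation_L2 d (E : measurableType d) (P : probability E R) (phi : R -> R) (M : R)
    (X : nat -> E -> R) (Y : E -> R) : continuous phi -> (forall x, `|phi x| <= M) ->
  (forall n, square_integrable P (X n)) -> square_integrable P Y ->
  second_moment P (fun w => X n w - Y w) @[n --> \oo] --> 0 ->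
  \int[P]_w phi (X n w) @[n --> \oo] --> \int[P]_w phi (Y w).
Proof.
move=> cphi phiM hX hY cv.
have M0 : 0 <= M by rewrite (le_trans _ (phiM 0)).
have mphi : measurable_fun setT phi by exact: continuous_measurable_fun.
have iX n : P.-integrable setT (EFin \o (fun w => phi (X n w))).
  by apply: (@bounded_integrable _ _ _ _ M) => //; apply: measurableT_comp => //; exact: (hX n).1.
have iY : P.-integrable setT (EFin \o (fun w => phi (Y w))).
  by apply: (@bounded_integrable _ _ _ _ M) => //; apply: measurableT_comp => //; exact: hY.1.
pose v := second_moment P Y; have v0 : 0 <= v by exact: second_moment_ge0.
apply/cvgrPdist_le => e e0.
have v1 : 0 < v + 1 by rewrite ltr_wpDl.
pose r := Num.sqrt (6 * (M + 1) * (v + 1) / e).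
have q0 : 0 < 6 * (M + 1) * (v + 1) / e.
  by rewrite divr_gt0// mulr_gt0// mulr_gt0// ltr_wpDl.
have r0 : 0 < r by rewrite sqrtr_gt0.
have e3 : 0 < e / 3 by rewrite divr_gt0.
have [k k0 hk] := bounded_continuous_modulus cphi phiM r0 e3.
have ek : 0 < e / (3 * k) by rewrite divr_gt0// mulr_gt0.
have rv : 2 * M / r ^+ 2 * v <= e / 3.
  rewrite sqr_sqrtr ?(ltW q0)// invf_div.
  have -> : 2 * M * (e / (6 * (M + 1) * (v + 1))) * v = e / 3 * ((M / (M + 1)) * (v / (v + 1))).
    field; rewrite !gt_eqF//; lra.
  have M1 : 0 < M + 1 by rewrite ltr_wpDl.
  apply: ler_piMr; first exact: ltW.
  rewrite mulr_ile1 ?divr_ge0 ?(ltW v1) ?(ltW M1)// ler_pdivrMr// mul1r lerDl//.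
near=> n.
have hn : second_moment P (fun w => X n w - Y w) < e / (3 * k).
  have : `|0 - second_moment P (fun w => X n w - Y w)| < e / (3 * k).
    by near: n; have /cvgrPdist_lt := cv; exact.
  by rewrite sub0r normrN ger0_norm// second_moment_ge0.
have [_ i2] := square_integrableB (hX n) hY; have [_ iY2] := hY.
rewrite distrC -RintegralB//.
apply: (le_trans (le_normr_Rintegral _ _)) => //.
  exact: integrable_EFinB.
have i3 : P.-integrable setT (EFin \o (fun w => e / 3 + 2 * M / r ^+ 2 * Y w ^+ 2)).
  apply: integrable_EFinD => //; last exact: integrable_EFinZ.
  exact: finite_measure_integrable_cst.
apply: (@le_trans _ _ (\int[P]_w (e / 3 + 2 * M / r ^+ 2 * Y w ^+ 2 + k * (X n w - Y w) ^+ 2))).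
  apply: le_Rintegral => //.
  - by apply: integrable_EFin_norm => //; exact: integrable_EFinB.
  - by apply: integrable_EFinD => //; exact: integrable_EFinZ.
rewrite RintegralD//; last exact: integrable_EFinZ.
rewrite RintegralD//; last 2 first.
- exact: finite_measure_integrable_cst.
- exact: integrable_EFinZ.
have -> : \int[P]_w (e / 3) = e / 3.
  rewrite (Rintegral_cst P (@measurableT _ E)).
  transitivity (e / 3 * fine (1%E : \bar R)); last by rewrite mulr1.
  by congr (_ * fine _); exact: probability_setT.
rewrite (RintegralZl _ _ iY2)// (RintegralZl _ _ i2)//.
rewrite -/(second_moment P Y) -/(second_moment P (fun w => X n w - Y w)).
have kn : k * second_moment P (fun w => X n w - Y w) <= e / 3.
  rewrite mulrC -ler_pdivlMr// (le_trans (ltW hn))// invfM mulrA.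
  by [].
by move: rv; rewrite -/v; lra.
Unshelve. all: by end_near. Qed.

End weak_limits.

Section gaussian_limits.
Context d (Omega : measurableType d) (R : realType) (P : probability Omega R).
Local Notation N01 := (@normal_prob R 0 1).

(** The two parameters of the law are recovered by integrating [x] and [x ^+ 2]. *)
Lemma centered_gaussian_integral (f : Omega -> R) : is_gaussian P f -> square_integrable P f ->
  \int[P]_w f w = 0 -> forall g : R -> \bar R, measurable_fun setT g ->
  (\int[P]_w g (f w) = \int[N01]_x g (Num.sqrt (second_moment P f) * x)%R)%E.
Proof.
move=> /gaussian_integral[m [s [s0 law]]] hf mean0.
have mE : measurable_fun setT (EFin : R -> \bar R) by exact/measurable_EFinP.
have iid := square_integrable1 (@normal_square_integrable R).
have m0 : m = 0.
  rewrite -mean0 /Rintegral (law _ mE).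
  transitivity (\int[N01]_x (s * x + m)); last by [].
  rewrite RintegralD//; last 2 first.
  - exact: integrable_EFinZ.
  - exact: finite_measure_integrable_cst.
  rewrite RintegralZl// normal_mean mulr0 add0r (Rintegral_cst N01 measurableT).
  transitivity (m * fine (1%E : \bar R)); first by rewrite mulr1.
  by congr (_ * fine _); exact/esym/probability_setT.
have m2 : measurable_fun setT (fun x : R => (x ^+ 2)%:E).
  by apply/measurable_EFinP; exact: measurable_funX.
have s2 : second_moment P f = s ^+ 2.
  rewrite /second_moment /Rintegral (law _ m2).
  transitivity (fine (\int[N01]_x ((s ^+ 2)%:E * (x ^+ 2)%:E)%E)).
    by congr fine; apply: eq_integral => x _; rewrite m0 addr0 exprMn EFinM.
  rewrite ge0_integralZl//.
  - by rewrite normal_second_moment mule1.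
  - by move=> x _; rewrite lee_fin sqr_ge0.
  - by rewrite lee_fin sqr_ge0.
move=> g mg; rewrite law// s2 sqrtr_sqr ger0_norm//.
by apply: eq_integral => x _; rewrite m0 addr0.
Qed.

(** [phi (X n)] has the expectation of [phi (s n * x)] under the standard normal
    law, and [cvg_expectation_L2] applies on both probability spaces. *)
Lemma gaussian_L2_limit (X : nat -> Omega -> R) (Y : Omega -> R) (phi : R -> R) (M : R) :
  (forall n, is_gaussian P (X n)) -> (forall n, square_integrable P (X n)) ->
  (forall n, \int[P]_w X n w = 0) -> square_integrable P Y ->
  second_moment P (fun w => X n w - Y w) @[n --> \oo] --> 0 ->
  continuous phi -> (forall x, `|phi x| <= M) ->
  \int[P]_w phi (Y w) = \int[N01]_x phi (Num.sqrt (second_moment P Y) * x).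
Proof.
move=> gX hX meanX hY cv cphi phiM.
have mphi : measurable_fun setT (fun x => (phi x)%:E).
  by apply/measurable_EFinP; exact: continuous_measurable_fun.
have cv1 := cvg_expectation_L2 cphi phiM hX hY cv.
pose s n := Num.sqrt (second_moment P (X n)); pose s' := Num.sqrt (second_moment P Y).
pose s'2 := second_moment P Y.
have cvs : s n @[n --> \oo] --> s'.
  exact: (cvg_comp _ _ (second_moment_cvg hX hY cv) (@sqrt_continuous R s'2)).
have hid := @normal_square_integrable R.
have cv2 : \int[N01]_x phi (s n * x) @[n --> \oo] --> \int[N01]_x phi (s' * x).
  apply: (@cvg_expectation_L2 _ _ _ N01 phi M (fun n x => s n * x) (fun x => s' * x)) => //.
  - by move=> n; exact: square_integrableZ.
  - exact: square_integrableZ.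
  have -> : (fun n => second_moment N01 (fun w => s n * w - s' * w)) =
      (fun n => (s n - s') ^+ 2 * second_moment N01 id).
    apply/funext => n; rewrite /second_moment -RintegralZl//; last exact: hid.2.
    by apply: eq_Rintegral => x _; rewrite -mulrBl exprMn.
  rewrite -[X in _ --> X](mul0r (second_moment N01 id)); apply: cvgMl.
  rewrite -[X in _ --> X](mul0r 0) -(subrr s').
  by apply: (@cvgM _ _ _ _ (fun n => s n - s') (fun n => s n - s')); apply: cvgB => //; exact: cvg_cst.
have key n : \int[P]_w phi (X n w) = \int[N01]_x phi (s n * x).
  by rewrite /Rintegral (centered_gaussian_integral (gX n) (hX n) (meanX n) mphi).
rewrite (funext key) in cv1.
exact: (cvg_unique _ cv1 cv2).
Qed.

Lemma normal_prob_bounded_std (phi : R -> R) (M s : R) : continuous phi ->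
  (forall x, `|phi x| <= M) -> 0 < s ->
  (\int[normal_prob 0 s]_x (phi x)%:E = \int[N01]_x (phi (s * x)%R)%:E)%E.
Proof.
move=> cphi phiM s0.
have mphi : measurable_fun setT (fun x => (phi x)%:E).
  by apply/measurable_EFinP; exact: continuous_measurable_fun.
rewrite integralE [RHS]integralE.
rewrite (normal_prob_std 0 s0 (measurable_funepos mphi) (funepos_ge0 _)).
rewrite (normal_prob_std 0 s0 (measurable_funeneg mphi) (funeneg_ge0 _)).
by congr (_ - _)%E; apply: eq_integral => x _; rewrite !unlock addr0.
Qed.

Lemma gaussian_L2_limit_law (X : nat -> Omega -> R) (Y : Omega -> R) (phi : R -> R) (M c s : R) :
  (forall n, is_gaussian P (X n)) -> (forall n, square_integrable P (X n)) ->
  (forall n, \int[P]_w X n w = 0) -> square_integrable P Y ->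
  second_moment P (fun w => X n w - Y w) @[n --> \oo] --> 0 ->
  continuous phi -> (forall x, `|phi x| <= M) ->
  c * Num.sqrt (second_moment P Y) = s -> 0 < s ->
  (\int[P]_w (phi (c * Y w))%:E = \int[normal_prob 0 s]_x (phi x)%:E)%E.
Proof.
move=> gX hX meanX hY cv cphi phiM cs s0.
have cphic : continuous (fun x : R => phi (c * x)).
  move=> x; apply: (@continuous_comp R R R (fun x => c * x) phi); last exact: cphi.
  by apply: cvgMr; exact: cvg_id.
have := gaussian_L2_limit gX hX meanX hY cv cphic (fun x => phiM (c * x)).
have fin1 d' (E : measurableType d') (Q : probability E R) (f : E -> R) :
   measurable_fun setT f -> (\int[Q]_w (phi (f w))%:E = (\int[Q]_w phi (f w))%:E)%E.
  move=> mf; rewrite /Rintegral fineK//; apply: integrable_fin_num => //.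
  apply: (@bounded_integrable R _ _ _ _ M) => //; apply: measurableT_comp => //.
  exact: continuous_measurable_fun.
have mY := hY.1.
rewrite (normal_prob_bounded_std cphi phiM s0) fin1 ?(fin1 _ _ N01)//; last exact: measurable_funM.
by move=> ->; congr EFin; apply: eq_Rintegral => x _; rewrite mulrA cs.
Qed.

End gaussian_limits.

(** * Scaling of the covariance form *)

Section self_similarity.
Context {R : realType}.
Implicit Types (al h r T : R) (f : R -> R).

Definition interaction al f (x y : R) : R := `|x - y| `^ (al - 1) * f x * f y.

(** The singular form on the whole line, where translations and dilations act. *)
Definition energy al f : \bar R :=
  (\int[lebesgue_measure]_x \int[lebesgue_measure]_y (interaction al f x y)%:E)%E.

Lemma interaction_ge0 al f x y : (forall x, 0 <= f x) -> 0 <= interaction al f x y.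
Proof. by move=> f0; rewrite /interaction !mulr_ge0 ?powR_ge0. Qed.

Lemma measurable_interaction al f : measurable_fun setT f ->
  measurable_fun setT (fun p : measurableTypeR R * measurableTypeR R => interaction al f p.1 p.2).
Proof.
move=> mf; apply: measurable_funM; first apply: measurable_funM.
- apply: (measurableT_comp (measurable_powR (al - 1))).
  by apply: measurableT_comp => //; apply: measurable_funB.
- exact: (measurableT_comp mf).
- exact: (measurableT_comp mf).
Qed.

Lemma measurable_distance_powR al x : measurable_fun setT (fun y : R => `|x - y| `^ al).
Proof.
apply: (measurableT_comp (measurable_powR al)).
by apply: measurableT_comp => //; apply: measurable_funB.
Qed.

Lemma measurable_interaction_section al f x : measurable_fun setT f ->
  measurable_fun setT (fun y : R => (interaction al f x y)%:E).
Proof.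
move=> mf; apply/measurable_EFinP.
exact: (measurableT_comp (measurable_interaction al mf) (@pair1_measurable _ _ (measurableTypeR R) (measurableTypeR R) x)).
Qed.

Lemma measurable_interaction_integral al f : measurable_fun setT f -> (forall x, 0 <= f x) ->
  measurable_fun setT (fun x : R => \int[lebesgue_measure]_y (interaction al f x y)%:E)%E.
Proof.
move=> mf f0.
apply: (measurable_fun_fubini_tonelli_F (m2 := @lebesgue_measure R)
  (fun p => (interaction al f p.1 p.2)%:E)).
  by apply/measurable_EFinP; exact: measurable_interaction.
by move=> p; rewrite lee_fin interaction_ge0.
Qed.

Lemma energy_support al (D : set R) f : (forall x, x \notin D -> f x = 0) ->
  (\int[lebesgue_measure]_(x in D) \int[lebesgue_measure]_(y in D) (interaction al f x y)%:E
   = energy al f)%E.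
Proof.
move=> fD; rewrite integral_mkcond; apply: eq_integral => x _.
rewrite patchE; case: ifPn => xD; last first.
  by rewrite integral0_eq// => y _; rewrite /interaction fD// mulr0 mul0r.
rewrite integral_mkcond; apply: eq_integral => y _.
rewrite patchE; case: ifPn => yD//.
by rewrite /interaction (fD y)// mulr0.
Qed.

(** The substitutions [x -> h x + r], [y -> h y + r] absorb the normalisation of
    the two kernels, and the power kernel is homogeneous of degree [al - 1]. *)
Lemma energy_scaling al (K : R -> R) h r : 0 < h -> measurable_fun setT K -> (forall x, 0 <= K x) ->
  energy al (fun s => scaled_kernel K h (s - r)) = ((h `^ (al - 1))%:E * energy al K)%E.
Proof.
move=> h0 mK K0.
set f := fun s => scaled_kernel K h (s - r).
have mf : measurable_fun setT f.
  apply: measurable_funM => //; apply: (measurableT_comp mK).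
  by apply: measurable_funM => //; exact: measurable_funB.
have f0 x : 0 <= f x by rewrite mulr_ge0// invr_ge0 ltW.
have fE x : f (h * x + r) = h^-1 * K x.
  by rewrite /f /scaled_kernel addrK mulrC mulrAC mulfV ?gt_eqF// mul1r mulrC.
have IE x y : interaction al f (h * x + r) (h * y + r) =
    h `^ (al - 1) * h ^- 2 * interaction al K x y.
  rewrite /interaction !fE.
  have -> : h * x + r - (h * y + r) = h * (x - y) by ring.
  have -> : `|h * (x - y)| = h * `|x - y| by rewrite normrM (gtr0_norm h0).
  rewrite powRM ?(ltW h0)//; field; by rewrite gt_eqF.
rewrite /energy (integral_affine r h0 (measurable_interaction_integral al mf f0)); last first.
  by move=> x; apply: integral_ge0 => y _; rewrite lee_fin interaction_ge0.
have inner x : (\int[lebesgue_measure]_y (interaction al f (h * x + r)%R y)%:E =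
    (h `^ (al - 1) / h)%:E * \int[lebesgue_measure]_y (interaction al K x y)%:E)%E.
  rewrite (integral_affine r h0 (measurable_interaction_section al _ mf)); last first.
    by move=> y; rewrite lee_fin interaction_ge0.
  under eq_integral do rewrite IE EFinM.
  rewrite ge0_integralZl//; last 3 first.
  - exact: measurable_interaction_section.
  - by move=> y _; rewrite lee_fin interaction_ge0.
  - by rewrite lee_fin mulr_ge0 ?powR_ge0// invr_ge0 exprn_ge0// ltW.
  rewrite muleA -EFinM; congr (_%:E * _)%E.
  by field; rewrite gt_eqF.
under eq_integral do rewrite inner.
rewrite ge0_integralZl//; last 3 first.
- exact: measurable_interaction_integral.
- by move=> x _; apply: integral_ge0 => y _; rewrite lee_fin interaction_ge0.
- by rewrite lee_fin mulr_ge0 ?powR_ge0// invr_ge0 ltW.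
rewrite muleA -EFinM; congr (_%:E * _)%E.
by field; rewrite gt_eqF.
Qed.

Lemma energy_singular_form T al f : 0 < T -> 0 < al -> bounded_measurable f ->
  (forall x, x \notin (`[0, T]%classic : set R) -> f x = 0) ->
  energy al f = (singular_form T al f f)%:E.
Proof.
move=> T0 al0 bf fT; rewrite -(singular_form_iterated T0 al0 bf bf).
exact/esym/energy_support.
Qed.

End self_similarity.

Lemma kernel_support {R : realType} (K : R -> R) (A B z : R) :
  [set v | K v != 0] = `]A, B[%classic -> K z != 0 -> A < z < B.
Proof. by move=> KAB Kz; have : [set v | K v != 0] z by []; rewrite KAB/= in_itv. Qed.

Lemma kernel_window {R : realType} (K : R -> R) (A B T h t z : R) : 0 <= A ->
  [set v | K v != 0] = `]A, B[%classic -> 0 < h -> t + h * B <= T -> K z != 0 ->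
  0 <= h * z /\ t + h * z <= T.
Proof.
move=> A0 KAB h0 hT /(kernel_support KAB)/andP[Az zB]; split.
  by rewrite mulr_ge0 ?(ltW h0)// (le_trans A0)// ltW.
by rewrite (le_trans _ hT)// lerD2l ler_pM2l// ltW.
Qed.

Section limit_variance.
Context {R : realType} (H : R) (K : R -> R) (A B : R).
Hypothesis H_gt : 2^-1 < H.
Hypothesis K_kernel : is_kernel K.
Hypothesis K_bounded : bounded_fun K.
Hypothesis AB : A < B.
Hypothesis A_ge0 : 0 <= A.
Hypothesis K_supp : [set v | K v != 0] = `]A, B[%classic.

Local Notation al := (2 * H - 1).

Lemma kernel_bound : exists2 M : R, 0 < M & forall x, `|K x| <= M.
Proof.
have [M [Mr hM]] := K_bounded.
exists (`|M| + 1); first by rewrite ltr_wpDl.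
by move=> x; apply: hM => //; rewrite (le_lt_trans (ler_norm M))// ltrDl.
Qed.

Lemma kernel_bounded_measurable : bounded_measurable K.
Proof.
by have [mK _ _] := K_kernel; have [M _ hM] := kernel_bound; split => //; exists M.
Qed.

Lemma kernel_out x : (x <= A) || (B <= x) -> K x = 0.
Proof.
move=> h; apply/eqP/negPn/negP => Kx.
have /andP[Ax xB] := kernel_support K_supp Kx.
by move: h; rewrite leNgt Ax leNgt xB.
Qed.

Lemma kernel_AB x : x \notin (`[A, B]%classic : set R) -> K x = 0.
Proof.
move=> h; apply: kernel_out; apply: contraNT h; rewrite negb_or -!ltNge => /andP[Ax xB].
by rewrite mem_setE in_itv/= !ltW.
Qed.

Let B_gt0 : 0 < B. Proof. exact: le_lt_trans AB. Qed.
Let al_gt0 : 0 < al. Proof. exact: hurst_exponent_gt0. Qed.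

Lemma energy_kernel : energy al K = (singular_form B al K K)%:E.
Proof.
apply: energy_singular_form => //; first exact: kernel_bounded_measurable.
move=> x xB; apply: kernel_out; apply: contraNT xB; rewrite negb_or -!ltNge => /andP[Ax xB].
by rewrite mem_setE in_itv/= !ltW// (le_lt_trans A_ge0).
Qed.

(** The inner integral is finite for every value of the outer variable, so taking
    real-valued integrals loses nothing. *)
Lemma limit_varianceE : (limit_variance H K A B)%:E = ((H * (2 * H - 1))%:E * energy al K)%E.
Proof.
have [mK K0 _] := K_kernel; have [M M0 hM] := kernel_bound.
rewrite /limit_variance EFinM; congr (_ * _)%E.
transitivity (fine (energy al K))%:E; last by rewrite energy_kernel.
rewrite /Rintegral; congr EFin; congr fine.
rewrite -(energy_support _ kernel_AB); apply: eq_integral => x xAB.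
rewrite /interaction (_ : 2 * H - 1 - 1 = 2 * H - 2); last by ring.
rewrite fineK// ge0_fin_numE; last first.
  by apply: integral_ge0 => y _; rewrite lee_fin !mulr_ge0 ?powR_ge0.
move: xAB; rewrite inE/= in_itv/= => /andP[Ax xB].
apply: (@le_lt_trans _ _ (\int[lebesgue_measure]_(y in `[0%R, B]) ((M * M)%:E * (`|x - y| `^ (al - 1))%:E))%E).
  apply: (@le_trans _ _ (\int[lebesgue_measure]_(y in `[A, B]) ((M * M)%:E * (`|x - y| `^ (al - 1))%:E))%E).
    apply: ge0_le_integral => //.
    - by move=> y _; rewrite lee_fin !mulr_ge0 ?powR_ge0.
    - apply/measurable_EFinP; apply: measurable_funM; last exact: measurable_funTS.
      by apply: measurable_funM => //; apply: measurable_funTS; exact: measurable_distance_powR.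
    - by apply: measurable_funeM; exact: measurable_norm_powR.
    - move=> y _; rewrite -EFinM lee_fin -mulrA mulrC.
      rewrite (_ : 2 * H - 2 = al - 1); last by ring.
      rewrite ler_wpM2r ?powR_ge0// ler_pM// (le_trans (ler_norm _))//.
  apply: ge0_subset_integral => //.
  - by apply: measurable_funeM; exact: measurable_norm_powR.
  - by move=> y _; rewrite -EFinM lee_fin mulr_ge0 ?powR_ge0// mulr_ge0 ?ltW.
  - by move=> y /=; rewrite !in_itv/= => /andP[Ay ->]; rewrite (le_trans A_ge0).
rewrite ge0_integralZl//; last 2 first.
- exact: measurable_norm_powR.
- by rewrite lee_fin mulr_ge0// ltW.
by rewrite integral_kernel ?(le_trans A_ge0)// -EFinM ltry.
Qed.

(** Since [2 H - 2 < 0], the power kernel is at least [(B - A) `^ (2 H - 2)] off the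
    diagonal of the support, and [K] has total mass [1]. *)
Lemma limit_variance_gt0 : H < 1 -> 0 < limit_variance H K A B.
Proof.
move=> H1; have [mK K0 K1] := K_kernel.
have mEK : measurable_fun setT (fun x => (K x)%:E) by exact/measurable_EFinP.
rewrite -lte_fin limit_varianceE; apply: mule_gt0.
  by rewrite lte_fin; exact: (hurst_constant_gt0 H_gt).
pose c := (B - A) `^ (al - 1).
have c0 : 0 < c by rewrite powR_gt0// subr_gt0.
apply: (@lt_le_trans _ _ c%:E); first by rewrite lte_fin.
apply: (@le_trans _ _ (\int[lebesgue_measure]_x (c%:E * (K x)%:E))%E).
  by rewrite ge0_integralZl ?K1 ?mule1// ?lee_fin ?ltW// => x _; rewrite lee_fin.
apply: ge0_le_integral => //.
- by move=> x _; rewrite -EFinM lee_fin mulr_ge0// ltW.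
- exact: measurable_funeM.
- exact: measurable_interaction_integral.
move=> x _.
apply: (@le_trans _ _ (\int[lebesgue_measure]_y ((c * K x)%:E * (K y)%:E))%E).
  rewrite ge0_integralZl//; first by rewrite K1 mule1.
  - by move=> y _; rewrite lee_fin.
  - by rewrite lee_fin mulr_ge0// ltW.
apply: ae_ge0_le_integral => //.
- by move=> y _; rewrite -EFinM lee_fin !mulr_ge0// ltW.
- exact: measurable_funeM.
- by move=> y _; rewrite lee_fin interaction_ge0.
- exact: measurable_interaction_section.
exists [set x]; split => //; first exact: lebesgue_measure_set1.
move=> y /= /not_implyP[_ hy]; apply: contrapT => yx; apply: hy.
rewrite -EFinM lee_fin /interaction -[leLHS]mulrA -[leRHS]mulrA.
have [xo|xi] := boolP ((x <= A) || (B <= x)); first by rewrite (kernel_out xo) mul0r !mulr0.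
have [yo|yi] := boolP ((y <= A) || (B <= y)); first by rewrite (kernel_out yo) !mulr0.
rewrite ler_wpM2r ?mulr_ge0//.
have xy0 : 0 < `|x - y| by rewrite normr_gt0 subr_eq0; apply/eqP => e; apply: yx.
have xyAB : `|x - y| <= B - A.
  move: xi yi; rewrite !negb_or -!ltNge => /andP[? ?] /andP[? ?]; rewrite ler_norml; apply/andP; lra.
rewrite /c; have -> : al - 1 = - (2 - 2 * H) by ring.
rewrite !powRN lef_pV2 ?posrE ?powR_gt0 ?subr_gt0//.
rewrite ge0_ler_powR ?nnegrE ?subr_ge0 ?(ltW AB)//; move: H1; lra.
Qed.

End limit_variance.

(** * Wiener integrals of the scaled kernels *)

Section kernel_wiener.
Context d (Omega : measurableType d) (R : realType) (P : probability Omega R).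
Variables (T H : R) (BH : R -> {RV P >-> R}) (K : R -> R) (A B : R).
Hypothesis T_gt0 : 0 < T.
Hypothesis H_gt : 2^-1 < H.
Hypothesis H_lt1 : H < 1.
Hypothesis BH_fbm : fractional_brownian_motion T H BH.
Hypothesis K_kernel : is_kernel K.
Hypothesis K_bounded : bounded_fun K.
Hypothesis AB : A < B.
Hypothesis A_ge0 : 0 <= A.
Hypothesis K_supp : [set v | K v != 0] = `]A, B[%classic.
Variables (h : R) (Z : R -> Omega -> R).
Hypothesis h_gt0 : 0 < h.
Hypothesis Z_wiener : is_kernel_wiener_process T H BH K h Z.

Local Notation al := (2 * H - 1).

Lemma scaled_kernel_bounded_measurable r :
  bounded_measurable (fun s => scaled_kernel K h (s - r)).
Proof.
have [mK [M hM]] := kernel_bounded_measurable K_kernel K_bounded; split.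
  apply: measurable_funM => //; apply: (measurableT_comp mK).
  by apply: measurable_funM => //; exact: measurable_funB.
by exists (`|h^-1| * M) => s; rewrite normrM ler_wpM2l.
Qed.

Lemma kernel_wiener_square_integrable r : r \in `[0, T] -> square_integrable P (Z r).
Proof.
move=> rT; have [_ /(_ r rT) wr] := Z_wiener.
by have [] := wiener_isometry T_gt0 H_gt BH_fbm (scaled_kernel_bounded_measurable r) wr.
Qed.

(** The condition on [r] says that the support of the scaled kernel lies in
    [[0, T]], so that its whole energy is seen. *)
Lemma kernel_wiener_second_moment r : 0 <= r -> r + h * B <= T ->
  second_moment P (Z r) = h `^ (al - 1) * limit_variance H K A B.
Proof.
move=> r0 rT; have [_ K0 _] := K_kernel.
have [mK _] := kernel_bounded_measurable K_kernel K_bounded.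
have B0 : 0 < B by exact: le_lt_trans AB.
have rin : r \in `[0, T].
  by rewrite in_itv/= r0 (le_trans _ rT)// lerDl mulr_ge0// ltW.
have [_ /(_ r rin) wr] := Z_wiener.
have bf := scaled_kernel_bounded_measurable r.
have [_ -> _] := wiener_isometry T_gt0 H_gt BH_fbm bf wr.
apply: EFin_inj.
rewrite EFinM -(energy_singular_form T_gt0 (hurst_exponent_gt0 H_gt) bf); last first.
  move=> s sT; rewrite /scaled_kernel (kernel_out K_supp) ?mulr0//.
  rewrite ler_pdivrMr// ler_pdivlMr//; apply: contraNT sT.
  rewrite negb_or -!ltNge => /andP[s1 s2].
  rewrite mem_setE in_itv/=; apply/andP; split.
    have : 0 <= A * h by rewrite mulr_ge0// ltW.
    by move: s1 r0; lra.
  by move: s2 rT; rewrite [B * h]mulrC; lra.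
rewrite energy_scaling// [RHS]EFinM (limit_varianceE H_gt K_kernel K_bounded AB A_ge0 K_supp).
by rewrite muleCA.
Qed.

(** Here [r] ranges over all of [[0, T]], where the kernel may be cut at [T]; the
    bound serves to show that almost all paths of [Z] are integrable. *)
Lemma kernel_wiener_second_moment_bound :
  exists2 c : R, 0 <= c & forall r, r \in `[0, T] -> second_moment P (Z r) <= c.
Proof.
have [M M0 hM] := kernel_bound K_bounded.
have al0 := hurst_exponent_gt0 H_gt.
pose N := h^-1 * M; have N0 : 0 <= N by rewrite mulr_ge0 ?invr_ge0// ltW.
have fN r s : `|scaled_kernel K h (s - r)| <= N.
  by rewrite normrM ger0_norm ?invr_ge0 ?(ltW h_gt0)// ler_wpM2l ?invr_ge0 ?(ltW h_gt0).
pose q := N * (2 * T `^ al / al) * (N * T).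
have k0 : 0 <= 2 * T `^ al / al by rewrite divr_ge0 ?(ltW al0)// mulr_ge0 ?powR_ge0.
have q0 : 0 <= q by rewrite mulr_ge0 ?(mulr_ge0 N0 k0)// mulr_ge0// ltW.
exists (H * al * q); first by rewrite mulr_ge0// (ltW (hurst_constant_gt0 H_gt)).
move=> r rT; have [_ /(_ r rT) wr] := Z_wiener.
have bf := scaled_kernel_bounded_measurable r.
have [_ -> _] := wiener_isometry T_gt0 H_gt BH_fbm bf wr.
rewrite ler_wpM2l ?(ltW (hurst_constant_gt0 H_gt))//.
rewrite (le_trans (ler_norm _))// (le_trans (singular_form_bound T_gt0 al0 bf bf (fN r)))//.
apply: ler_wpM2l; first exact: mulr_ge0.
have [mf _] := bounded_measurable_norm bf.
have iN : lebesgue_measure.-integrable `[0, T] (EFin \o (fun=> N)).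
  by apply: continuous_itv_integrable; apply: continuous_subspaceT => s; exact: cvg_cst.
apply: (@le_trans _ _ (\int[lebesgue_measure]_(s in `[0, T]) N)).
  apply: le_Rintegral => //.
  apply: le_integrable iN => //.
    by apply/measurable_EFinP; exact: measurable_funTS.
  by move=> s _ /=; rewrite lee_fin (ger0_norm N0) normr_id.
have T0 := T_gt0.
have e : lebesgue_measure (`[0, T]%classic : set R) = T%:E.
  by rewrite lebesgue_measure_itv/= lte_fin T0 oppr0 adde0.
rewrite (@Rintegral_cst _ _ _ lebesgue_measure)//.
by rewrite le_eqVlt; apply/orP; left; apply/eqP; congr (_ * _); rewrite -[RHS]/(fine T%:E); congr fine.
Qed.

(** As soon as the kernel fits into [[0, T]], the law is exactly normal with the
    rescaled variance: nothing is left to converge. *)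
Lemma kernel_wiener_law r (phi : R -> R) (M c : R) : 0 <= r -> r + h * B <= T ->
  continuous phi -> (forall x, `|phi x| <= M) ->
  c * Num.sqrt (h `^ (al - 1)) = 1 ->
  (\int[P]_w (phi (c * Z r w))%:E =
   \int[normal_prob 0 (Num.sqrt (limit_variance H K A B))]_x (phi x)%:E)%E.
Proof.
move=> r0 rT cphi phiM hc.
have B0 : 0 < B by exact: le_lt_trans AB.
have rin : r \in `[0, T].
  by rewrite in_itv/= r0 (le_trans _ rT)// lerDl mulr_ge0// ltW.
have [_ /(_ r rin) wr] := Z_wiener.
have [hZ _ [psi [vpsi cv _]]] :=
  wiener_isometry T_gt0 H_gt BH_fbm (scaled_kernel_bounded_measurable r) wr.
have lv0 := limit_variance_gt0 H_gt K_kernel K_bounded AB A_ge0 K_supp H_lt1.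
apply: (gaussian_L2_limit_law (X := fun n => step_integral BH (psi n)) _ _ _ hZ cv cphi phiM).
- by move=> n; exact: (step_integral_gaussian BH_fbm (vpsi n)).
- by move=> n; exact: (step_integral_square_integrable BH_fbm (vpsi n)).
- by move=> n; exact: (step_integral_mean BH_fbm (vpsi n)).
- rewrite kernel_wiener_second_moment// sqrtrM ?powR_ge0// mulrA hc mul1r//.
- by rewrite sqrtr_gt0.
Qed.

End kernel_wiener.

(** * Second moment of the supremum of fractional Brownian motion *)

Section dyadic_chaining.
Context {R : realType} (T : R).
Hypothesis T_gt0 : 0 < T.
Implicit Types f : R -> R.

Definition dyadic (n k : nat) : R := T * k%:R / 2 ^+ n.

Definition dyadic_variation f n : R :=
  \sum_(k < 2 ^ n) (f (dyadic n k.+1) - f (dyadic n k)) ^+ 2.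

Lemma dyadic_double n k : dyadic n.+1 k.*2 = dyadic n k.
Proof.
rewrite /dyadic exprS -muln2 natrM.
by field; rewrite gt_eqF// exprn_gt0.
Qed.

Lemma dyadic_in n k : (k <= 2 ^ n)%N -> dyadic n k \in `[0, T].
Proof.
move=> kn; rewrite in_itv/= divr_ge0 ?mulr_ge0 ?(ltW T_gt0) ?exprn_ge0//=.
by rewrite ler_pdivrMr ?exprn_gt0// ler_pM2l// -natrX ler_nat.
Qed.

Lemma dyadic_increment f n k : (k < 2 ^ n)%N ->
  `|f (dyadic n k.+1) - f (dyadic n k)| <= Num.sqrt (dyadic_variation f n).
Proof.
move=> kn; rewrite -sqrtr_sqr; apply: ler_wsqrtr.
rewrite /dyadic_variation (bigD1 (Ordinal kn))//= lerDl.
by apply: sumr_ge0 => i _; exact: sqr_ge0.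
Qed.

(** From a dyadic point of level [n + 1] one increment leads to level [n]. *)
Lemma dyadic_chain f n k : (k <= 2 ^ n)%N ->
  `|f (dyadic n k) - f 0| <= \sum_(i < n.+1) Num.sqrt (dyadic_variation f i).
Proof.
elim: n k => [|n ih] k kn.
  rewrite big_ord1; case: k kn => [_|[_|//]].
    by rewrite /dyadic mulr0 mul0r subrr normr0.
  have e0 : dyadic 0 0 = 0 by rewrite /dyadic mulr0 mul0r.
  by rewrite -{1}e0; exact: dyadic_increment.
rewrite big_ord_recr/= -(odd_double_half k) addnC.
have kn2 : (k./2 <= 2 ^ n)%N.
  by rewrite -leq_double -[(2 ^ n).*2]mul2n -expnS (leq_trans _ kn)// -{2}(odd_double_half k) leq_addl.
have h := ih _ kn2.
case: (boolP (odd k)) => ok; last first.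
  by rewrite addn0 dyadic_double (le_trans h)// lerDl sqrtr_ge0.
rewrite addn1 -(subrK (f (dyadic n.+1 k./2.*2)) (f _)) -addrA addrC.
rewrite (le_trans (ler_normD _ _))// lerD//; first by rewrite dyadic_double.
apply: dyadic_increment; rewrite (leq_trans _ kn)//.
by rewrite -{2}(odd_double_half k) ok add1n.
Qed.

Lemma geometric_sum_le (th : R) n : 0 < th -> th < 1 -> \sum_(i < n) th ^+ i <= (1 - th)^-1.
Proof.
move=> th0 th1; rewrite -div1r ler_pdivlMr ?subr_gt0// mulrC.
have -> : (1 - th) * \sum_(i < n) th ^+ i = 1 - th ^+ n.
  elim: n => [|n ih]; first by rewrite big_ord0 mulr0 expr0 subrr.
  by rewrite big_ord_recr/= mulrDr ih exprS; ring.
by rewrite lerBlDr lerDl exprn_ge0// ltW.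
Qed.

(** The Cauchy-Schwarz inequality with geometric weights. *)
Lemma weighted_square_sum (th : R) (a : nat -> R) n : 0 < th ->
  (\sum_(i < n) a i) ^+ 2 <= (\sum_(i < n) th ^+ i) * (\sum_(i < n) (th ^+ i)^-1 * a i ^+ 2).
Proof.
move=> th0; elim: n => [|n ih]; first by rewrite !big_ord0 expr2 !mul0r.
rewrite !big_ord_recr/=.
set s := \sum_(i < n) a i in ih *; set p := \sum_(i < n) th ^+ i in ih *.
set q := \sum_(i < n) _ in ih *.
have p0 : 0 <= p by apply: sumr_ge0 => i _; rewrite exprn_ge0// ltW.
set x := th ^+ n; have x0 : 0 < x by rewrite exprn_gt0.
have q0 : 0 <= q by apply: sumr_ge0 => i _; rewrite mulr_ge0 ?sqr_ge0// invr_ge0 exprn_ge0// ltW.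
have [p1|p1] := ltP 0 p; last first.
  have pE : p = 0 by apply/eqP; rewrite eq_le p1 p0.
  have s0 : s = 0.
    by apply/eqP; rewrite -sqrf_eq0 eq_le sqr_ge0 andbT (le_trans ih)// pE mul0r.
  rewrite s0 pE !add0r mulrDr mulrA mulfV ?gt_eqF// mul1r lerDr mulr_ge0// ltW//.
have h : 2 * s * a n <= p * (x^-1 * a n ^+ 2) + x * q.
  apply: (@le_trans _ _ (p * (x^-1 * a n ^+ 2) + x * (s ^+ 2 / p))).
    rewrite -subr_ge0 (_ : _ - _ = (p * a n - x * s) ^+ 2 / (p * x)).
      by rewrite divr_ge0 ?sqr_ge0// mulr_ge0// ltW.
    by field; rewrite !gt_eqF.
  by rewrite lerD2l ler_pM2l// ler_pdivrMr// [leRHS]mulrC.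
rewrite mulrDl mulrDr mulrDr [x * (x^-1 * _)]mulrA mulfV ?gt_eqF// mul1r sqrrD.
by move: ih h; rewrite -[s * a n *+ 2]mulr_natl; lra.
Qed.

Lemma dyadic_dense f (t e : R) : {within `[0, T], continuous f} -> t \in `[0, T] -> 0 < e ->
  exists n k, (k <= 2 ^ n)%N /\ `|f t - f (dyadic n k)| < e.
Proof.
move=> cf tT e0; have [d d0 dP] := within_itv_dist cf tT e0.
have /andP[t0 tT'] : 0 <= t <= T by move: tT; rewrite in_itv.
have [n nd] : exists n, T / 2 ^+ n < d.
  have cv : T * (2^-1 : R) ^+ n @[n --> \oo] --> T * 0.
    by apply: cvgMr; apply: cvg_expr; rewrite ger0_norm ?invr_ge0// invf_lt1// ltr1n.
  rewrite mulr0 in cv; have [n _ hn] := cvgr_lt _ cv d d0.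
  by exists n; have := hn n (leqnn n); rewrite /= exprVn.
have n0 : 0 < 2 ^+ n :> R by exact: exprn_gt0.
have q0 : 0 <= t * 2 ^+ n / T by rewrite divr_ge0 ?mulr_ge0// ltW.
exists n, (Num.trunc (t * 2 ^+ n / T)).
have /andP[k1 k2] := truncn_itv q0.
have kn : (Num.trunc (t * 2 ^+ n / T) <= 2 ^ n)%N.
  rewrite -(ler_nat R) (le_trans k1)// natrX ler_pdivrMr// mulrC ler_pM2l//.
split => //; rewrite distrC; apply: dP; first exact: dyadic_in.
rewrite distrC; apply: le_lt_trans nd; rewrite /dyadic ger0_norm.
  rewrite lerBlDr -mulrDl -[X in X + _]mulr1 -mulrDr ler_pdivlMr//.
  by rewrite -ler_pdivrMl// mulrC (le_trans (ltW k2))// -natr1 addrC.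
rewrite subr_ge0 ler_pdivrMr// mulrC -ler_pdivlMr//.
Qed.

(** The chain of increments bounds [f] on dyadic points, and continuity extends the
    bound to all times. The right-hand side no longer depends on [t]. *)
Lemma dyadic_sup (th : R) f t : 0 < th -> th < 1 ->
  {within `[0, T], continuous f} -> t \in `[0, T] ->
  (((1 - th) * (f t - f 0) ^+ 2)%:E <=
   \sum_(0 <= n <oo) ((th ^+ n)^-1 * dyadic_variation f n)%:E)%E.
Proof.
move=> th0 th1 cf tT.
have v0 n : 0 <= (th ^+ n)^-1 * dyadic_variation f n.
  rewrite mulr_ge0 ?invr_ge0 ?exprn_ge0 ?(ltW th0)//.
  by apply: sumr_ge0 => i _; exact: sqr_ge0.
have W0 : (0 <= \sum_(0 <= n <oo) ((th ^+ n)^-1 * dyadic_variation f n)%:E)%E.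
  by apply: nneseries_ge0 => n _ _; rewrite lee_fin.
have dyad n k : (k <= 2 ^ n)%N -> (((1 - th) * (f (dyadic n k) - f 0) ^+ 2)%:E <=
   \sum_(0 <= n <oo) ((th ^+ n)^-1 * dyadic_variation f n)%:E)%E.
  move=> kn; apply: (@le_trans _ _ (\sum_(0 <= i < n.+1) ((th ^+ i)^-1 * dyadic_variation f i)%:E)%E); last first.
    by apply: nneseries_lim_ge => i _ _; rewrite lee_fin.
  rewrite sumEFin lee_fin big_mkord -ler_pdivlMl ?subr_gt0//.
  rewrite -real_normK ?num_real//.
  have c := dyadic_chain f kn.
  apply: (@le_trans _ _ ((\sum_(i < n.+1) Num.sqrt (dyadic_variation f i)) ^+ 2)).
    by rewrite ler_sqr ?nnegrE// (le_trans _ c).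
  apply: (le_trans (weighted_square_sum (fun i => Num.sqrt (dyadic_variation f i)) n.+1 th0)).
  have e : \sum_(i < n.+1) (th ^+ i)^-1 * Num.sqrt (dyadic_variation f i) ^+ 2 =
      \sum_(i < n.+1) (th ^+ i)^-1 * dyadic_variation f i.
    apply: eq_bigr => i _; rewrite sqr_sqrtr//.
    by apply: sumr_ge0 => j _; exact: sqr_ge0.
  rewrite e ler_wpM2r ?geometric_sum_le//.
  by apply: sumr_ge0 => i _.
move: W0 dyad; case: (\sum_(0 <= n <oo) _)%E => [W|_ _|//]; last by rewrite leey.
rewrite !lee_fin => W0 dyad.
have c0 : 0 < 1 - th by rewrite subr_gt0.
rewrite -ler_pdivlMl// -[leLHS]real_normK ?num_real//.
have W1 : 0 <= (1 - th)^-1 * W by rewrite mulr_ge0// invr_ge0 ltW.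
rewrite -(sqr_sqrtr W1) ler_sqr ?nnegrE ?sqrtr_ge0//.
apply/ler_addgt0Pr => e e0.
have [n [k [kn tk]]] := dyadic_dense cf tT e0.
rewrite -(subrK (f (dyadic n k)) (f t)) -addrA (le_trans (ler_normD _ _))//.
rewrite [leRHS]addrC; apply: lerD; first exact: ltW.
have := dyad _ _ kn; rewrite lee_fin -ler_pdivlMl// => h.
by rewrite -sqrtr_sqr ler_wsqrtr.
Qed.

End dyadic_chaining.

Section fbm_supremum.
Context d (Omega : measurableType d) (R : realType) (P : probability Omega R).
Variables (T H : R) (BH : R -> {RV P >-> R}).
Hypothesis T_gt0 : 0 < T.
Hypothesis H_gt : 2^-1 < H.
Hypothesis BH_fbm : fractional_brownian_motion T H BH.

Lemma fbm_increment_moment s t : s \in `[0, T] -> t \in `[0, T] ->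
  second_moment P (fun w => BH t w - BH s w) = `|t - s| `^ (2 * H).
Proof.
move=> sT tT.
have hs := fbm_square_integrable BH_fbm sT; have ht := fbm_square_integrable BH_fbm tT.
have itt := square_integrable_mul ht ht; have iss := square_integrable_mul hs hs.
have ist := square_integrable_mul hs ht.
have -> : second_moment P (fun w => BH t w - BH s w) =
   L2_inner P (BH t) (BH t) + (-2) * L2_inner P (BH s) (BH t) + L2_inner P (BH s) (BH s).
  rewrite /L2_inner -RintegralZl// -RintegralD//; last exact: integrable_EFinZ.
  rewrite -RintegralD//; last by apply: integrable_EFinD => //; exact: integrable_EFinZ.
  by apply: eq_Rintegral => w _; ring.
have H0 : 2 * H != 0 by rewrite gt_eqF//; move: H_gt; lra.
rewrite (fbm_inner BH_fbm tT tT) (fbm_inner BH_fbm sT tT) (fbm_inner BH_fbm sT sT).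
rewrite !subrr normr0 powR0//; by field.
Qed.

(** The [2 ^ n] increments of level [n] have variance [(T / 2 ^ n) `^ (2 H)] each,
    so the sum of their squares has expectation of order [chaining_ratio ^ (2 n)].
    The ratio is below [1] exactly when [1 < 2 H], which is why squares suffice. *)
Definition chaining_ratio : R := Num.sqrt (2 * (2^-1) `^ (2 * H)).

Lemma chaining_ratio_sq : chaining_ratio ^+ 2 = 2 * (2^-1) `^ (2 * H).
Proof. by rewrite sqr_sqrtr// mulr_ge0 ?powR_ge0. Qed.

Lemma chaining_ratio_gt0 : 0 < chaining_ratio.
Proof. by rewrite sqrtr_gt0 mulr_gt0// powR_gt0// invr_gt0. Qed.

Lemma chaining_ratio_lt1 : chaining_ratio < 1.
Proof.
rewrite -sqrtr1 ltr_sqrt//.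
have h : (2^-1 : R) `^ (2 * H) < 2^-1.
  have two_gt0 : 0 < 2 :> R by [].
  have i0 : 0 <= 2^-1 :> R by [].
  have e : (2^-1 : R) `^ (2 * H) = (2 `^ (2 * H))^-1.
    rewrite -powR_inv1// -powRrM mulN1r powRN//.
  rewrite e ltf_pV2 ?posrE ?powR_gt0//.
  rewrite -[ltLHS]powRr1// /powR gt_eqF// ltr_expR ltr_pM2r ?ln_gt0 ?ltr1n//.
  by move: H_gt; lra.
by move: h; lra.
Qed.

Lemma dyadic_power n : 2 ^+ n * (T / 2 ^+ n) `^ (2 * H) = T `^ (2 * H) * (chaining_ratio ^+ 2) ^+ n.
Proof.
rewrite chaining_ratio_sq exprMn powRM ?(ltW T_gt0) ?invr_ge0 ?exprn_ge0//.
rewrite mulrCA; congr (_ * (_ * _)).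
elim: n => [|n ih]; first by rewrite expr0 invr1 powR1.
by rewrite exprS invfM powRM ?invr_ge0 ?exprn_ge0// ih exprS.
Qed.

Lemma dyadic_variation_moment n :
  (\int[P]_w (dyadic_variation T (fun t => BH t w) n)%:E =
   (T `^ (2 * H) * (chaining_ratio ^+ 2) ^+ n)%:E)%E.
Proof.
rewrite /dyadic_variation.
have kin (k : 'I_(2 ^ n)) : dyadic T n k \in `[0, T] /\ dyadic T n k.+1 \in `[0, T].
  by split; apply: dyadic_in => //; exact: ltnW.
under eq_integral do rewrite -sumEFin.
rewrite ge0_integral_sum//; last 2 first.
- move=> k; apply/measurable_EFinP; apply: measurable_funX; apply: measurable_funB; exact: measurable_funP.
- by move=> k w _; rewrite lee_fin sqr_ge0.
transitivity (\sum_(k < 2 ^ n) ((T / 2 ^+ n) `^ (2 * H))%:E)%E.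
  apply: eq_bigr => k _; have [k1 k2] := kin k.
  rewrite second_momentE; last first.
    by apply: square_integrableB; [exact: (fbm_square_integrable BH_fbm k2)|exact: (fbm_square_integrable BH_fbm k1)].
  rewrite fbm_increment_moment// /dyadic -mulrBl -mulrBr -natrB// subSnn mulr1.
  by rewrite ger0_norm// divr_ge0 ?exprn_ge0// ltW.
by rewrite sumEFin; congr EFin; rewrite sumr_const card_ord -[LHS]mulr_natl natrX dyadic_power.
Qed.

(** With weights of ratio [chaining_ratio], the expectations of the terms in
    [dyadic_sup] form a convergent geometric series. The bound is extended real
    valued so that it holds for every [w]. *)
Lemma fbm_sup_square : exists G : Omega -> \bar R,
  [/\ measurable_fun setT G, forall w, (0 <= G w)%E, (\int[P]_w G w < +oo)%E &
      forall w t, t \in `[0, T] -> ((BH t w ^+ 2)%:E <= G w)%E].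
Proof.
pose th := chaining_ratio.
have th0 : 0 < th := chaining_ratio_gt0; have th1 : th < 1 := chaining_ratio_lt1.
pose v n w := (th ^+ n)^-1 * dyadic_variation T (fun t => BH t w) n.
have v0 n w : 0 <= v n w.
  rewrite mulr_ge0 ?invr_ge0 ?exprn_ge0 ?(ltW th0)//.
  by apply: sumr_ge0 => i _; exact: sqr_ge0.
have mV n : measurable_fun setT (fun w => dyadic_variation T (fun t => BH t w) n).
  apply: measurable_sum => k; apply: measurable_funX; apply: measurable_funB; exact: measurable_funP.
have mv n : measurable_fun setT (fun w => (v n w)%:E).
  by apply/measurable_EFinP; exact: measurable_funM.
pose W w := (\sum_(0 <= n <oo) (v n w)%:E)%E.
have W0 w : (0 <= W w)%E by apply: nneseries_ge0 => n _ _; rewrite lee_fin.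
have mW : measurable_fun setT W.
  by apply: ge0_emeasurable_sum => // n w _ _; rewrite lee_fin.
have IW : (\int[P]_w W w < +oo)%E.
  rewrite integral_nneseries//; last by move=> n w _; rewrite lee_fin.
  apply: (@le_lt_trans _ _ (T `^ (2 * H) * (1 - th)^-1)%:E); last by rewrite ltry.
  apply: lime_le.
    by apply: is_cvg_nneseries => n _ _; apply: integral_ge0 => w _; rewrite lee_fin.
  near=> N.
  have e i : (\int[P]_w (v i w)%:E = (T `^ (2 * H) * th ^+ i)%:E)%E.
    under eq_integral do rewrite EFinM.
    rewrite ge0_integralZl//; last 3 first.
    - exact/measurable_EFinP.
    - by move=> w _; rewrite lee_fin; apply: sumr_ge0 => k _; exact: sqr_ge0.
    - by rewrite lee_fin invr_ge0 exprn_ge0// ltW.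
    rewrite dyadic_variation_moment -EFinM -/th exprAC expr2; congr EFin.
    by field; rewrite gt_eqF// exprn_gt0.
  rewrite (eq_bigr _ (fun i _ => e i)) sumEFin lee_fin -mulr_sumr ler_wpM2l ?powR_ge0//.
  by rewrite big_mkord geometric_sum_le.
have zT : 0 \in `[0, T] by rewrite in_itv/= lexx ltW.
have hB0 := fbm_square_integrable BH_fbm zT.
have c0 : 0 < 1 - th by rewrite subr_gt0.
pose G w := ((2 * BH 0 w ^+ 2)%:E + (2 / (1 - th))%:E * W w)%E.
have k0 : 0 <= 2 / (1 - th) by rewrite divr_ge0// ltW.
have m0 : measurable_fun setT (fun w => (2 * BH 0 w ^+ 2)%:E).
  by apply/measurable_EFinP; apply: measurable_funM => //; apply: measurable_funX; exact: hB0.1.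
exists G; split.
- by apply: emeasurable_funD => //; exact: measurable_funeM.
- by move=> w; rewrite adde_ge0// ?mule_ge0// lee_fin mulr_ge0// sqr_ge0.
- rewrite ge0_integralD//; last 3 first.
  + by move=> w _; rewrite lee_fin mulr_ge0// sqr_ge0.
  + by move=> w _; rewrite mule_ge0.
  + exact: measurable_funeM.
  rewrite lte_add_pinfty//.
    have i : P.-integrable setT (EFin \o (fun w => 2 * BH 0 w ^+ 2)).
      by apply: integrable_EFinZ => //; exact: hB0.2.
    have f := integrable_fin_num measurableT i.
    by rewrite ltey_eq f.
  rewrite ge0_integralZl// lte_mul_pinfty//.
move=> w t tT; have [_ _ _ cB] := BH_fbm.
have h := dyadic_sup T_gt0 th0 th1 (cB w) tT.
apply: (@le_trans _ _ ((2 * BH 0 w ^+ 2)%:E + (2 / (1 - th))%:E * ((1 - th) * (BH t w - BH 0 w) ^+ 2)%:E)%E).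
  rewrite -EFinM -EFinD lee_fin [_ / _ * (_ * _)]mulrA divfK ?gt_eqF//.
  rewrite -subr_ge0 (_ : _ - _ = (BH t w - 2 * BH 0 w) ^+ 2) ?sqr_ge0//; ring.
by rewrite leeD2l// lee_wpmul2l.
Unshelve. all: by end_near. Qed.

End fbm_supremum.

(** * Averages of the increments of a path *)

Section kernel_average.
Context {R : realType} (K : R -> R) (A B T h t : R).
Hypothesis T_gt0 : 0 < T.
Hypothesis K_kernel : is_kernel K.
Hypothesis K_bounded : bounded_fun K.
Hypothesis A_ge0 : 0 <= A.
Hypothesis K_supp : [set v | K v != 0] = `]A, B[%classic.
Hypothesis h_gt0 : 0 < h.
Hypothesis t_ge0 : 0 <= t.
Hypothesis thB : t + h * B <= T.
Variable m : {sigma_finite_measure set (measurableTypeR R) -> \bar R}.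
Variables (beta F : R -> R).
Hypothesis mbeta : measurable_fun setT beta.
Hypothesis beta_ge0 : forall s, 0 <= beta s.
Hypothesis beta_fin : (\int[m]_(s in `[0%R, T]) (beta s)%:E < +oo)%E.
Hypothesis F_primitive : forall p q : R, 0 <= p -> p <= q -> q <= T ->
  (\int[m]_(s in `]p, q]) (beta s)%:E = (F q - F p)%:E)%E.

Local Notation leb := (@lebesgue_measure R).
Local Notation Kh r s := (scaled_kernel K h (s - r)).

Let mK : measurable_fun setT K. Proof. by have [] := K_kernel. Qed.
Let K0 x : 0 <= K x. Proof. by have [_ ->] := K_kernel. Qed.
Let K1 : (\int[leb]_x (K x)%:E = 1)%E. Proof. by have [] := K_kernel. Qed.

Let indic_ge0 (D : set R) (x : R) : 0 <= (\1_D x : R).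
Proof. by rewrite indicE. Qed.

Let Kh0 r s : 0 <= Kh r s.
Proof. by rewrite mulr_ge0// invr_ge0 ltW. Qed.

Let mKh : measurable_fun setT (fun p : measurableTypeR R * measurableTypeR R => Kh p.1 p.2).
Proof.
apply: measurable_funM => //; apply: (measurableT_comp mK).
by apply: measurable_funM => //; exact: measurable_funB.
Qed.

Let mKhs r : measurable_fun setT (fun s : R => Kh r s).
Proof.
apply: measurable_funM => //; apply: (measurableT_comp mK).
by apply: measurable_funM => //; exact: measurable_funB.
Qed.

Lemma kernel_average_lty r : (\int[m]_(s in `[0%R, T]) (Kh r s * beta s)%:E < +oo)%E.
Proof.
have [M M0 hM] := kernel_bound K_bounded.
apply: (@le_lt_trans _ _ (\int[m]_(s in `[0%R, T]) ((h^-1 * M)%:E * (beta s)%:E))%E).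
  apply: ge0_le_integral => //.
  - by move=> s _; rewrite lee_fin mulr_ge0.
  - by apply/measurable_EFinP; apply: measurable_funTS; exact: (measurable_funM (mKhs r) mbeta).
  - by apply: measurable_funeM; apply/measurable_EFinP; exact: measurable_funTS.
  - move=> s _; rewrite -EFinM lee_fin ler_wpM2r// ler_wpM2l ?invr_ge0 ?(ltW h_gt0)//.
    by rewrite (le_trans (ler_norm _)).
rewrite ge0_integralZl//; last 3 first.
- by apply/measurable_EFinP; exact: measurable_funTS.
- by move=> s _; rewrite lee_fin.
- by rewrite lee_fin mulr_ge0 ?invr_ge0// ltW.
by rewrite lte_mul_pinfty// lee_fin mulr_ge0 ?invr_ge0// ltW.
Qed.

Let k (p : measurableTypeR R * measurableTypeR R) : R :=
  \1_(`]0, t]%classic : set R) p.1 * \1_(`[0, T]%classic : set R) p.2 * (Kh p.1 p.2 * beta p.2).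

Let k0 p : 0 <= k p.
Proof.
by apply: mulr_ge0; [apply: mulr_ge0; exact: indic_ge0|apply: mulr_ge0; [exact: Kh0|exact: beta_ge0]].
Qed.

Let mk : measurable_fun setT k.
Proof.
apply: measurable_funM; apply: measurable_funM => //.
- by apply: (measurableT_comp (measurable_indic _)) => //; exact: measurable_itv.
- by apply: (measurableT_comp (measurable_indic _)) => //; exact: measurable_itv.
- exact: (measurableT_comp mbeta).
Qed.

(** The integrand after the substitution [r = s - h z]. *)
Let k2 (p : measurableTypeR R * measurableTypeR R) : R :=
  K p.1 * (\1_(`]0, t]%classic : set R) (p.2 - h * p.1) * \1_(`[0, T]%classic : set R) p.2 * beta p.2).

Let k20 p : 0 <= k2 p.
Proof.
apply: mulr_ge0; first exact: K0.
by apply: mulr_ge0; [apply: mulr_ge0; exact: indic_ge0|exact: beta_ge0].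
Qed.

Let mk2 : measurable_fun setT k2.
Proof.
apply: measurable_funM; first exact: (measurableT_comp mK).
apply: measurable_funM; last exact: (measurableT_comp mbeta).
apply: measurable_funM.
  apply: (measurableT_comp (measurable_indic _)); first exact: measurable_itv.
  by apply: measurable_funB => //; exact: measurable_funM.
by apply: (measurableT_comp (measurable_indic _)) => //; exact: measurable_itv.
Qed.

Let k_change s : (\int[leb]_r (k (r, s))%:E = \int[leb]_z (k2 (z, s))%:E)%E.
Proof.
have mks : measurable_fun setT (fun r : R => (k (r, s))%:E).
  apply/measurable_EFinP.
  exact: (measurableT_comp mk (@pair2_measurable _ _ (measurableTypeR R) (measurableTypeR R) s)).
rewrite (integral_affine s h_gt0 mks); last by move=> r; rewrite lee_fin.
rewrite integral_lebesgueN; last 2 first.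
- apply: (measurableT_comp mks).
  by apply: measurable_funD => //; exact: measurable_funM.
- by move=> r; rewrite lee_fin.
rewrite -ge0_integralZl//; last 3 first.
- apply: (measurableT_comp mks); apply: measurable_funD => //.
  by apply: measurable_funM => //; exact: oppr_measurable.
- by move=> r _; rewrite lee_fin.
- by rewrite lee_fin ltW.
apply: eq_integral => z _; rewrite -EFinM; congr EFin.
rewrite /k /k2/=.
have -> : s - (h * - z + s) = z * h by ring.
have -> : h * - z + s = s - h * z by ring.
rewrite /scaled_kernel mulfK ?gt_eqF//.
by field; rewrite gt_eqF.
Qed.

Let k2_inner z : (\int[m]_s (k2 (z, s))%:E = (K z * (F (t + h * z) - F (h * z)))%:E)%E.
Proof.
have [Kz0|Kz] := eqVneq (K z) 0.
  by rewrite Kz0 mul0r integral0_eq// => s _; rewrite /k2/= Kz0 mul0r.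
have [hz0 hzT] := kernel_window A_ge0 K_supp h_gt0 thB Kz.
rewrite EFinM -F_primitive//; last by rewrite lerDr.
rewrite -ge0_integralZl//; last 2 first.
- by move=> s _; rewrite lee_fin.
- by rewrite lee_fin.
rewrite [RHS]integral_mkcond.
apply: eq_integral => s _; rewrite /k2/= EFinM.
rewrite patchE !indicE !mem_setE !in_itv/= subr_gt0 lerBlDr.
  have [/andP[h1 h2]|_] := boolP (h * z < s <= t + h * z).
    by rewrite (le_trans hz0 (ltW h1)) (le_trans h2 hzT) !mul1r.
  by rewrite !mul0r mule0.
by apply/measurable_EFinP; exact: measurable_funTS.
Qed.

Lemma measurable_kernel_average :
  measurable_fun setT (fun r : R => \int[m]_(s in `[0%R, T]) (Kh r s * beta s)%:E)%E.
Proof.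
pose k' (p : measurableTypeR R * measurableTypeR R) : R :=
  \1_(`[0, T]%classic : set R) p.2 * (Kh p.1 p.2 * beta p.2).
have mk' : measurable_fun setT k'.
  apply: measurable_funM; last by apply: measurable_funM => //; exact: (measurableT_comp mbeta).
  by apply: (measurableT_comp (measurable_indic _)) => //; exact: measurable_itv.
have k'0 p : 0 <= k' p.
    by apply: mulr_ge0; [exact: indic_ge0|apply: mulr_ge0; [exact: Kh0|exact: beta_ge0]].
have := measurable_fun_fubini_tonelli_F (m2 := m) (fun p => (k' p)%:E).
rewrite /fubini_F; move=> /(_ _ _).
rewrite (_ : (fun x => _) = (fun r : R => \int[m]_(s in `[0%R, T]) (Kh r s * beta s)%:E)%E).
  by apply; [exact/measurable_EFinP|move=> p; rewrite lee_fin].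
apply/funext => r; rewrite [RHS]integral_mkcond; apply: eq_integral => s _.
by rewrite patchE /k'/= indicE; case: ifPn => _; rewrite ?mul1r ?mul0r.
Qed.

(** Tonelli's theorem, used before and after the substitution [r = s - h z] in the
    inner integral: for fixed [z], the constraint [0 < r <= t] becomes
    [h z < s <= t + h z]. *)
Lemma kernel_average :
  (\int[leb]_(r in `[0%R, t]) \int[m]_(s in `[0%R, T]) (Kh r s * beta s)%:E =
   \int[leb]_z (K z * (F (t + h * z) - F (h * z)))%:E)%E.
Proof.
(* without r = 0, the variable s ranges over the half-open interval ]hz, t + hz] *)
rewrite -integral_itv_obnd_cbnd; last by apply: measurable_funTS; exact: measurable_kernel_average.
transitivity (\int[leb]_r \int[m]_s (k (r, s))%:E)%E.
  rewrite integral_mkcond; apply: eq_integral => r _; rewrite patchE.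
  case: ifPn => rt.
    rewrite integral_mkcond; apply: eq_integral => s _.
    rewrite patchE /k !indicE/= rt mul1r.
    by case: ifPn => _; rewrite ?mul1r ?mul0r.
  by rewrite integral0_eq// => s _; rewrite /k indicE/= (negbTE rt) !mul0r.
rewrite (fubini_tonelli (fun p => (k p)%:E))//; last exact/measurable_EFinP.
under eq_integral do rewrite k_change.
rewrite -(fubini_tonelli (fun p => (k2 p)%:E))//; last exact/measurable_EFinP.
by apply: eq_integral => z _; exact: k2_inner.
Qed.

Lemma primitive_homo p q : 0 <= p -> p <= q -> q <= T -> F p <= F q.
Proof.
move=> p0 pq qT; rewrite -subr_ge0 -lee_fin -F_primitive//.
by apply: integral_ge0 => s _; rewrite lee_fin.
Qed.

Lemma kernel_average_ge0 z : 0 <= K z * (F (t + h * z) - F (h * z)).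
Proof.
by rewrite -lee_fin -k2_inner; apply: integral_ge0 => s _; rewrite lee_fin.
Qed.

Lemma measurable_kernel_increment :
  measurable_fun setT (fun z : R => K z * (F (t + h * z) - F (h * z))).
Proof.
apply/measurable_EFinP.
have := measurable_fun_fubini_tonelli_F (m2 := m) (fun p => (k2 p)%:E).
rewrite /fubini_F; move=> /(_ _ _).
rewrite (funext k2_inner); apply; first exact/measurable_EFinP.
by move=> p; rewrite lee_fin.
Qed.

Lemma integrable_kernel_increment :
  leb.-integrable setT (EFin \o (fun z => K z * (F (t + h * z) - F (h * z)))).
Proof.
have T0 := T_gt0.
apply/integrableP; split; first by apply/measurable_EFinP; exact: measurable_kernel_increment.
apply: (@le_lt_trans _ _ (\int[leb]_z ((F T - F 0)%:E * (K z)%:E))%E).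
  apply: ge0_le_integral => //.
  - apply: measurableT_comp => //; apply/measurable_EFinP; exact: measurable_kernel_increment.
  - by apply: measurable_funeM; exact/measurable_EFinP.
  - move=> z _ /=; rewrite -EFinM lee_fin ger0_norm ?kernel_average_ge0//.
    have [->|Kz] := eqVneq (K z) 0; first by rewrite mulr0 mul0r.
    have [hz0 hzT] := kernel_window A_ge0 K_supp h_gt0 thB Kz.
    rewrite mulrC ler_wpM2r// lerB//; apply: primitive_homo => //.
      by rewrite addr_ge0.
    by rewrite (le_trans _ hzT)// lerDr.
rewrite ge0_integralZl//.
- by rewrite K1 mule1 ltry.
- exact/measurable_EFinP.
- by move=> z _; rewrite lee_fin.
- by rewrite lee_fin subr_ge0 primitive_homo// ltW.
Qed.

Lemma kernel_average_Rintegral :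
  leb.-integrable `[0, t] (EFin \o (fun r => \int[m]_(s in `[0, T]) (Kh r s * beta s))) /\
  \int[leb]_(r in `[0, t]) (\int[m]_(s in `[0, T]) (Kh r s * beta s)) =
  \int[leb]_z (K z * (F (t + h * z) - F (h * z))).
Proof.
have e r : (\int[m]_(s in `[0, T]) (Kh r s * beta s))%:E =
    (\int[m]_(s in `[0%R, T]) (Kh r s * beta s)%:E)%E.
  rewrite /Rintegral fineK// ge0_fin_numE ?kernel_average_lty//.
  by apply: integral_ge0 => s _; rewrite lee_fin mulr_ge0.
have i := integrable_kernel_increment.
have v : (\int[leb]_(r in `[0%R, t]) (\int[m]_(s in `[0, T]) (Kh r s * beta s))%:E =
    (\int[leb]_z (K z * (F (t + h * z) - F (h * z))))%:E)%E.
  under eq_integral do rewrite e.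
  by rewrite kernel_average /Rintegral fineK//; exact: integrable_fin_num.
split; last by rewrite /Rintegral v.
apply/integrableP; split.
  rewrite (_ : EFin \o _ = fun r => \int[m]_(s in `[0%R, T]) (Kh r s * beta s)%:E)%E; last by apply/funext => r /=; rewrite e.
  by apply: measurable_funTS; exact: measurable_kernel_average.
apply: (@le_lt_trans _ _ (\int[leb]_(r in `[0%R, t]) (\int[m]_(s in `[0, T]) (Kh r s * beta s))%:E)%E); last by rewrite v ltry.
rewrite le_eqVlt; apply/orP; left; apply/eqP; apply: eq_integral => r _ /=.
by rewrite ger0_norm//; apply: Rintegral_ge0 => s _; rewrite mulr_ge0.
Qed.

End kernel_average.

Section path_average.
Context {R : realType} (K : R -> R) (A B T h t : R).
Hypothesis T_gt0 : 0 < T.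
Hypothesis K_kernel : is_kernel K.
Hypothesis K_bounded : bounded_fun K.
Hypothesis A_ge0 : 0 <= A.
Hypothesis K_supp : [set v | K v != 0] = `]A, B[%classic.
Hypothesis h_gt0 : 0 < h.
Hypothesis t_ge0 : 0 <= t.
Hypothesis thB : t + h * B <= T.

Local Notation leb := (@lebesgue_measure R).
Local Notation Kh r s := (scaled_kernel K h (s - r)).

(** The common form of the contributions of drift and reflection to the
    estimator; integrability is recorded so that contributions can be added. *)
Definition averages_increments (g V : R -> R) :=
  [/\ leb.-integrable `[0, t] (EFin \o g),
      leb.-integrable setT (EFin \o (fun z => K z * (V (t + h * z) - V (h * z)))) &
      \int[leb]_(r in `[0, t]) g r = \int[leb]_z (K z * (V (t + h * z) - V (h * z)))].

Lemma averages_incrementsD (e : R) g1 g2 V1 V2 :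
  averages_increments g1 V1 -> averages_increments g2 V2 ->
  averages_increments (fun r => g1 r + e * g2 r) (fun s => V1 s + e * V2 s).
Proof.
move=> [i1 j1 e1] [i2 j2 e2].
have jE : (fun z => K z * (V1 (t + h * z) + e * V2 (t + h * z) - (V1 (h * z) + e * V2 (h * z)))) =
    (fun z => K z * (V1 (t + h * z) - V1 (h * z)) + e * (K z * (V2 (t + h * z) - V2 (h * z)))).
  by apply/funext => z; ring.
split.
- by apply: integrable_EFinD => //; exact: integrable_EFinZ.
- by rewrite jE; apply: integrable_EFinD => //; exact: integrable_EFinZ.
- rewrite RintegralD//; last exact: integrable_EFinZ.
  rewrite RintegralZl// e1 e2 jE RintegralD//; last exact: integrable_EFinZ.
  by rewrite RintegralZl.
Qed.

Lemma averages_increments_eq g1 g2 V1 V2 : averages_increments g1 V1 ->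
  g1 =1 g2 -> (forall p q, 0 <= p -> p <= q -> q <= T -> V1 q - V1 p = V2 q - V2 p) ->
  averages_increments g2 V2.
Proof.
move=> [i1 j1 e1] /funext <- V12.
suff jE : (fun z => K z * (V1 (t + h * z) - V1 (h * z))) = (fun z => K z * (V2 (t + h * z) - V2 (h * z))).
  by split => //; rewrite -?jE.
apply/funext => z; have [->|Kz] := eqVneq (K z) 0; first by rewrite !mul0r.
have [hz0 hzT] := kernel_window A_ge0 K_supp h_gt0 thB Kz.
by rewrite V12// lerDr.
Qed.

Lemma finite_measure_averages (m : {finite_measure set (measurableTypeR R) -> \bar R}) :
  averages_increments (fun r => \int[m]_(s in `[0, T]) Kh r s)
    (fun p => fine (m `]0, p]%classic)).
Proof.
have fin (D : set (measurableTypeR R)) : measurable D -> m D \is a fin_num.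
    exact: fin_num_measure.
pose one : R -> R := fun=> 1; have mone : measurable_fun setT one by exact: measurable_cst.
have one0 s : 0 <= one s by rewrite ler01.
have F p q : 0 <= p -> p <= q -> q <= T ->
  (\int[m]_(s in `]p, q]) (one s)%:E = (fine (m `]0%R, q]%classic) - fine (m `]0%R, p]%classic))%:E)%E.
  move=> p0 pq qT; rewrite /one integral_cst// mul1e.
  have e : `]0%R, q]%classic = `]0%R, p]%classic `|` `]p, q]%classic :> set R.
    by rewrite -itv_bndbnd_setU// bnd_simp.
  rewrite e measureU//; last first.
    apply/seteqP; split => // s [] /=; rewrite !in_itv/= => /andP[_ sp] /andP[ps _].
    by have := lt_le_trans ps sp; rewrite ltxx.
  by rewrite fineD ?fin// addrC addKr fineK ?fin.
have bfin : (\int[m]_(s in `[0%R, T]) (one s)%:E < +oo)%E.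
  by rewrite /one integral_cst// mul1e -ge0_fin_numE// fin.
have [i v] := kernel_average_Rintegral T_gt0 K_kernel K_bounded A_ge0 K_supp h_gt0 t_ge0 thB
  mone one0 bfin F.
have j := integrable_kernel_increment T_gt0 K_kernel A_ge0 K_supp h_gt0 t_ge0 thB
  mone one0 F.
apply: (@averages_increments_eq (fun r => \int[m]_(s in `[0, T]) (Kh r s * 1)) _ (fun p => fine (m `]0, p]%classic))) => //.
by move=> r; under eq_Rintegral do rewrite mulr1.
Qed.

(** The previous lemma for the two Jordan parts of the differential measure. *)
Lemma stieltjes_averages (y : R -> R) : {within `[0, T], continuous y} ->
  bounded_variation 0 T y ->
  averages_increments (fun r => stieltjes_integral T y (fun s => Kh r s)) y.
Proof.
move=> cy bvy; have [D1 _] := differential_measureP T_gt0 cy bvy.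
set nu := differential_measure T y in D1.
pose jp : {finite_measure set (measurableTypeR R) -> \bar R} := jordan_pos (hahn_pos_negP nu).
pose jn : {finite_measure set (measurableTypeR R) -> \bar R} := jordan_neg (hahn_pos_negP nu).
apply: (averages_increments_eq (averages_incrementsD (-1)
  (finite_measure_averages jp) (finite_measure_averages jn))).
  by move=> r; rewrite mulN1r.
have decomp q : 0 <= q -> q <= T ->
    fine (jp `]0, q]%classic) + -1 * fine (jn `]0, q]%classic) = y q - y 0.
  move=> q0 qT; have := D1 _ _ (lexx 0) q0 qT.
  rewrite (jordan_decomp (hahn_pos_negP nu))// /cadd/= cscaleN1.
  have fp : jp `]0, q]%classic \is a fin_num by exact: fin_num_measure.
  have fn : jn `]0, q]%classic \is a fin_num by exact: fin_num_measure.
  move=> /(congr1 fine)/=; rewrite fineB// => <-.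
  by rewrite mulN1r.
move=> p q p0 pq qT; rewrite !decomp ?(le_trans p0)// ?(le_trans pq)//.
by ring.
Qed.

(** The nonnegative case gives the claim for [beta + M] and for [M], where [M]
    bounds [beta] on [[0, T]]. *)
Lemma drift_averages (beta : R -> R) : {within `[0, T], continuous beta} ->
  averages_increments (fun r => \int[leb]_(s in `[0, T]) (Kh r s * beta s))
    (fun p => \int[leb]_(s in `[0, p]) beta s).
Proof.
move=> cb; have T0 := ltW T_gt0.
have [M M0 hM] : exists2 M : R, 0 <= M & forall s, s \in `[0, T] -> `|beta s| <= M.
  have /compact_bounded[M [Mr hM]] : compact (beta @` `[0, T]).
    by apply: continuous_compact => //; exact: segment_compact.
  exists (`|M| + 1); first by rewrite addr_ge0.
  move=> s sT; apply: hM; first by rewrite (le_lt_trans (ler_norm M))// ltrDl.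
  by exists s.
have ci (c : R) p : leb.-integrable `[0, p] (EFin \o (fun=> c)).
  by apply: continuous_itv_integrable; apply: continuous_subspaceT => r; exact: cvg_cst.
have bi p : p <= T -> leb.-integrable `[0, p] (EFin \o beta).
  move=> pT; apply: continuous_itv_integrable; apply: continuous_subspaceW cb.
  by move=> s /=; rewrite !in_itv/= => /andP[-> sp]; rewrite (le_trans sp).
have bMi p : p <= T -> leb.-integrable `[0, p] (EFin \o (fun s => beta s + M)).
  by move=> pT; apply: integrable_EFinD => //; exact: bi.
pose beta1 := (fun s => beta s + M) \_ `[0, T].
have beta1E s : s \in `[0, T] -> beta1 s = beta s + M.
  by move=> sT; rewrite /beta1 patchE mem_setE sT.
have mb1 : measurable_fun setT beta1.
  apply/(measurable_restrictT _ _).1 => //.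
  have := measurable_int _ (bMi T (lexx T)).
  by move/measurable_EFinP.
have b1_ge0 s : 0 <= beta1 s.
  rewrite /beta1 patchE mem_setE; case: ifPn => // sT.
  by have := hM _ sT; rewrite ler_norml => /andP[]; lra.
have itv_sub (p q : R) : 0 <= p -> q <= T -> `]p, q]%classic `<=` (`[0, T]%classic : set R).
  move=> p0 qT s /=; rewrite !in_itv/= => /andP[ps sq].
  by rewrite (le_trans p0 (ltW ps)) (le_trans sq qT).
have F1 p q : 0 <= p -> p <= q -> q <= T -> (\int[leb]_(s in `]p, q]) (beta1 s)%:E =
    (\int[leb]_(s in `[0, q]) (beta s + M) - \int[leb]_(s in `[0, p]) (beta s + M))%:E)%E.
  move=> p0 pq qT.
  have i := bMi q qT.
  rewrite Rintegral_itvB ?bnd_simp//.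
  rewrite /Rintegral fineK; last first.
    apply: integrable_fin_num => //; apply: integrableS i => //.
    by move=> s /=; rewrite !in_itv/= => /andP[/ltW/(le_trans p0) -> ->].
  apply: eq_integral => s; rewrite inE => /(itv_sub _ _ p0 qT) sT.
  by rewrite beta1E.
have F2 p q : 0 <= p -> p <= q -> q <= T -> (\int[leb]_(s in `]p, q]) M%:E =
    (\int[leb]_(s in `[0, q]) M - \int[leb]_(s in `[0, p]) M)%:E)%E.
  move=> p0 pq qT.
  rewrite Rintegral_itvB ?bnd_simp//.
  rewrite /Rintegral fineK//.
  apply: integrable_fin_num => //; apply: integrableS (ci M q) => //.
  by move=> s /=; rewrite !in_itv/= => /andP[/ltW/(le_trans p0) -> ->].
have fin1 : (\int[leb]_(s in `[0%R, T]) (beta1 s)%:E < +oo)%E.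
  have i := bMi T (lexx T).
  have : (\int[leb]_(s in `[0%R, T]) (beta s + M)%:E)%E \is a fin_num by apply: integrable_fin_num.
  rewrite fin_numElt => /andP[_]; apply: le_lt_trans.
  rewrite le_eqVlt; apply/orP; left; apply/eqP; apply: eq_integral => s.
  by rewrite inE => sT; rewrite beta1E.
have fin2 : (\int[leb]_(s in `[0%R, T]) M%:E < +oo)%E.
  have : (\int[leb]_(s in `[0%R, T]) M%:E)%E \is a fin_num by apply: integrable_fin_num (ci M T).
  by rewrite fin_numElt => /andP[_].
have [i1 v1] := kernel_average_Rintegral T_gt0 K_kernel K_bounded A_ge0 K_supp h_gt0 t_ge0 thB
  mb1 b1_ge0 fin1 F1.
have j1 := integrable_kernel_increment T_gt0 K_kernel A_ge0 K_supp h_gt0 t_ge0 thB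
  mb1 b1_ge0 F1.
have [i2 v2] := kernel_average_Rintegral T_gt0 K_kernel K_bounded A_ge0 K_supp h_gt0 t_ge0 thB
  (measurable_cst M) (fun=> M0) fin2 F2.
have j2 := integrable_kernel_increment T_gt0 K_kernel A_ge0 K_supp h_gt0 t_ge0 thB
  (measurable_cst M) (fun=> M0) F2.
have a1 : averages_increments (fun r => \int[leb]_(s in `[0, T]) (Kh r s * beta1 s))
    (fun p => \int[leb]_(s in `[0, p]) (beta s + M)) by split.
have a2 : averages_increments (fun r => \int[leb]_(s in `[0, T]) (Kh r s * M))
    (fun p => \int[leb]_(s in `[0, p]) M) by split.
have fi r (g : R -> R) : measurable_fun setT g -> (forall s, 0 <= g s) ->
    (\int[leb]_(s in `[0%R, T]) (g s)%:E < +oo)%E ->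
    leb.-integrable `[0, T] (EFin \o (fun s => Kh r s * g s)).
  move=> mg g0 gfin; have [mK K0 _] := K_kernel.
  have Kg0 s : 0 <= Kh r s * g s by rewrite !mulr_ge0 ?invr_ge0 ?(ltW h_gt0).
  apply/integrableP; split.
    apply/measurable_EFinP; apply: measurable_funTS; apply: measurable_funM => //.
    apply: measurable_funM => //; apply: (measurableT_comp mK).
    by apply: measurable_funM => //; exact: measurable_funB.
  apply: le_lt_trans (kernel_average_lty K_kernel K_bounded h_gt0 mg g0 gfin r).
  rewrite le_eqVlt; apply/orP; left; apply/eqP; apply: eq_integral => s _ /=.
  by rewrite ger0_norm.
apply: (averages_increments_eq (averages_incrementsD (-1) a1 a2)).
  move=> r; rewrite mulN1r -RintegralB//; last 2 first.
  - exact: fi mb1 b1_ge0 fin1.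
  - exact: (fi r _ (measurable_cst M) (fun=> M0) fin2).
  apply: eq_Rintegral => s; rewrite inE => sT.
  by rewrite beta1E//; ring.
have e q : 0 <= q -> q <= T -> \int[leb]_(s in `[0, q]) (beta s + M) + -1 * \int[leb]_(s in `[0, q]) M =
    \int[leb]_(s in `[0, q]) beta s.
  move=> q0 qT; rewrite RintegralD ?mulN1r ?addrK//; exact: bi.
by move=> p q p0 pq qT; rewrite !e ?(le_trans p0)// (le_trans pq).
Qed.

End path_average.

(** * Measurability, and paths of the noise that are not integrable *)

(** One of the parts of [f] has infinite integral, so the extended integral is
    infinite (with [+oo - +oo = -oo]) and its real part is [0]. *)
Lemma Rintegral_not_integrable d (E : measurableType d) (R : realType)
    (mu : {measure set E -> \bar R}) (D : set E) (f : E -> R) : measurable D ->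
  measurable_fun D f -> ~ mu.-integrable D (EFin \o f) -> Rintegral mu D f = 0.
Proof.
move=> mD mf nif; have mEf : measurable_fun D (EFin \o f) by exact/measurable_EFinP.
rewrite /Rintegral integralE.
have p0 : (0 <= \int[mu]_(x in D) (EFin \o f)^\+ x)%E by apply: integral_ge0 => x _; exact: funepos_ge0.
have n0 : (0 <= \int[mu]_(x in D) (EFin \o f)^\- x)%E by apply: integral_ge0 => x _; exact: funeneg_ge0.
have sum : (\int[mu]_(x in D) `|(EFin \o f) x| =
    \int[mu]_(x in D) (EFin \o f)^\+ x + \int[mu]_(x in D) (EFin \o f)^\- x)%E.
  rewrite -ge0_integralD//; last 2 first.
  - exact: measurable_funepos.
  - exact: measurable_funeneg.
  by apply: eq_integral => x _; have := congr1 (@^~ x) (fune_abse (EFin \o f)).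
move: sum p0 n0.
case: (\int[mu]_(x in D) (EFin \o f)^\+ x)%E => [p|_|//]; case: (\int[mu]_(x in D) (EFin \o f)^\- x)%E => [q|_|//].
  move=> sum _ _; exfalso; apply: nif; apply/integrableP; split => //.
  by rewrite sum -EFinD ltry.
- by [].
- by [].
- by [].
Qed.

Section noisy_average.
Context {R : realType} (K : R -> R) (T h t : R).
Local Notation leb := (@lebesgue_measure R).

(** If [zeta] is not integrable, neither is the first integrand, and both real
    integrals are [0]. *)
Lemma noisy_average (g V zeta : R -> R) (e : R) : 0 < e ->
  averages_increments K h t g V -> measurable_fun `[0, t] zeta ->
  \int[leb]_(r in `[0, t]) (g r + e * zeta r) - e * \int[leb]_(r in `[0, t]) zeta r =
  if `[< leb.-integrable `[0, t] (EFin \o zeta) >]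
  then \int[leb]_z (K z * (V (t + h * z) - V (h * z))) else 0.
Proof.
move=> e0 [ig jV gV] mz; case: asboolP => iz.
  rewrite RintegralD//; last exact: integrable_EFinZ.
  by rewrite RintegralZl// addrK.
have mg : measurable_fun `[0, t] g.
  by have /measurable_EFinP := measurable_int _ ig.
rewrite !Rintegral_not_integrable ?mulr0 ?subrr//.
  by apply: measurable_funD => //; exact: measurable_funM.
move=> igz; apply: iz.
have mD : measurable (`[0, t]%classic : set (measurableTypeR R)) by exact: measurable_itv.
have := integrable_EFinZ mD e^-1 (integrable_EFinB mD igz ig).
apply: eq_integrable => // r _ /=.
by rewrite addrAC subrr add0r mulKf// gt_eqF.
Qed.

End noisy_average.

Section joint_measurability.
Context d (Omega : measurableType d) (R : realType).
Local Notation leb := (@lebesgue_measure R).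

(** The process is the limit of its discretisations on finer and finer grids. *)
Lemma measurable_continuous_process (T : R) (V : R -> Omega -> R) : 0 < T ->
  (forall s, s \in `[0, T] -> measurable_fun setT (V s)) ->
  (forall w, {within `[0, T], continuous (fun s => V s w)}) ->
  measurable_fun (`]0, T] `*` setT)
    (fun p : measurableTypeR R * Omega => V p.1 p.2).
Proof.
move=> T0 mV cV.
apply: (@measurable_fun_cvg _ _ _ _
  (fun n (p : measurableTypeR R * Omega) => grid_step T n (fun s => V s p.2) p.1)).
  move=> n; apply: measurable_funTS; apply: measurable_sum => k.
  apply: measurable_funM.
    apply: (measurableT_comp (mV _ _)) => //.
    have [k0 kT] := @grid_in _ _ T0 n k (ltnW (ltn_ord k)).
    by rewrite in_itv/= k0.
  by apply: (measurableT_comp (measurable_indic _)) => //; exact: measurable_itv.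
move=> [r w] [/= ]; rewrite in_itv/= => /andP[r0 rT] _.
exact: grid_step_cvg.
Qed.

Lemma measurable_Rintegral_param (f : measurableTypeR R * Omega -> R) :
  measurable_fun setT f -> measurable_fun setT (fun w => \int[leb]_z f (z, w)).
Proof.
move=> mf; have mEf : measurable_fun setT (EFin \o f) by exact/measurable_EFinP.
apply: measurableT_comp => //.
under eq_fun do rewrite integralE.
apply: emeasurable_funB.
- have := @measurable_fun_fubini_tonelli_G _ _ _ _ _ leb ((EFin \o f)^\+)%E (measurable_funepos mEf) (funepos_ge0 _).
  by apply: eq_measurable_fun => w _; apply: eq_integral => z _; rewrite !unlock.
- have := @measurable_fun_fubini_tonelli_G _ _ _ _ _ leb ((EFin \o f)^\-)%E (measurable_funeneg mEf) (funeneg_ge0 _).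
  by apply: eq_measurable_fun => w _; apply: eq_integral => z _; rewrite !unlock.
Qed.

Lemma measurable_path_average (K : R -> R) (A B T h t : R) (V : R -> Omega -> R) :
  0 < T -> 0 <= A -> measurable_fun setT K -> [set v | K v != 0] = `]A, B[%classic ->
  0 < h -> 0 <= t -> t + h * B <= T ->
  (forall s, s \in `[0, T] -> measurable_fun setT (V s)) ->
  (forall w, {within `[0, T], continuous (fun s => V s w)}) ->
  measurable_fun setT (fun w => \int[leb]_z (K z * (V (t + h * z) w - V (h * z) w))).
Proof.
move=> T0 A0 mK K_supp h0 t0 thB mV cV.
have jV := measurable_continuous_process T0 mV cV.
pose f (p : measurableTypeR R * Omega) := K p.1 * (V (t + h * p.1) p.2 - V (h * p.1) p.2).
apply: (measurable_Rintegral_param (f := f)).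
pose E : set (measurableTypeR R * Omega) := `]A, B[ `*` setT.
have mE : measurable E by apply: measurableX => //; exact: measurable_itv.
have -> : f = f \_ E.
  apply/funext => -[z w]; rewrite patchE; case: ifPn => // nE.
  rewrite /f/=; have [->|Kz] := eqVneq (K z) 0; first by rewrite mul0r.
  move: nE; rewrite notin_setE => -[]; split => //.
  have : [set v | K v != 0] z by []; by rewrite K_supp.
apply: (measurable_restrictT f mE).1.
have comp (c : R) : 0 <= c -> c + h * B <= T ->
    measurable_fun E (fun p : measurableTypeR R * Omega => V (c + h * p.1) p.2).
  move=> c0 cB.
  have mD : measurable (`]0, T] `*` setT : set (measurableTypeR R * Omega)).
    by apply: measurableX => //; exact: measurable_itv.
  apply: (measurable_comp (F := `]0, T] `*` setT)
    (g := fun p : measurableTypeR R * Omega => ((c + h * p.1, p.2) : measurableTypeR R * Omega)) mD _ jV).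
    move=> _ [[z w] [/= + _] <-]; rewrite in_itv/= => /andP[Az zB]; split => //=.
    rewrite in_itv/=; apply/andP; split.
      by rewrite ltr_wpDl// mulr_gt0// (le_lt_trans A0).
    by rewrite (le_trans _ cB)// lerD2l ler_pM2l// ltW.
  apply: measurable_funTS; apply/measurable_fun_pairP; split => //=.
    by apply: measurable_funD => //; exact: measurable_funM.
  exact: measurable_snd.
apply: measurable_funM; first by apply: measurable_funTS; exact: (measurableT_comp mK).
apply: measurable_funB; first exact: comp.
have := comp 0 (lexx 0).
have hBT : 0 + h * B <= T by rewrite add0r (le_trans _ thB)// lerDr.
by move=> /(_ hBT); apply: eq_measurable_fun => p _; rewrite add0r.
Qed.

End joint_measurability.

Section integrable_paths.
Context d (Omega : measurableType d) (R : realType) (P : probability Omega R).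
Variables (T t : R) (Z : R -> Omega -> R).
Hypothesis t_ge0 : 0 <= t.
Hypothesis tT : t <= T.
Hypothesis mZ : measurable_fun (`[0, T] `*` setT)
  (fun p : measurableTypeR R * Omega => Z p.1 p.2).
Local Notation leb := (@lebesgue_measure R).

Let E : set (measurableTypeR R * Omega) := `[0, t] `*` setT.

Let mE : measurable E.
Proof. by apply: measurableX => //; exact: measurable_itv. Qed.

Let Zt : measurableTypeR R * Omega -> R := (fun p => `|Z p.1 p.2|) \_ E.

Let mZt : measurable_fun setT Zt.
Proof.
have h : measurable_fun E (fun p : measurableTypeR R * Omega => Z p.1 p.2).
  apply: measurable_funS mZ; first by apply: measurableX => //; exact: measurable_itv.
  move=> [r w] [/= + _]; rewrite in_itv/= => /andP[r0 rt]; split => //=.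
  by rewrite in_itv/= r0 (le_trans rt).
apply: (measurable_restrictT (fun p : measurableTypeR R * Omega => `|Z p.1 p.2|) mE).1.
exact: (measurableT_comp (@normr_measurable R setT) h).
Qed.

Let Zt0 p : (0 <= (Zt p)%:E)%E.
Proof. by rewrite /Zt patchE; case: ifPn => _; rewrite lee_fin. Qed.

Lemma measurable_path w : measurable_fun `[0, t] (fun r : R => Z r w).
Proof.
have mD : measurable (`[0, T] `*` setT : set (measurableTypeR R * Omega)).
  by apply: measurableX => //; exact: measurable_itv.
apply: (measurable_comp (F := `[0, T] `*` setT)
  (g := fun r : measurableTypeR R => ((r, w) : measurableTypeR R * Omega)) mD _ mZ).
  move=> _ [r + <-]; rewrite /= in_itv/= => /andP[r0 rt]; split => //=.
  by rewrite in_itv/= r0 (le_trans rt).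
apply: measurable_funTS; exact: pair2_measurable.
Qed.

Let norm_path w : (\int[leb]_(r in `[0%R, t]) `|Z r w|%:E = \int[leb]_r (Zt (r, w))%:E)%E.
Proof.
rewrite integral_mkcond; apply: eq_integral => r _; rewrite /Zt !patchE.
have -> : ((r, w) \in E) = (r \in (`[0, t]%classic : set R)).
  by apply/idP/idP; rewrite !inE /E/=; [move=> []|].
by case: ifPn.
Qed.

Lemma integrable_pathP w : leb.-integrable `[0, t] (EFin \o (fun r => Z r w)) <->
  (\int[leb]_r (Zt (r, w))%:E < +oo)%E.
Proof.
rewrite -norm_path; split => [/integrableP[]//|h].
by apply/integrableP; split => //; apply/measurable_EFinP; exact: measurable_path.
Qed.

Lemma measurable_integrable_paths :
  measurable [set w | leb.-integrable `[0, t] (EFin \o (fun r => Z r w))].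
Proof.
have mF : measurable_fun setT (fun w => \int[leb]_r (Zt (r, w))%:E)%E.
  apply: (@measurable_fun_fubini_tonelli_G _ _ _ _ _ leb (fun p => (Zt p)%:E)) => //.
  exact/measurable_EFinP.
have := emeasurable_fun_infty_o measurableT mF +oo%E.
rewrite setTI; congr measurable; apply/seteqP; split => w /=; by move/integrable_pathP.
Qed.

(** By Tonelli's theorem and [`|z| <= 1 + z ^+ 2]. *)
Lemma ae_integrable_paths (c : R) :
  (forall r, r \in `[0, T] -> square_integrable P (Z r) /\ second_moment P (Z r) <= c) ->
  {ae P, forall w, leb.-integrable `[0, t] (EFin \o (fun r => Z r w))}.
Proof.
move=> hZ.
have i : P.-integrable setT (fun w => \int[leb]_r (Zt (r, w))%:E)%E.
  apply/integrableP; split.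
    apply: (@measurable_fun_fubini_tonelli_G _ _ _ _ _ leb (fun p => (Zt p)%:E)) => //.
    exact/measurable_EFinP.
  under eq_integral => w _ do rewrite gee0_abs ?integral_ge0//.
  rewrite -(fubini_tonelli (m1 := leb) (m2 := P) (fun p => (Zt p)%:E))//; last exact/measurable_EFinP.
  apply: (@le_lt_trans _ _ (\int[leb]_(r in `[0%R, t]) (1 + c)%:E)%E).
    rewrite [leRHS]integral_mkcond; apply: ge0_le_integral => //.
    - by move=> r _; apply: integral_ge0.
    - apply: (@measurable_fun_fubini_tonelli_F _ _ _ _ _ P (fun p => (Zt p)%:E)) => //.
      exact/measurable_EFinP.
    - apply/(measurable_restrictT _ _).1 => //; exact: measurable_itv.
    move=> r _; rewrite patchE; case: ifPn => rt; last first.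
      rewrite integral0_eq// => w _; rewrite /Zt patchE.
      by case: ifPn => //; rewrite inE => -[/= rt' _]; move: rt; rewrite notin_setE.
    have rT : r \in `[0, T].
      by move: rt; rewrite inE/= !in_itv/= => /andP[-> rt]; rewrite (le_trans rt).
    have [hr hc] := hZ _ rT.
    apply: (@le_trans _ _ (\int[P]_w (1 + Z r w ^+ 2)%:E)%E).
      apply: ge0_le_integral => //.
      + by apply/measurable_EFinP; exact: (measurableT_comp mZt (pair1_measurable _)).
      + apply/measurable_EFinP; apply: measurable_funD => //; apply: measurable_funX; exact: hr.1.
      move=> w _; rewrite /Zt patchE; case: ifPn => _; rewrite lee_fin.
        have := sqr_ge0 (`|Z r w| - 1); have := normr_ge0 (Z r w).
        by rewrite -(real_normK (num_real (Z r w))) => ? ?; nra.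
      by rewrite addr_ge0// sqr_ge0.
    under eq_integral do rewrite EFinD.
    rewrite ge0_integralD//; last 2 first.
    - by move=> w _; rewrite lee_fin sqr_ge0.
    - apply/measurable_EFinP; apply: measurable_funX; exact: hr.1.
    rewrite second_momentE// EFinD; apply: leeD; last by rewrite lee_fin.
    by rewrite integral_cst// mul1e; exact: probability_le1.
  rewrite integral_cst//= lebesgue_measure_itv/= lte_fin.
  by case: ifPn => _; rewrite ?mule0 ?ltry// -EFinB -EFinM ltry.
have := integrable_ae measurableT i.
apply: filterS => w /= /(_ I) fin; apply/integrable_pathP.
by rewrite -ge0_fin_numE// integral_ge0.
Qed.

End integrable_paths.

(** * Asymptotics of the estimator *)

Section solution_average.
Context {R : realType} (T : R) (b : R -> R) (C : R -> set R) (l u : R -> R) (x0 : R).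
Hypothesis T_gt0 : 0 < T.
Hypothesis b_lip : lipschitz b.
Hypothesis C_itv : forall t, t \in `[0, T] -> C t = `[l t, u t]%classic.

Lemma skorokhod_reflection_rule z x y : skorokhod_solution b C T x0 z x y ->
  reflection_rule T l u x y.
Proof.
move=> sol; have [[cx cy bvy] [xC _ _ _]] := sol; split => //.
- by move=> t tT; have := xC t tT; rewrite C_itv//= in_itv.
- by move=> s t *; exact: (skorokhod_nondecreasing T_gt0 C_itv sol).
- by move=> s t *; exact: (skorokhod_nonincreasing T_gt0 C_itv sol).
Qed.

Variables (K : R -> R) (A B h t : R).
Hypothesis K_kernel : is_kernel K.
Hypothesis K_bounded : bounded_fun K.
Hypothesis A_ge0 : 0 <= A.
Hypothesis K_supp : [set v | K v != 0] = `]A, B[%classic.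
Hypothesis h_gt0 : 0 < h.
Hypothesis t_ge0 : 0 <= t.
Hypothesis thB : t + h * B <= T.
Local Notation leb := (@lebesgue_measure R).
Local Notation Kh r s := (scaled_kernel K h (s - r)).

(** Drift and reflection together make up [x - z]. *)
Lemma solution_averages z x y : skorokhod_solution b C T x0 z x y ->
  averages_increments K h t
    (fun r => \int[leb]_(s in `[0, T]) (Kh r s * b (x s)) +
       stieltjes_integral T y (fun s => Kh r s))
    (fun s => x s - z s).
Proof.
move=> [[cx cy bvy] [_ _ xE _]].
have [L L0 bL] := lipschitz_constant b_lip.
have cbx := lipschitz_comp_within L0 bL cx.
have a1 := drift_averages T_gt0 K_kernel K_bounded A_ge0 K_supp h_gt0 t_ge0 thB cbx.
have a2 := stieltjes_averages T_gt0 K_kernel K_bounded A_ge0 K_supp h_gt0 t_ge0 thB cy bvy.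
apply: (averages_increments_eq A_ge0 K_supp h_gt0 t_ge0 thB (averages_incrementsD 1 a1 a2)).
  by move=> r; rewrite mul1r.
move=> p q p0 pq qT.
rewrite (xE q) ?(xE p) ?in_itv/= ?p0 ?(le_trans pq qT) ?(le_trans p0 pq) ?qT//.
by rewrite !mul1r /comp; ring.
Qed.

Lemma kernel_average_dist g1 g2 V1 V2 (S : R) :
  averages_increments K h t g1 V1 -> averages_increments K h t g2 V2 ->
  (forall s, s \in `[0, T] -> `|V1 s - V2 s| <= S) ->
  `|\int[leb]_z (K z * (V1 (t + h * z) - V1 (h * z))) -
    \int[leb]_z (K z * (V2 (t + h * z) - V2 (h * z)))| <= 2 * S.
Proof.
move=> [_ i1 _] [_ i2 _] VS; have [mK K0 K1] := K_kernel.
have iK : leb.-integrable setT (EFin \o K).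
  apply/integrableP; split; first exact/measurable_EFinP.
  under eq_integral => v _ do rewrite /= ger0_norm//.
  by rewrite K1 ltry.
rewrite -RintegralB//; apply: (le_trans (le_normr_Rintegral _ _)) => //.
  exact: integrable_EFinB.
apply: (@le_trans _ _ (\int[leb]_z ((2 * S) * K z))).
  apply: le_Rintegral => //.
  - by apply: integrable_EFin_norm => //; exact: integrable_EFinB.
  - exact: integrable_EFinZ.
  - move=> z _; have [->|Kz] := eqVneq (K z) 0.
      by rewrite !mul0r subr0 normr0 mulr0.
    have [hz0 hzT] := kernel_window A_ge0 K_supp h_gt0 thB Kz.
    have V1' := VS (t + h * z); have V2' := VS (h * z).
    have {}V1' : `|V1 (t + h * z) - V2 (t + h * z)| <= S.
      by apply: V1'; rewrite in_itv/= hzT addr_ge0.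
    have {}V2' : `|V1 (h * z) - V2 (h * z)| <= S.
      by apply: V2'; rewrite in_itv/= hz0 (le_trans _ hzT)// lerDr.
    have -> : K z * (V1 (t + h * z) - V1 (h * z)) - K z * (V2 (t + h * z) - V2 (h * z)) =
       K z * ((V1 (t + h * z) - V2 (t + h * z)) - (V1 (h * z) - V2 (h * z))) by ring.
    have -> : forall a c : R, `|a * c| = `|a| * `|c| by move=> a c; exact: normrM.
    rewrite (ger0_norm (K0 z)) mulrC ler_wpM2r//.
    by rewrite (le_trans (ler_normB _ _))// mulr2n mulrDl mul1r lerD.
by rewrite RintegralZl// /Rintegral K1/= mulr1.
Qed.

(** The first order terms [h z a1] and [h z a0] integrate to the announced bias; the
    remainders are at most [e h B] on the support of [K]. *)
Lemma kernel_average_slope g x (a1 a0 e : R) : averages_increments K h t g x -> 0 <= e ->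
  (forall z, A < z -> z < B -> `|x (t + h * z) - x t - h * z * a1| <= e * (h * z)) ->
  (forall z, A < z -> z < B -> `|x (h * z) - x 0 - h * z * a0| <= e * (h * z)) ->
  `|h^-1 * (\int[leb]_z (K z * (x (t + h * z) - x (h * z))) - (x t - x 0))
    - (a1 - a0) * \int[leb]_(z in `[A, B]) (K z * z)| <= 2 * e * B.
Proof.
move=> [_ i _] e0 x1 x2; have [mK K0 K1] := K_kernel.
have iK : leb.-integrable setT (EFin \o K).
  apply/integrableP; split; first exact/measurable_EFinP.
  under eq_integral => v _ do rewrite /= ger0_norm//.
  by rewrite K1 ltry.
have KAB z : K z != 0 -> A < z < B.
  exact: kernel_support.
have ikz : leb.-integrable setT (EFin \o (fun z => K z * z)).
  apply: le_integrable (integrable_EFinZ _ B iK) => //.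
    by apply/measurable_EFinP; exact: measurable_funM.
  move=> z _ /=; rewrite lee_fin.
  have [->|/KAB/andP[Az zB]] := eqVneq (K z) 0; first by rewrite mul0r mulr0 normr0.
  have z0 : 0 <= z by rewrite (le_trans A_ge0)// ltW.
  have Kz0 : 0 <= K z * z by exact: mulr_ge0.
  have BK0 : 0 <= B * K z by rewrite mulr_ge0// (le_trans z0)// ltW.
  rewrite (ger0_norm Kz0) (ger0_norm BK0) mulrC ler_wpM2r// ltW//.
have -> : \int[leb]_(z in `[A, B]) (K z * z) = \int[leb]_z (K z * z).
  rewrite Rintegral_mkcond; apply: eq_Rintegral => z _; rewrite patchE.
  case: ifPn => // zAB; rewrite (kernel_AB K_supp zAB) mul0r//.
have hn0 : h != 0 by rewrite gt_eqF.
have E : h^-1 * (\int[leb]_z (K z * (x (t + h * z) - x (h * z))) - (x t - x 0))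
    - (a1 - a0) * \int[leb]_z (K z * z) =
    \int[leb]_z (h^-1 * (K z * (x (t + h * z) - x (h * z))) + - (h^-1 * (x t - x 0)) * K z
       + - (a1 - a0) * (K z * z)).
  rewrite RintegralD//; last 2 first.
  - by apply: integrable_EFinD => //; exact: integrable_EFinZ.
  - exact: integrable_EFinZ.
  rewrite RintegralD//; [|exact: integrable_EFinZ..].
  rewrite !RintegralZl//.
  have -> : \int[leb]_z K z = 1 by rewrite /Rintegral K1.
  by ring.
have iE : leb.-integrable setT (EFin \o (fun z => h^-1 * (K z * (x (t + h * z) - x (h * z)))
     + - (h^-1 * (x t - x 0)) * K z + - (a1 - a0) * (K z * z))).
  apply: integrable_EFinD => //; last exact: integrable_EFinZ.
  by apply: integrable_EFinD => //; exact: integrable_EFinZ.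
rewrite E; apply: (le_trans (le_normr_Rintegral _ _)) => //.
apply: (@le_trans _ _ (\int[leb]_z ((2 * e * B) * K z))); last first.
  by rewrite RintegralZl// /Rintegral K1/= mulr1.
apply: le_Rintegral => //.
- exact: integrable_EFin_norm.
- exact: integrable_EFinZ.
move=> z _; have [->|/KAB/andP[Az zB]] := eqVneq (K z) 0.
  by rewrite !(mul0r, mulr0) !addr0 normr0.
have -> : h^-1 * (K z * (x (t + h * z) - x (h * z))) + - (h^-1 * (x t - x 0)) * K z + - (a1 - a0) * (K z * z)
  = K z * (h^-1 * ((x (t + h * z) - x t - h * z * a1) - (x (h * z) - x 0 - h * z * a0))).
  by field.
have hV : 0 <= h^-1 by rewrite invr_ge0 ltW.
rewrite normrM (ger0_norm (K0 z)) mulrC ler_wpM2r//.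
rewrite normrM (ger0_norm hV) ler_pdivrMl//.
rewrite (le_trans (ler_normB _ _))//.
apply: (le_trans (lerD (x1 _ Az zB) (x2 _ Az zB))).
have -> : e * (h * z) + e * (h * z) = h * (2 * e * z) by ring.
by rewrite ler_pM2l// ler_wpM2l ?mulr_ge0// ltW.
Qed.

End solution_average.

Section powers_near_zero.
Context {R : realType}.

Lemma near_powR_lt (a delta : R) : 0 < a -> 0 < delta ->
  \forall eps \near (0 : R)^'+, eps `^ a < delta.
Proof.
move=> a0 d0; near=> eps.
have e0 : 0 < eps by near: eps; exact: nbhs_right_gt.
have -> : delta = (delta `^ a^-1) `^ a by rewrite -powRrM mulVf ?gt_eqF// powRr1// ltW.
apply: gt0_ltr_powR => //; rewrite ?nnegrE ?powR_ge0 ?(ltW e0)//.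
by near: eps; apply: nbhs_right_lt; exact: powR_gt0.
Unshelve. all: by end_near. Qed.

Lemma bandwidth_gt0 (H eps : R) : 0 < eps -> 0 < bandwidth H eps.
Proof. exact: powR_gt0. Qed.

Lemma rateE (H eps : R) : eps `^ (- (2 - H)^-1) = (bandwidth H eps)^-1.
Proof. by rewrite powRN. Qed.

Lemma noise_rateE (H eps : R) : 0 < eps ->
  eps `^ (- (2 - H)^-1) * eps = eps `^ (1 - (2 - H)^-1).
Proof.
move=> e0; rewrite -[X in _ * X]powRr1 ?(ltW e0)// -powRD; last by rewrite (gt_eqF e0) implybT.
by rewrite addrC.
Qed.

Lemma noise_rate_gt0 (H : R) : H < 1 -> 0 < 1 - (2 - H)^-1.
Proof.
move=> H1; have h : 0 < 2 - H by lra.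
rewrite subr_gt0 invf_lt1//; lra.
Qed.

Lemma variance_rate (H eps : R) : H < 1 -> 0 < eps ->
  eps `^ (1 - (2 - H)^-1) * Num.sqrt (bandwidth H eps `^ (2 * H - 1 - 1)) = 1.
Proof.
move=> H1 e0; have h : 2 - H != 0 by rewrite gt_eqF//; lra.
rewrite -powR12_sqrt ?powR_ge0// /bandwidth -!powRrM -powRD; last by rewrite (gt_eqF e0) implybT.
have -> : 1 - (2 - H)^-1 + (2 - H)^-1 * ((2 * H - 1 - 1) / 2) = 0 by field.
by rewrite powRr0.
Qed.

End powers_near_zero.

Section main_estimate.
Context d (Omega : measurableType d) (R : realType) (P : probability Omega R).
Variables (T H : R) (b : R -> R) (C : R -> set R) (l u : R -> R) (x0 : R).
Variables (BH : R -> {RV P >-> R}) (X Y : R -> R -> {RV P >-> R}) (x y K : R -> R) (A B t : R).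
Variable Z : R -> R -> Omega -> R.
Hypothesis T_gt0 : 0 < T.
Hypothesis H_gt : 2^-1 < H.
Hypothesis H_lt1 : H < 1.
Hypothesis b_lip : lipschitz b.
Hypothesis l_C1 : C1_on T l.
Hypothesis u_C1 : C1_on T u.
Hypothesis lu : forall t, t \in `[0, T] -> l t < u t.
Hypothesis C_itv : forall t, t \in `[0, T] -> C t = `[l t, u t]%classic.
Hypothesis BH_fbm : fractional_brownian_motion T H BH.
Hypothesis XY_sol : forall eps, 0 < eps -> forall w,
  skorokhod_solution b C T x0 (fun t => eps * BH t w)
    (fun t => X eps t w) (fun t => Y eps t w).
Hypothesis xy_sol : skorokhod_solution b C T x0 (fun=> 0) x y.
Hypothesis K_kernel : is_kernel K.
Hypothesis K_bounded : bounded_fun K.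
Hypothesis AB : A < B.
Hypothesis K_supp : [set v | K v != 0] = `]A, B[%classic.
Hypothesis Z_wiener : forall eps, 0 < eps ->
  is_kernel_wiener_process T H BH K (bandwidth H eps) (Z eps).
Hypothesis A_ge0 : 0 <= A.
Hypothesis t_E : E_set T l u C x t.
Hypothesis t_lt : t \in `[0, T[.

Local Notation leb := (@lebesgue_measure R).
Local Notation h eps := (bandwidth H eps).

Let t_ge0 : 0 <= t. Proof. by move: t_lt; rewrite in_itv/= => /andP[]. Qed.
Let t_ltT : t < T. Proof. by move: t_lt; rewrite in_itv/= => /andP[]. Qed.
Let B_gt0 : 0 < B. Proof. exact: le_lt_trans AB. Qed.

Lemma near_bandwidth (delta : R) : 0 < delta ->
  \forall eps \near (0 : R)^'+, h eps < delta.
Proof.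
by apply: near_powR_lt; rewrite invr_gt0 subr_gt0; move: H_lt1; lra.
Qed.

Lemma near_admissible : \forall eps \near (0 : R)^'+, 0 < eps /\ t + h eps * B <= T.
Proof.
near=> eps; split; first by near: eps; exact: nbhs_right_gt.
rewrite -lerBrDl -ler_pdivlMr//; apply: ltW; near: eps.
by apply: near_bandwidth; rewrite divr_gt0// subr_gt0.
Unshelve. all: by end_near. Qed.

(** The average of the increments of [X eps - eps * BH], i.e. of drift plus
    reflection of the perturbed equation. *)
Definition noiseless_average eps w : R :=
  \int[leb]_z (K z * ((X eps (t + h eps * z) w - eps * BH (t + h eps * z) w)
                      - (X eps (h eps * z) w - eps * BH (h eps * z) w))).

Definition good_paths eps : set Omega :=
  [set w | leb.-integrable `[0, t] (EFin \o (fun r => Z eps r w))].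

Lemma trend_estimator_gamma eps w : 0 < eps -> t + h eps * B <= T ->
  trend_estimator T b K (h eps) eps (X eps) (Y eps) (Z eps) t w - gamma eps (Z eps) t w
  = noiseless_average eps w * \1_(good_paths eps) w.
Proof.
move=> e0 thB; have h0 := bandwidth_gt0 H e0.
have av := solution_averages T_gt0 b_lip K_kernel K_bounded A_ge0 K_supp h0 t_ge0 thB (XY_sol e0 w).
have [mZ _] := Z_wiener e0.
have := noisy_average e0 av (measurable_path (ltW t_ltT) mZ w).
rewrite /trend_estimator /gamma => eqn.
transitivity (if `[< leb.-integrable `[0, t] (EFin \o (fun r => Z eps r w)) >]
  then noiseless_average eps w else 0).
  rewrite -eqn; congr (_ - _).
  by apply: eq_Rintegral => r _; rewrite addrAC.
rewrite indicE; case: asboolP => gw.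
  by rewrite mem_set// mulr1.
by rewrite memNset// mulr0.
Qed.

Lemma trendE : trend b x y x0 t = x t - x 0.
Proof.
have [_ [_ y0 xE _]] := xy_sol.
have tT : t \in `[0, T] by rewrite in_itv/= t_ge0 ltW.
have zT : 0 \in `[0, T] by rewrite in_itv/= lexx ltW.
by rewrite /trend (xE t tT) (xE 0 zT) set_itv1 Rintegral_set1 y0; ring.
Qed.

(** The deterministic part of the error. *)
Lemma bias_slope_limit (eta : R) : 0 < eta -> \forall eps \near (0 : R)^'+,
  `|(h eps)^-1 * (\int[leb]_z (K z * (x (t + h eps * z) - x (h eps * z))) - (x t - x 0))
    - trend_bias b x y K A B t| <= eta.
Proof.
move=> eta0; have [[cx cy bvy] [xC y0 xE _]] := xy_sol.
have [L L0 bL] := lipschitz_constant b_lip.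
have rule := skorokhod_reflection_rule T_gt0 C_itv xy_sol.
have xE' r : r \in `[0, T] -> x r = \int[leb]_(s in `[0, r]) b (x s) + y r.
  by move=> rT; rewrite xE// addr0.
have sl := solution_slope T_gt0 L0 bL l_C1 u_C1 lu C_itv rule cx xE'.
have zT : 0 \in `[0, T[ by rewrite in_itv/= lexx.
have st := sl t t_lt (or_intror t_E); have s0 := sl 0 zT (or_introl erefl).
pose e := eta / (2 * B).
have e0 : 0 < e by rewrite divr_gt0// mulr_gt0.
have [d1 d10 h1] := st e e0; have [d2 d20 h2] := s0 e e0.
near=> eps.
have [eps0 thB] : 0 < eps /\ t + h eps * B <= T by near: eps; exact: near_admissible.
have h0 := bandwidth_gt0 H eps0.
have hd1 : h eps * B < d1.
  by rewrite -ltr_pdivlMr//; near: eps; apply: near_bandwidth; rewrite divr_gt0.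
have hd2 : h eps * B < d2.
  by rewrite -ltr_pdivlMr//; near: eps; apply: near_bandwidth; rewrite divr_gt0.
have av := solution_averages T_gt0 b_lip K_kernel K_bounded A_ge0 K_supp h0 t_ge0 thB xy_sol.
have hz z : A < z -> z < B -> [/\ 0 < h eps * z, h eps * z < h eps * B & t + h eps * z <= T].
  move=> Az zB; split; first by rewrite mulr_gt0// (le_lt_trans A_ge0).
    by rewrite ltr_pM2l.
  by rewrite (le_trans _ thB)// lerD2l ler_pM2l// ltW.
have -> : eta = 2 * e * B by rewrite /e; field; rewrite gt_eqF.
rewrite /trend_bias.
have -> : b (x t) - b (x 0) + path_derivative y t - path_derivative y 0 =
  (b (x t) + path_derivative y t) - (b (x 0) + path_derivative y 0) by ring.
have av' : averages_increments K (h eps) t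
    (fun r => \int[leb]_(s in `[0, T]) (scaled_kernel K (h eps) (s - r) * b (x s)) +
       stieltjes_integral T y (fun s => scaled_kernel K (h eps) (s - r))) x.
  apply: (averages_increments_eq A_ge0 K_supp h0 t_ge0 thB av) => // p q _ _ _.
  by rewrite !subr0.
apply: (kernel_average_slope K_kernel A_ge0 K_supp h0 av' (ltW e0)) => z Az zB.
  have [hz0 hzB hzT] := hz z Az zB.
  have := h1 (t + h eps * z); rewrite addrAC subrr add0r (gtr0_norm hz0); apply.
    by rewrite in_itv/= hzT addr_ge0// ltW.
  exact: lt_trans hd1.
have [hz0 hzB hzT] := hz z Az zB.
have := h2 (h eps * z); rewrite subr0 (gtr0_norm hz0); apply.
  by rewrite in_itv/= (ltW hz0) (le_trans _ hzT)// lerDr.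
exact: lt_trans hd2.
Unshelve. all: by end_near. Qed.

(** [X eps - eps * BH] differs from [x] by a multiple of [eps] times the supremum
    of the noise, by stability of the reflected equation. *)
Lemma noiseless_average_stability : exists2 c : R, 0 < c & forall eps w (S : R),
  0 < eps -> t + h eps * B <= T -> (forall s, s \in `[0, T] -> `|BH s w| <= S) ->
  `|noiseless_average eps w - \int[leb]_z (K z * (x (t + h eps * z) - x (h eps * z)))|
   <= c * (eps * S).
Proof.
have [L L0 bL] := lipschitz_constant b_lip.
exists (2 * (4 * expR (4 * L * T) + 1)).
  by rewrite mulr_gt0// ltr_wpDl// mulr_ge0// expR_ge0.
move=> eps w S e0 thB BS; have h0 := bandwidth_gt0 H e0.
have [[cx _ _] [_ y0 xE _]] := xy_sol.
have [[cX _ _] [_ Y0 XE _]] := XY_sol e0 w.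
have r1 := skorokhod_reflection_rule T_gt0 C_itv (XY_sol e0 w).
have r2 := skorokhod_reflection_rule T_gt0 C_itv xy_sol.
have zT : 0 \in `[0, T] by rewrite in_itv/= lexx ltW.
have S0 : 0 <= S by rewrite (le_trans _ (BS 0 zT)).
have eB s : s \in `[0, T] -> `|eps * BH s w - 0| <= eps * S.
  by move=> sT; rewrite subr0 normrM gtr0_norm// ler_pM2l// BS.
have Y0y : Y eps 0 w = y 0 by rewrite Y0 y0.
have stab := reflected_stability T_gt0 L0 bL r1 r2 cX cx Y0y XE xE
  (mulr_ge0 (ltW e0) S0) eB.
have av1 := solution_averages T_gt0 b_lip K_kernel K_bounded A_ge0 K_supp h0 t_ge0 thB (XY_sol e0 w).
have av2 := solution_averages T_gt0 b_lip K_kernel K_bounded A_ge0 K_supp h0 t_ge0 thB xy_sol.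
have dist s : s \in `[0, T] -> `|(X eps s w - eps * BH s w) - (x s - 0)| <=
    (4 * expR (4 * L * T) + 1) * (eps * S).
  move=> sT.
  have -> : X eps s w - eps * BH s w - (x s - 0) = (X eps s w - x s) - (eps * BH s w - 0) by ring.
  rewrite (le_trans (ler_normB _ _))// mulrDl mul1r lerD ?eB//.
  by rewrite (le_trans (stab s sT))// mulrAC.
have := kernel_average_dist K_kernel A_ge0 K_supp h0 t_ge0 thB av1 av2 dist.
rewrite mulrA; apply: le_trans; rewrite le_eqVlt; apply/orP; left; apply/eqP.
by congr `|_ - _|; apply: eq_Rintegral => z _; rewrite !subr0.
Qed.

Definition rescaled_error eps w : R :=
  eps `^ (- (2 - H)^-1) *
    (trend_estimator T b K (h eps) eps (X eps) (Y eps) (Z eps) t w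
     - trend b x y x0 t - gamma eps (Z eps) t w).

Lemma rescaled_errorE eps w : 0 < eps -> t + h eps * B <= T ->
  rescaled_error eps w =
  (h eps)^-1 * (noiseless_average eps w * \1_(good_paths eps) w - (x t - x 0)).
Proof.
move=> e0 thB; rewrite /rescaled_error rateE -trendE -trend_estimator_gamma//.
by congr (_ * _); ring.
Qed.

Lemma measurable_rescaled_error eps : 0 < eps -> t + h eps * B <= T ->
  measurable_fun setT (rescaled_error eps).
Proof.
move=> e0 thB; rewrite (funext (fun w => rescaled_errorE w e0 thB)).
have [mK _ _] := K_kernel; have [mZ _] := Z_wiener e0.
apply: measurable_funM => //; apply: measurable_funB => //; apply: measurable_funM.
  have [_ _ _ cB] := BH_fbm.
  apply: (measurable_path_average (V := fun s w => X eps s w - eps * BH s w)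
     T_gt0 A_ge0 mK K_supp (bandwidth_gt0 H e0) t_ge0 thB).
  - move=> s _; apply: measurable_funB; first exact: measurable_funP.
    by apply: measurable_funM => //; exact: measurable_funP.
  - move=> w; have [[cX _ _] _] := XY_sol e0 w.
    by move=> s; apply: cvgB; [exact: cX|apply: cvgMr; exact: cB].
apply: measurable_indic; exact: (measurable_integrable_paths (ltW t_ltT) mZ).
Qed.

Lemma ae_good_paths eps : 0 < eps -> {ae P, forall w, good_paths eps w}.
Proof.
move=> e0; have h0 := bandwidth_gt0 H e0; have [mZ _] := Z_wiener e0.
have [c _ hc] := kernel_wiener_second_moment_bound T_gt0 H_gt BH_fbm K_kernel K_bounded
  h0 (Z_wiener e0).
suff good : {ae P, forall w, leb.-integrable `[0, t] (EFin \o (fun r => Z eps r w))} by exact: good.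
apply: (ae_integrable_paths (c := c) (ltW t_ltT) mZ) => r rT; split; last exact: hc.
exact: (kernel_wiener_square_integrable T_gt0 H_gt BH_fbm K_kernel K_bounded (Z_wiener e0) rT).
Qed.

(** Divided by the bandwidth, the stability bound is of order
    [eps `^ (1 - (2 - H)^-1)] times the supremum of the noise. *)
Lemma rescaled_error_second_moment : exists2 c : R, 0 <= c & forall eta, 0 < eta ->
  \forall eps \near (0 : R)^'+,
  square_integrable P (fun w => rescaled_error eps w - trend_bias b x y K A B t) /\
  second_moment P (fun w => rescaled_error eps w - trend_bias b x y K A B t) <=
    2 * eta ^+ 2 + c * (eps `^ (1 - (2 - H)^-1)) ^+ 2.
Proof.
have [G [mG G0 IG GB]] := fbm_sup_square T_gt0 H_gt BH_fbm.
have [c c0 stab] := noiseless_average_stability.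
pose g := fine (\int[P]_w G w)%E.
have gE : (\int[P]_w G w = g%:E)%E.
  by rewrite /g fineK// ge0_fin_numE// integral_ge0.
have g0 : 0 <= g by rewrite -lee_fin -gE integral_ge0.
exists (2 * c ^+ 2 * g); first by rewrite mulr_ge0// mulr_ge0// sqr_ge0.
move=> eta eta0; near=> eps.
have [e0 thB] : 0 < eps /\ t + h eps * B <= T by near: eps; exact: near_admissible.
have h0 := bandwidth_gt0 H e0.
have bias : `|(h eps)^-1 * (\int[leb]_z (K z * (x (t + h eps * z) - x (h eps * z))) - (x t - x 0))
    - trend_bias b x y K A B t| <= eta by near: eps; exact: bias_slope_limit.
pose D w := rescaled_error eps w - trend_bias b x y K A B t.
pose rho := eps `^ (1 - (2 - H)^-1).
have rho0 : 0 < rho by exact: powR_gt0.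
pose k := 2 * c ^+ 2 * rho ^+ 2; have kp : 0 < k by rewrite !mulr_gt0 ?exprn_gt0.
have k0 := ltW kp.
have mD : measurable_fun setT D.
  by apply: measurable_funB => //; exact: measurable_rescaled_error.
have mD2 : measurable_fun setT (fun w => (D w ^+ 2)%:E).
  by apply/measurable_EFinP; exact: measurable_funX.
have bound : (\int[P]_w (D w ^+ 2)%:E <= (2 * eta ^+ 2 + k * g)%:E)%E.
  apply: (@le_trans _ _ (\int[P]_w ((2 * eta ^+ 2)%:E + k%:E * G w))%E); last first.
    rewrite ge0_integralD//; last 3 first.
    - by move=> w _; rewrite lee_fin mulr_ge0// sqr_ge0.
    - by move=> w _; rewrite mule_ge0.
    - exact: measurable_funeM.
    rewrite ge0_integralZl// gE -EFinM EFinD leeD2r// integral_cst//.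
    rewrite -[leRHS]mule1; apply: lee_wpmul2l; last exact: probability_le1.
    by rewrite lee_fin mulr_ge0// sqr_ge0.
  apply: ae_ge0_le_integral => //.
  - by move=> w _; rewrite lee_fin sqr_ge0.
  - by move=> w _; rewrite adde_ge0 ?mule_ge0// lee_fin mulr_ge0// sqr_ge0.
  - by apply: emeasurable_funD => //; exact: measurable_funeM.
  apply: filterS (ae_good_paths e0) => w gw _.
  have := G0 w; have := GB w; case: (G w) => [s|_ _|//]; last first.
    (* an infinite supremum bound makes the inequality trivial, as k > 0 *)
    by rewrite gt0_muley ?lte_fin// addey// leey.
  move=> Bs s0; rewrite -EFinM -EFinD lee_fin /D rescaled_errorE// indicE mem_set// mulr1.
  have BS r : r \in `[0, T] -> `|BH r w| <= Num.sqrt s.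
    move=> rT; rewrite -sqrtr_sqr ler_wsqrtr//.
    by have := Bs _ rT; rewrite lee_fin.
  have st := stab eps w (Num.sqrt s) e0 thB BS.
  have hV : 0 <= (h eps)^-1 by rewrite invr_ge0 ltW.
  set I := \int[leb]_z _ in bias st.
  set a := (h eps)^-1 * (noiseless_average eps w - I).
  set e := (h eps)^-1 * (I - (x t - x 0)) - _ in bias.
  have -> : (h eps)^-1 * (noiseless_average eps w - (x t - x 0)) - trend_bias b x y K A B t = a + e.
    by rewrite /a /e; ring.
  have a2 : a ^+ 2 <= c ^+ 2 * rho ^+ 2 * s.
    have -> : c ^+ 2 * rho ^+ 2 * s = (c * rho * Num.sqrt s) ^+ 2.
      by rewrite !exprMn sqr_sqrtr// -lee_fin.
    rewrite -real_normK ?num_real// ler_sqr ?nnegrE//; last first.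
      by rewrite mulr_ge0 ?sqrtr_ge0// mulr_ge0// ltW.
    have -> : c * rho * Num.sqrt s = (h eps)^-1 * (c * (eps * Num.sqrt s)).
      by rewrite /rho -noise_rateE// rateE; ring.
    by rewrite /a normrM (ger0_norm hV) ler_wpM2l.
  have e2 : e ^+ 2 <= eta ^+ 2.
    by rewrite -real_normK ?num_real// ler_sqr ?nnegrE// ltW.
  have -> : (a + e) ^+ 2 = 2 * a ^+ 2 + 2 * e ^+ 2 - (a - e) ^+ 2 by ring.
  have -> : k * s = 2 * (c ^+ 2 * rho ^+ 2 * s) by rewrite /k; ring.
  by move: (sqr_ge0 (a - e)) a2 e2; lra.
split.
  split => //; apply/integrableP; split => //.
  apply: (@le_lt_trans _ _ (\int[P]_w (D w ^+ 2)%:E)%E).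
    rewrite le_eqVlt; apply/orP; left; apply/eqP; apply: eq_integral => w _ /=.
    by rewrite ger0_norm// sqr_ge0.
  by rewrite (le_lt_trans bound)// ltry.
rewrite /second_moment /Rintegral.
rewrite (_ : 2 * c ^+ 2 * g * rho ^+ 2 = k * g); last by rewrite /k; ring.
rewrite -lee_fin fineK// ge0_fin_numE; first by rewrite (le_lt_trans bound)// ltry.
by apply: integral_ge0 => w _; rewrite lee_fin sqr_ge0.
Unshelve. all: by end_near. Qed.

Lemma rescaled_error_L2 : cvg_L2 P 0^'+ rescaled_error (fun=> trend_bias b x y K A B t).
Proof.
have [c c0 hc] := rescaled_error_second_moment.
set mu := trend_bias b x y K A B t in hc *.
have sq : \forall eps \near (0 : R)^'+, square_integrable P (fun w => rescaled_error eps w - mu).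
  by apply: filterS (hc 1 ltr01) => eps [].
split.
- by apply/Lfun2P; exact: square_integrable_cst.
- apply: filterS sq => eps heps; apply/Lfun2P.
  have := square_integrableD heps (square_integrable_cst P mu).
  by under eq_fun do rewrite subrK.
- have LE : \forall eps \near (0 : R)^'+, Lnorm P 2%:E (EFin \o (rescaled_error eps \- (fun=> mu))) =
      (Num.sqrt (second_moment P (fun w => rescaled_error eps w - mu)))%:E.
    by apply: filterS sq => eps heps; rewrite -Lnorm2_second_moment.
  apply/fine_cvgP; split; first by apply: filterS LE => eps ->.
  apply/cvgrPdist_le => e e0.
  have e2 : 0 < e / 2 by rewrite divr_gt0.
  have c1 : 0 < c + 1 by rewrite ltr_wpDl.
  pose delta := e / (2 * (c + 1)).
  near=> eps.
  have -> : (fine \o (fun eps => Lnorm P 2%:E (EFin \o (rescaled_error eps \- (fun=> mu))))) eps =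
      Num.sqrt (second_moment P (fun w => rescaled_error eps w - mu)).
    by rewrite /=; have -> // : Lnorm P 2%:E (EFin \o (rescaled_error eps \- (fun=> mu))) =
      (Num.sqrt (second_moment P (fun w => rescaled_error eps w - mu)))%:E; near: eps; exact: LE.
  rewrite sub0r normrN ger0_norm ?sqrtr_ge0//.
  rewrite -(ger0_norm (ltW e0)) -sqrtr_sqr ler_wsqrtr//.
  have [_ h1] : square_integrable P (fun w => rescaled_error eps w - mu) /\
    second_moment P (fun w => rescaled_error eps w - mu) <=
    2 * (e / 2) ^+ 2 + c * (eps `^ (1 - (2 - H)^-1)) ^+ 2 by near: eps; exact: hc.
  have r : eps `^ (1 - (2 - H)^-1) < Num.sqrt (e ^+ 2 / (2 * (c + 1))).
    near: eps; apply: near_powR_lt; first exact: noise_rate_gt0.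
    by rewrite sqrtr_gt0 divr_gt0 ?exprn_gt0// mulr_gt0.
  have r2 : (eps `^ (1 - (2 - H)^-1)) ^+ 2 <= e ^+ 2 / (2 * (c + 1)).
    have q0 : 0 <= e ^+ 2 / (2 * (c + 1)) by rewrite divr_ge0 ?sqr_ge0// mulr_ge0// ltW.
    by rewrite -(sqr_sqrtr q0) ler_sqr ?nnegrE ?powR_ge0 ?sqrtr_ge0// ltW.
  have cr : c * (eps `^ (1 - (2 - H)^-1)) ^+ 2 <= e ^+ 2 / 2.
    apply: (@le_trans _ _ ((c + 1) * (e ^+ 2 / (2 * (c + 1))))).
      by rewrite ler_pM ?sqr_ge0// lerDl.
    by rewrite le_eqVlt; apply/orP; left; apply/eqP; field; rewrite gt_eqF.
  have -> : e ^+ 2 = 2 * (e / 2) ^+ 2 + e ^+ 2 / 2 by field.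
  by rewrite (le_trans h1)// lerD2l.
Unshelve. all: by end_near. Qed.

Lemma rescaled_noise_law : cvg_in_law P 0^'+
  (fun eps w => eps `^ (- (2 - H)^-1) * gamma_dot eps (Z eps) t w)
  (normal_prob 0 (Num.sqrt (limit_variance H K A B))).
Proof.
have tT : t \in `[0, T] by rewrite in_itv/= t_ge0 ltW.
split.
  near=> eps; have e0 : 0 < eps by near: eps; exact: nbhs_right_gt.
  apply: measurable_funM => //; apply: measurable_funM => //.
  exact: (kernel_wiener_square_integrable T_gt0 H_gt BH_fbm K_kernel K_bounded (Z_wiener e0) tT).1.
move=> phi cphi [M [Mr phiM]]; apply: cvg_near_cst; near=> eps.
have [e0 thB] : 0 < eps /\ t + h eps * B <= T by near: eps; exact: near_admissible.
have bphi v : `|phi v| <= `|M| + 1.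
  by apply: phiM => //; rewrite (le_lt_trans (ler_norm M))// ltrDl.
have h0 := bandwidth_gt0 H e0.
rewrite -(kernel_wiener_law T_gt0 H_gt H_lt1 BH_fbm K_kernel K_bounded AB A_ge0 K_supp h0
  (Z_wiener e0) t_ge0 thB cphi bphi (variance_rate H_lt1 e0)).
rewrite unlock; apply: eq_integral => w _ /=.
by rewrite /gamma_dot mulrA noise_rateE.
Unshelve. all: by end_near. Qed.

End main_estimate.
Theorem proposition3p8 (R : realType) (d : measure_display)
  (Omega : measurableType d) (P : probability Omega R)
  (T : R) (T_gt0 : 0 < T)
  (H : R) (H_gt : 2^-1 < H) (H_lt1 : H < 1)
  (b : R -> R) (b_lip : lipschitz b)
  (C : R -> set R) (C_lip : lipschitz_multifunction T C)
  (l u : R -> R) (l_C1 : C1_on T l) (u_C1 : C1_on T u)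
  (lu : forall t, t \in `[0, T] -> l t < u t)
  (C_itv : forall t, t \in `[0, T] -> C t = `[l t, u t]%classic)
  (x0 : R) (x0_C : C 0 x0)
  (BH : R -> {RV P >-> R}) (BH_fbm : fractional_brownian_motion T H BH)
  (X Y : R -> R -> {RV P >-> R})
  (XY_sol : forall eps, 0 < eps -> forall w,
     skorokhod_solution b C T x0 (fun t => eps * BH t w)
       (fun t => X eps t w) (fun t => Y eps t w))
  (x y : R -> R) (xy_sol : skorokhod_solution b C T x0 (fun=> 0) x y)
  (K : R -> R) (K_kernel : is_kernel K) (K_bounded : bounded_fun K)
  (A B : R) (AB : A < B) (K_supp : [set v | K v != 0] = `]A, B[%classic)
  (Z : R -> R -> Omega -> R)
  (Z_wiener : forall eps, 0 < eps ->
     is_kernel_wiener_process T H BH K (bandwidth H eps) (Z eps))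
  (A_ge0 : 0 <= A)
  (t : R) (t_E : E_set T l u C x t) (t_lt : t \in `[0, T[) :
  cvg_L2 P 0^'+
    (fun eps w => eps `^ (- (2 - H)^-1) *
       (trend_estimator T b K (bandwidth H eps) eps (X eps) (Y eps) (Z eps) t w
        - trend b x y x0 t - gamma eps (Z eps) t w))
    (fun=> trend_bias b x y K A B t)
  /\
  cvg_in_law P 0^'+
    (fun eps w => eps `^ (- (2 - H)^-1) * gamma_dot eps (Z eps) t w)
    (normal_prob 0 (Num.sqrt (limit_variance H K A B))).
Proof.
split.
- exact: (rescaled_error_L2 T_gt0 H_gt H_lt1 b_lip l_C1 u_C1 lu C_itv BH_fbm XY_sol xy_sol
    K_kernel K_bounded AB K_supp Z_wiener A_ge0 t_E t_lt).
- exact: (rescaled_noise_law T_gt0 H_gt H_lt1 BH_fbm K_kernel K_bounded AB K_supp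
    Z_wiener A_ge0 t_lt).
Qed.
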